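(* Let $\Gamma$ be fixed data with cluster variety $\mathcal A$. For each seed $\mathbf s=(e_1,\dots,e_n)$, let the (Fock–Goncharov) cluster chamber associated to $\mathbf s$ be $$\mathcal C^+_{\mathbf s}:=\{x\in\mathcal A^\vee(\mathbb R^T)\mid (z^{e_i})^T(x)\le 0\text{ for all } i\in I_{uf}\}.$$ The collection $\Delta^+$ of such subsets of $\mathcal A^\vee(\mathbb R^T)$ over all mutation equivalent seeds form the maximal cones of a simplicial fan (of not necessarily strictly convex cones), the (Fock–Goncharov) cluster complex. The Fomin–Zelevinsky exchange graph is the dual graph of this fan.
   Context: Put $[a]_+=\max(a,0)$. FIXED DATA $\Gamma$: a lattice $N$ of rank $n$ with a skew-symmetric form $\{\cdot,\cdot\}:N\times N\to\mathbb Q$; a saturated sublattice $N_{uf}\subseteq N$; $I=\{1,\dots,n\}\supseteq I_{uf}$ with $|I_{uf}|=\operatorname{rank}N_{uf}$; positive integers $d_i$ ($i\in I$) with gcd $1$; a finite-index sublattice $N^\circ\subseteq N$ with $\{N_{uf},N^\circ\}\subseteq\mathbb Z$ and $\{N,N_{uf}\cap N^\circ\}\subseteq\mathbb Z$. $M^\circ=\operatorname{Hom}(N^\circ,\mathbb Z)$. A seed is a basis $\mathbf s=(e_i)_{i\in I}$ of $N$ with $(e_i)_{i\in I_{uf}}$ a basis of $N_{uf}$ and $(d_ie_i)_{i\in I}$ a basis of $N^\circ$; $\epsilon_{ij}=\{e_i,e_j\}d_j$; $v_i=\{e_i,\cdot\}\in M^\circ$ for $i\in I_{uf}$, assumed non-zero.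 Mutation at $k\in I_{uf}$: $\mu_k(\mathbf s)=(e_i')$, $e_k'=-e_k$, $e_i'=e_i+[\epsilon_{ik}]_+e_k$ for $i\neq k$. A mutation class of seeds is part of $\Gamma$; ''seed'' means a member of it. The space $\mathcal A^\vee(\mathbb R^T)$ of max-plus tropical points of the Fock–Goncharov dual of $\mathcal A$ is obtained from one copy of $M^\circ_{\mathbb R}=M^\circ\otimes\mathbb R$ for each seed by identifying the copies of $\mathbf s$ and $\mu_k(\mathbf s)$ via the piecewise linear bijection $T_k(m)=m+[\langle d_ke_k,m\rangle]_+v_k$ ($e_k,v_k$ from $\mathbf s$). So each seed identifies $\mathcal A^\vee(\mathbb R^T)$ with $M^\circ_{\mathbb R}$. In the identification given by $\mathbf s=(e_i)$ one has $(z^{e_i})^T(x)=-\langle e_i,x\rangle$, so that $\mathcal C^+_{\mathbf s}=\{x\in M^\circ_{\mathbb R}:\langle e_i,x\rangle\ge0\ \forall i\in I_{uf}\}$. The fan assertion means: in the identification $\mathcal A^\vee(\mathbb R^T)=M^\circ_{\mathbb R}$ given by any seed, the sets $\mathcal C^+_{\mathbf s'}$ are the maximal cones of a simplicial fan. EXCHANGE GRAPH. To the initial seed attach independent cluster variables $A_1,\dots,A_n$; mutation at $k\in I_{uf}$ replaces $A_k$ by $A_k'$ with $A_kA_k'=\prod_iA_i^{[\epsilon_{ki}]_+}+\prod_iA_i^{[-\epsilon_{ki}]_+}$ and leaves the other $A_i$ unchanged. The vertices of the exchange graph are the pairs (cluster $(A_i)$, exchange matrix $(\epsilon_{ij})$)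 arising from mutation sequences, modulo simultaneous renumbering, and the edges correspond to mutations. The dual graph of the fan has the maximal cones as vertices and an edge for each pair of maximal cones sharing a codimension-one face. *)

(* Defs.v *)
From HB Require Import structures.
From mathcomp Require Import all_boot all_order all_algebra all_fingroup.
From mathcomp Require Import classical_sets functions reals.
From mathcomp Require Import mpoly.

Set Implicit Arguments.
Unset Strict Implicit.
Unset Printing Implicit Defensive.

Import Order.TTheory GRing.Theory Num.Theory.
Local Open Scope classical_set_scope.
Local Open Scope ring_scope.

(** * Fixed data and seeds

    The lattice [N] is ['rV[int]_n], the index set [I] is ['I_n], and the
    rational skew-symmetric form on [N] is given by its Gram matrix. *)

Definition zbasis n (J : finType) (b : J -> 'rV[int]_n)
    (L : {pred 'rV[int]_n}) : Prop :=
  (forall j, b j \in L) /\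
  (forall x, x \in L -> exists! c : {ffun J -> int}, x = \sum_j c j *: b j).

Definition saturated n (L : {pred 'rV[int]_n}) : Prop :=
  forall (a : int) x, a != 0 -> a *: x \in L -> x \in L.

Definition finite_index n (L : {pred 'rV[int]_n}) : Prop :=
  exists reps : seq 'rV[int]_n, forall x, exists2 y, y \in reps & x - y \in L.

Definition gram_form n (B : 'M[rat]_n) (x y : 'rV[int]_n) : rat :=
  (map_mx intr x *m B *m (map_mx intr y)^T) 0 0.

Record fixed_data (n : nat) := FixedData {
  gram : 'M[rat]_n;
  gram_skew : gram^T = - gram;
  Nuf : {pred 'rV[int]_n};
  Nuf_zmod : GRing.zmod_closed Nuf;
  Nuf_saturated : saturated Nuf;
  Iuf : {set 'I_n};
  Nuf_rank : exists b : 'I_#|Iuf| -> 'rV[int]_n, zbasis b Nuf;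
  dmul : 'I_n -> nat;
  dmul_gt0 : forall i, (0 < dmul i)%N;
  dmul_gcd : (\big[gcdn/0]_(i < n) dmul i = 1)%N;
  Ncirc : {pred 'rV[int]_n};
  Ncirc_zmod : GRing.zmod_closed Ncirc;
  Ncirc_index : finite_index Ncirc;
  form_Nuf_Ncirc : forall x y, x \in Nuf -> y \in Ncirc ->
    gram_form gram x y \is a Num.int;
  form_N_NufNcirc : forall x y, y \in Nuf -> y \in Ncirc ->
    gram_form gram x y \is a Num.int
}.

(** Directions of mutation, i.e. the elements of [Iuf]. *)
Definition direction n (G : fixed_data n) := {k : 'I_n | k \in Iuf G}.

Definition is_seed n (G : fixed_data n) (e : 'I_n -> 'rV[int]_n) : Prop :=
  [/\ zbasis e predT,
      zbasis (fun k : direction G => e (val k)) (Nuf G)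
    & zbasis (fun i => e i *+ dmul G i) (Ncirc G)].

Definition exchange_matrix n (G : fixed_data n) (e : 'I_n -> 'rV[int]_n) :
    'M[rat]_n :=
  \matrix_(i, j) (gram_form (gram G) (e i) (e j) * (dmul G j)%:R).

(** [q]_+ as a natural number.  It is only used for integral [q], namely for
    entries of exchange matrices with at least one index in [Iuf]; [Num.truncn]
    is 0 on negative arguments. *)
Definition pospart (q : rat) : nat := Num.truncn q.

Definition mutate n (G : fixed_data n) (k : direction G)
    (e : 'I_n -> 'rV[int]_n) : 'I_n -> 'rV[int]_n :=
  fun i => if i == val k then - e (val k)
           else e i + e (val k) *+ pospart (exchange_matrix G e i (val k)).

(** The functional [{e, .}] in the coordinates dual to those of [N]. *)
Definition covector n (G : fixed_data n) (e : 'rV[int]_n) : 'rV[rat]_n :=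
  map_mx intr e *m gram G.

(** Mutation of lattice bases is not involutive, and the same basis can be
    reached by two mutation sequences along which the composites of the tropical
    gluing maps differ (for type A_2, the sequence 1,2,1,2 returns to the initial
    basis but not to the initial cluster).  The members of the mutation class of
    [s] are therefore indexed by mutation sequences [w] and not by bases. *)
Definition seed_at n (G : fixed_data n) (s : 'I_n -> 'rV[int]_n)
    (w : seq (direction G)) : 'I_n -> 'rV[int]_n :=
  foldl (fun e k => mutate k e) s w.

(** * Tropical points of the Fock-Goncharov dual

    Since [Ncirc] has finite index in [N], [Hom(Ncirc, Z)] tensored with [R] is
    the space of additive maps from [N] to [R], i.e. ['rV[R]_n] through the
    pairing below. *)

Definition pairing (R : realType) n (e : 'rV[int]_n) (m : 'rV[R]_n) : R :=
  \sum_j (e 0 j)%:~R * m 0 j.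

Definition tropical_mutation (R : realType) n (G : fixed_data n)
    (e : 'I_n -> 'rV[int]_n) (k : direction G) (m : 'rV[R]_n) : 'rV[R]_n :=
  m + Num.max (pairing (e (val k) *+ dmul G (val k)) m) 0
      *: map_mx ratr (covector G (e (val k))).

(** A point of the space glued from the copies of ['rV[R]_n]: its coordinates in
    all the copies, matched by the gluing maps. *)
Record tropical_point (R : realType) n (G : fixed_data n)
    (s : 'I_n -> 'rV[int]_n) := TropicalPoint {
  chart : seq (direction G) -> 'rV[R]_n;
  chart_rcons : forall w k,
    chart (rcons w k) = tropical_mutation (seed_at s w) k (chart w)
}.

(** The tropicalization of the function [z^{e_i}], where [e] is the seed at [w]. *)
Definition zpow_trop (R : realType) n (G : fixed_data n)
    (s : 'I_n -> 'rV[int]_n) (w : seq (direction G)) (i : 'I_n)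
    (x : tropical_point R G s) : R :=
  - pairing (seed_at s w i) (chart x w).

Definition cluster_chamber (R : realType) n (G : fixed_data n)
    (s : 'I_n -> 'rV[int]_n) (w : seq (direction G)) :
    set (tropical_point R G s) :=
  [set x | forall i, i \in Iuf G -> zpow_trop w i x <= 0].

Definition chamber_in_chart (R : realType) n (G : fixed_data n)
    (s : 'I_n -> 'rV[int]_n) (t w : seq (direction G)) : set 'rV[R]_n :=
  [set chart x t | x in @cluster_chamber R n G s w].

(** * Fans of not necessarily strictly convex cones *)

Definition polyhedral_cone (R : realType) n (C : set 'rV[R]_n) : Prop :=
  exists r (g : 'M[R]_(r, n)),
    C = [set x | exists a : 'rV[R]_r, (forall j, 0 <= a 0 j) /\ x = a *m g].

(** The rows of [l] span the lineality space, and those of [g] are generators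
    which are linearly independent modulo it. *)
Definition simplicial_cone (R : realType) n (C : set 'rV[R]_n) : Prop :=
  exists r p (g : 'M[R]_(r, n)) (l : 'M[R]_(p, n)),
    row_free (col_mx g l) /\
    C = [set x | exists (a : 'rV[R]_r) (b : 'rV[R]_p),
                   (forall j, 0 <= a 0 j) /\ x = a *m g + b *m l].

Definition face_of (R : realType) n (D C : set 'rV[R]_n) : Prop :=
  exists u : 'cV[R]_n, (forall x, C x -> 0 <= (x *m u) 0 0) /\
                       D = [set x | C x /\ (x *m u) 0 0 = 0].

Definition fan (R : realType) n (F : set (set 'rV[R]_n)) : Prop :=
  [/\ forall C, F C -> polyhedral_cone C,
      forall C D, F C -> face_of D C -> F D
    & forall C D, F C -> F D -> face_of (C `&` D) C /\ face_of (C `&` D) D].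

Definition simplicial_fan (R : realType) n (F : set (set 'rV[R]_n)) : Prop :=
  fan F /\ (forall C, F C -> simplicial_cone C).

Definition maximal_cones (R : realType) n (F : set (set 'rV[R]_n)) :
    set (set 'rV[R]_n) :=
  [set C | F C /\ forall D, F D -> C `<=` D -> D = C].

(** The linear span of [C] has dimension [d]. *)
Definition cone_dim (R : realType) n (C : set 'rV[R]_n) (d : nat) : Prop :=
  exists b : 'M[R]_(d, n),
    [/\ row_free b, forall i, C (row i b) & forall x, C x -> (x <= b)%MS].

Definition codim1_face_of (R : realType) n (D C : set 'rV[R]_n) : Prop :=
  face_of D C /\ exists d, cone_dim D d /\ cone_dim C d.+1.

(** * Graphs *)

Record graph (T : Type) := Graph {
  vertices : set T;
  adjacent : T -> T -> Prop
}.

Definition graph_iso T U (G : graph T) (H : graph U) (f : T -> U) : Prop :=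
  set_bij (vertices G) (vertices H) f /\
  (forall x y, vertices G x -> vertices G y ->
    (adjacent G x y <-> adjacent H (f x) (f y))).

Definition dual_graph (R : realType) n (F : set (set 'rV[R]_n)) :
    graph (set 'rV[R]_n) :=
  Graph (maximal_cones F)
    (fun C D => C <> D /\ exists E, codim1_face_of E C /\ codim1_face_of E D).

(** * The exchange graph *)

Definition ratfun n : fieldType := {fraction {mpoly rat[n]}}.

Definition initial_cluster n : 'I_n -> ratfun n :=
  fun i => tofrac ('X_i : {mpoly rat[n]}).

Definition mutate_cluster n (G : fixed_data n) (eps : 'M[rat]_n)
    (k : direction G) (A : 'I_n -> ratfun n) : 'I_n -> ratfun n :=
  fun i => if i == val k then
             (\prod_j A j ^+ pospart (eps (val k) j)
              + \prod_j A j ^+ pospart (- eps (val k) j)) / A (val k)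
           else A i.

Fixpoint cluster_along n (G : fixed_data n) (e : 'I_n -> 'rV[int]_n)
    (A : 'I_n -> ratfun n) (w : seq (direction G)) : 'I_n -> ratfun n :=
  if w is k :: w' then
    cluster_along (mutate k e) (mutate_cluster (exchange_matrix G e) k A) w'
  else A.

Definition labelled_seed n : Type := (('I_n -> ratfun n) * 'M[rat]_n)%type.

Definition labelled_seed_at n (G : fixed_data n) (s : 'I_n -> 'rV[int]_n)
    (w : seq (direction G)) : labelled_seed n :=
  (cluster_along s (@initial_cluster n) w, exchange_matrix G (seed_at s w)).

Definition renumber n (p : 'S_n) (S : labelled_seed n) : labelled_seed n :=
  (fun i => S.1 (p i), \matrix_(i, j) S.2 (p i) (p j)).

(** The vertex of the exchange graph reached by the mutation sequence [w]: an
    equivalence class modulo simultaneous renumbering. *)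
Definition vertex_at n (G : fixed_data n) (s : 'I_n -> 'rV[int]_n)
    (w : seq (direction G)) : set (labelled_seed n) :=
  [set renumber p (labelled_seed_at s w) | p in [set: 'S_n]].

Definition exchange_graph n (G : fixed_data n) (s : 'I_n -> 'rV[int]_n) :
    graph (set (labelled_seed n)) :=
  Graph [set vertex_at s w | w in [set: seq (direction G)]]
    (fun x y => exists (w : seq (direction G)) (k : direction G),
       x = vertex_at s w /\ y = vertex_at s (rcons w k)).

(* Main.v *)
From HB Require Import structures.
Require Import Defs.
From mathcomp Require Import all_boot all_order all_algebra all_fingroup.
From mathcomp Require Import classical_sets functions boolp reals.
From mathcomp Require Import mpoly ring lra zify.

Set Implicit Arguments.
Unset Strict Implicit.
Unset Printing Implicit Defensive.

Import Order.TTheory GRing.Theory Num.Theory.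
Local Open Scope ring_scope.

(** The key point is that a tropical point with positive coordinates in one seed
    has no vanishing coordinate in any other seed.  It comes from the consistent
    scattering diagram in the quantum torus at the value [q = 2] whose incoming
    walls are the hyperplanes [e_i^perp]: its group element is determined by its
    incoming part, hence is carried by mutation to the one of the mutated seed,
    and in every seed the points on no wall avoid the hyperplanes [e_i^perp].
    Non-vanishing makes the transition maps linear and sign-coherent on each
    chamber, so chambers meet along common faces and each wall separates exactly
    two chambers.

    A pairing between tropical cluster variables and tropical points, monotone
    along mutation paths that end in a chamber, shows that two seeds have the same
    chamber if and only if their tropical cluster variables agree up to a
    permutation.  The cluster variables then agree as well: by the Laurent
    phenomenon their ratios are Laurent polynomials, which are bounded on the
    powers of two and hence constant. *)

(** The form may be degenerate, so a wall function cannot be recovered from the automorphism it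
    induces. The quantum torus avoids this: group elements are power series with constant term 1 in
    an associative ring and are compared coefficient by coefficient. No diagram is built. For a
    linear form [t] the group element factors by the sign of [t] on exponents, and the middle factor
    is the wall function at the point [t]. An integer [D] clears the denominators of the form, and
    the wall of [e_i] carries a dilogarithm of base 2 to the power [D / d_i].

    Frozen vectors receive incoming walls too. Hence frozen coordinates do not vanish either; as
    they are only translated by amounts depending on the unfrozen ones, they can only grow along a
    path leaving a chamber. The monotone pairing is this growth for one auxiliary frozen direction,
    whose row of the form encodes the tropical cluster point. *)

Lemma local_fixpoint (T A : Type) (a0 : A) (deg : T -> nat)
    (Phi : (T -> A) -> T -> A) :
  (forall f g t, (forall s, (deg s < deg t)%N -> f s = g s) ->
     Phi f t = Phi g t) ->
  exists f, forall t, f t = Phi f t.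
Proof.
move=> loc.
(* The iterates stabilize degree by degree, so the value at [t] is read off after [(deg t).+1]
   iterations. Series with recursively determined coefficients are obtained this way below. *)
pose F N := iter N Phi (fun=> a0).
have stab N M t : (deg t < N)%N -> (deg t < M)%N -> F N t = F M t.
  elim: N M t => [|N IH] [|M] t //= tN tM; rewrite /F /=.
  by apply: loc => s st; apply: IH; apply: leq_trans st _.
exists (fun t => F (deg t).+1 t) => t.
by rewrite {1}/F /=; apply: loc => s st; apply: (stab (deg t) (deg s).+1).
Qed.

(** * The quantum torus *)

Section Box.
Variable n : nat.
Implicit Types c k l : 'X_{1..n}.

(** The exponents dividing [c], drawn from the finite type of monomials of degree at most [mdeg c].
    The lock stops simplification from unfolding this enumeration. *)
Definition mbox c : seq 'X_{1..n} :=
  locked (filter (fun k => (k <= c)%MM)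
            (map val (enum {: 'X_{1..n < (mdeg c).+1}}))).

Lemma mdeg_lem k c : (k <= c)%MM -> (mdeg k <= mdeg c)%N.
Proof. by move=> /submK <-; rewrite mdegD leq_addl. Qed.

Lemma mem_mbox k c : (k \in mbox c) = (k <= c)%MM.
Proof.
rewrite /mbox -lock mem_filter andb_idr // => /mdeg_lem kc.
by apply/mapP; exists (BMultinom (kc : mdeg k < (mdeg c).+1)%N); rewrite ?mem_enum.
Qed.

Lemma mbox_uniq c : uniq (mbox c).
Proof. by rewrite /mbox -lock filter_uniq // map_inj_uniq ?enum_uniq //; exact: val_inj. Qed.

Lemma mdeg_ltm k c : (k <= c)%MM -> k != c -> (mdeg k < mdeg c)%N.
Proof.
move=> kc nkc; rewrite ltn_neqAle mdeg_lem // andbT.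
apply: contraNneq nkc => E; have := submK kc => /(congr1 mdeg).
rewrite mdegD E -[RHS]add0n => /addIn /eqP; rewrite mdeg_eq0 => /eqP z.
by apply/eqP; rewrite -[RHS](submK kc) z add0m.
Qed.

Lemma mdeg_subm k c : (k <= c)%MM -> k != 0%MM -> (mdeg (c - k) < mdeg c)%N.
Proof.
move=> kc k0; rewrite -{2}(submK kc) mdegD -{1}[mdeg _]addn0 ltn_add2l lt0n.
by rewrite mdeg_eq0.
Qed.

Lemma submmK k c : (k <= c)%MM -> (c - (c - k) = k)%MM.
Proof.
move=> /mnm_lepP kc; apply/mnmP => i; rewrite !mnmBE subKn //; exact: kc.
Qed.

Lemma big_mbox_sub (V : nmodType) c (F : 'X_{1..n} -> 'X_{1..n} -> V) :
  \sum_(k <- mbox c) F k (c - k)%MM = \sum_(k <- mbox c) F (c - k)%MM k.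
Proof.
rewrite (perm_big [seq (c - k)%MM | k <- mbox c]) /=; last first.
  apply: uniq_perm; rewrite ?mbox_uniq ?map_inj_in_uniq ?mbox_uniq //.
    move=> k l; rewrite !mem_mbox => kc lc /(congr1 (fun x => c - x)%MM).
    by rewrite !submmK.
  move=> k; rewrite mem_mbox; apply/idP/mapP => [kc|[l _ ->]].
    by exists (c - k)%MM; rewrite ?mem_mbox ?lem_subr ?submmK.
  exact: lem_subr.
rewrite big_map big_seq [RHS]big_seq; apply: eq_bigr => k; rewrite mem_mbox => kc.
by rewrite submmK.
Qed.

(** Both sides run over the ordered ways to write [c] as a sum of three exponents; on the right the
    first two are grouped into [s]. This reindexing gives associativity of the product of series. *)
Lemma big_mbox_assoc (V : nmodType) c (F : 'X_{1..n} -> 'X_{1..n} -> 'X_{1..n} -> V) :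
  \sum_(k <- mbox c) \sum_(l <- mbox (c - k)) F k l (c - k - l)%MM =
  \sum_(s <- mbox c) \sum_(k <- mbox s) F k (s - k)%MM (c - s)%MM.
Proof.
have E s : s \in mbox c -> \sum_(k <- mbox s) F k (s - k)%MM (c - s)%MM =
   \sum_(k <- mbox c | (k <= s)%MM) F k (s - k)%MM (c - s)%MM.
  rewrite mem_mbox => sc; rewrite -[RHS]big_filter; apply: perm_big.
  apply: uniq_perm => [||k]; [exact: mbox_uniq | exact/filter_uniq/mbox_uniq |].
  rewrite mem_filter !mem_mbox andb_idr // => /lepm_trans; exact.
rewrite [RHS]big_seq (eq_bigr _ E) -big_seq (exchange_big_dep xpredT) //=.
rewrite big_seq [RHS]big_seq; apply: eq_bigr => k; rewrite mem_mbox => kc.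
rewrite -[RHS]big_filter [RHS](perm_big [seq (l + k)%MM | l <- mbox (c - k)]) /=.
  rewrite big_map; apply: eq_bigr => l _; rewrite addmK; congr F.
  by rewrite submDA addmC.
apply: uniq_perm => [||s]; first exact/filter_uniq/mbox_uniq.
  by rewrite map_inj_uniq ?mbox_uniq // => x y /addIm.
 rewrite mem_filter mem_mbox; apply/andP/mapP => [[ks sc]|[l]].
  exists (s - k)%MM; last by rewrite submK.
  rewrite mem_mbox; apply/mnm_lepP => i; rewrite !mnmBE leq_sub2r //.
  by move/mnm_lepP: sc; apply.
rewrite mem_mbox => lc ->; split; first exact: lem_addl.
by rewrite -(submK kc); apply/mnm_lepP => i; rewrite [X in (X <= _)%N]mnmDE [X in (_ <= X)%N]mnmDE leq_add2r; exact: (mnm_lepP lc).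
Qed.

End Box.

Section Twist.
Variables (n : nat) (W : 'I_n -> 'I_n -> int).
Implicit Types a b c k l : 'X_{1..n}.

Definition mform a b : int :=
  \sum_i \sum_j W i j * (a i)%:Z * (b j)%:Z.

Lemma mformDl a b c : mform (a + b)%MM c = mform a c + mform b c.
Proof.
rewrite /mform -big_split; apply: eq_bigr => i _; rewrite -big_split.
by apply: eq_bigr => j _ /=; rewrite mnmDE PoszD; ring.
Qed.

Lemma mformDr a b c : mform a (b + c)%MM = mform a b + mform a c.
Proof.
rewrite /mform -big_split; apply: eq_bigr => i _; rewrite -big_split.
by apply: eq_bigr => j _ /=; rewrite mnmDE PoszD; ring.
Qed.

Lemma mform0l a : mform 0%MM a = 0.
Proof. by apply: (addrI (mform 0%MM a)); rewrite -mformDl addm0 addr0. Qed.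

Lemma mform0r a : mform a 0%MM = 0.
Proof. by apply: (addrI (mform a 0%MM)); rewrite -mformDr addm0 addr0. Qed.

(** Here [q] is the number 2. It is not a root of unity, so the denominators of the quantum
    dilogarithm do not vanish, and all coefficients stay rational. *)
Definition twist a b : rat := 2%:R ^ mform a b.

Lemma twistDl a b c : twist (a + b)%MM c = twist a c * twist b c.
Proof. by rewrite /twist mformDl expfzDr. Qed.

Lemma twistDr a b c : twist a (b + c)%MM = twist a b * twist a c.
Proof. by rewrite /twist mformDr expfzDr. Qed.

Lemma twist0l a : twist 0%MM a = 1. Proof. by rewrite /twist mform0l. Qed.
Lemma twist0r a : twist a 0%MM = 1. Proof. by rewrite /twist mform0r. Qed.

End Twist.

(* Power series [\sum_c f(c) y^c] in the quantum torus
   [y^a y^b = 2^(W(a, b)) y^(a+b)]. *)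
Definition tw n (W : 'I_n -> 'I_n -> int) := 'X_{1..n} -> rat.

Section TwRing.
Variables (n : nat) (W : 'I_n -> 'I_n -> int).
Local Notation chi := (twist W).
Local Notation tw := (tw W).
Implicit Types (f g h : tw) (c k : 'X_{1..n}).

HB.instance Definition _ := gen_eqMixin tw.
HB.instance Definition _ := gen_choiceMixin tw.

Lemma twP f g : (forall c, f c = g c) -> f = g. Proof. exact: funext. Qed.

Definition tw_add f g : tw := fun c => f c + g c.
Definition tw_opp f : tw := fun c => - f c.
Definition tw_zero : tw := fun=> 0.
Definition tw_one : tw := fun c => (c == 0%MM)%:R.
Definition tw_mul f g : tw :=
  fun c => \sum_(k <- mbox c) chi k (c - k)%MM * f k * g (c - k)%MM.

Fact tw_addA : associative tw_add.
Proof. by move=> f g h; apply: twP => c; rewrite /tw_add addrA. Qed.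
Fact tw_addC : commutative tw_add.
Proof. by move=> f g; apply: twP => c; rewrite /tw_add addrC. Qed.
Fact tw_add0 : left_id tw_zero tw_add.
Proof. by move=> f; apply: twP => c; rewrite /tw_add add0r. Qed.
Fact tw_addN : left_inverse tw_zero tw_opp tw_add.
Proof. by move=> f; apply: twP => c; rewrite /tw_add addNr. Qed.

HB.instance Definition _ :=
  GRing.isZmodule.Build tw tw_addA tw_addC tw_add0 tw_addN.

Fact tw_mulA : associative tw_mul.
Proof.
move=> f g h; apply: twP => c; rewrite /tw_mul.
pose F a b d := chi a b * chi a d * chi b d * f a * g b * h d.
transitivity (\sum_(k <- mbox c) \sum_(l <- mbox (c - k)) F k l (c - k - l)%MM).
  rewrite big_seq [RHS]big_seq; apply: eq_bigr => k _.
  rewrite mulr_sumr big_seq [RHS]big_seq; apply: eq_bigr => l; rewrite mem_mbox => lc.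
  rewrite -{1}(submK lc) twistDr /F; ring.
rewrite big_mbox_assoc big_seq [RHS]big_seq; apply: eq_bigr => s; rewrite mem_mbox => sc.
rewrite mulr_sumr mulr_suml big_seq [RHS]big_seq.
apply: eq_bigr => k; rewrite mem_mbox => ks.
have -> : chi s (c - s)%MM = chi (s - k)%MM (c - s)%MM * chi k (c - s)%MM.
  by rewrite -twistDl submK.
by rewrite /F; ring.
Qed.

Fact tw_mul1 : left_id tw_one tw_mul.
Proof.
move=> f; apply: twP => c; rewrite /tw_mul.
have c0 : 0%MM \in mbox c by rewrite mem_mbox; apply/mnm_lepP => i; rewrite mnm0E.
rewrite (bigD1_seq _ c0 (mbox_uniq c)) /= big1 => [|k /negPf k0]; last by rewrite /tw_one k0 mulr0 mul0r.
by rewrite /tw_one eqxx twist0l subm0 !mul1r addr0.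
Qed.

Fact tw_mulr1 : right_id tw_one tw_mul.
Proof.
move=> f; apply: twP => c; rewrite /tw_mul.
have cc : c \in mbox c by rewrite mem_mbox lepm_refl.
rewrite (bigD1_seq _ cc (mbox_uniq c)) /= big_seq_cond big1 => [|k]; last first.
  rewrite mem_mbox => /andP[kc nkc].
  rewrite /tw_one; case: eqP => [z|]; last by rewrite mulr0.
  by move: nkc; rewrite -[X in _ != X](submK kc) z add0m eqxx.
have -> : (c - c)%MM = 0%MM by rewrite -[X in (X - _)%MM]add0m addmK.
by rewrite /tw_one eqxx twist0r mul1r mulr1 addr0.
Qed.

Fact tw_mulDl : left_distributive tw_mul tw_add.
Proof.
move=> f g h; apply: twP => c; rewrite /tw_mul /tw_add -big_split.
by apply: eq_bigr => k _ /=; ring.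
Qed.

Fact tw_mulDr : right_distributive tw_mul tw_add.
Proof.
move=> f g h; apply: twP => c; rewrite /tw_mul /tw_add -big_split.
by apply: eq_bigr => k _ /=; ring.
Qed.

Fact tw_one_neq0 : tw_one != 0 :> tw.
Proof. by apply/eqP => /(congr1 (fun f : tw => f 0%MM)); rewrite /tw_one eqxx. Qed.

HB.instance Definition _ := GRing.Zmodule_isNzRing.Build tw
  tw_mulA tw_mul1 tw_mulr1 tw_mulDl tw_mulDr tw_one_neq0.

Lemma twD f g c : (f + g) c = f c + g c. Proof. by []. Qed.

Lemma twB f g c : (f - g) c = f c - g c. Proof. by []. Qed.

Lemma tw1 c : (1 : tw) c = (c == 0%MM)%:R. Proof. by []. Qed.
Lemma twM f g c :
  (f * g) c = \sum_(k <- mbox c) chi k (c - k)%MM * f k * g (c - k)%MM.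
Proof. by []. Qed.

End TwRing.

(** * Series with constant term 1: products, supports and inverses *)

Section Unipotent.
Variables (n : nat) (W : 'I_n -> 'I_n -> int).
Local Notation chi := (twist W).
Local Notation tw := (tw W).
Local Notation mon := ('X_{1..n}).
Implicit Types (f g h p z r : tw) (a b c k : 'X_{1..n}) (X : mon -> bool).

Definition unip f := f 0%MM = 1.

Definition agree N f g := forall c, (mdeg c < N)%N -> f c = g c.

(** The part of the coefficient of a product that sees both factors only in degrees below [mdeg c].
    Recursions on coefficients isolate it from the two extreme terms. *)
Definition inner f g c : rat :=
  \sum_(k <- mbox c | (k != 0%MM) && (k != c)) chi k (c - k)%MM * f k * g (c - k)%MM.

Lemma le0mm c : (0 <= c)%MM.
Proof. by apply/mnm_lepP => i; rewrite mnm0E. Qed.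

Lemma submm c : (c - c = 0)%MM.
Proof. by rewrite -[X in (X - _)%MM]add0m addmK. Qed.

Lemma subm_neq0 k c : (k <= c)%MM -> k != c -> (c - k)%MM != 0%MM.
Proof. by move=> kc; apply: contraNneq => z; rewrite -[X in _ == X](submK kc) z add0m. Qed.

Lemma tw_mul0 f g : (f * g) 0%MM = f 0%MM * g 0%MM.
Proof.
have z : 0%MM \in mbox (0%MM : mon) by rewrite mem_mbox le0mm.
rewrite twM (bigD1_seq _ z (mbox_uniq _)) /= big_seq_cond big1 => [|k].
  by rewrite twist0l subm0 mul1r addr0.
rewrite mem_mbox => /andP[/mdeg_lem + k0].
by rewrite mdeg0 leqn0 mdeg_eq0 (negPf k0).
Qed.

Lemma tw_mulE f g c : c != 0%MM ->
  (f * g) c = f 0%MM * g c + f c * g 0%MM + inner f g c.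
Proof.
move=> c0.
have z0 : 0%MM \in mbox c by rewrite mem_mbox le0mm.
have cc : c \in mbox c by rewrite mem_mbox lepm_refl.
rewrite twM (bigD1_seq _ z0 (mbox_uniq _)) /= -addrA; congr (_ + _).
  by rewrite twist0l subm0 mul1r.
rewrite -big_filter (bigD1_seq c) /=; first 1 last.
- by rewrite mem_filter c0.
- exact/filter_uniq/mbox_uniq.
by rewrite submm twist0r mul1r; congr (_ + _); rewrite big_filter_cond.
Qed.

Lemma tw_mul_unip f g c : unip f -> unip g -> c != 0%MM ->
  (f * g) c = f c + g c + inner f g c.
Proof. by rewrite /unip => f1 g1 c0; rewrite tw_mulE // f1 g1 mul1r mulr1 [g c + _]addrC. Qed.

Lemma unipM f g : unip f -> unip g -> unip (f * g).
Proof. by rewrite /unip tw_mul0 => -> ->; rewrite mulr1. Qed.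

Lemma unip1 : unip 1. Proof. by rewrite /unip tw1 eqxx. Qed.

Lemma inner_agree f f' g g' c : agree (mdeg c) f f' -> agree (mdeg c) g g' ->
  inner f g c = inner f' g' c.
Proof.
move=> ff gg; rewrite /inner big_seq_cond [RHS]big_seq_cond; apply: eq_bigr => k.
rewrite mem_mbox => /and3P[kc k0 nkc].
by rewrite ff ?mdeg_ltm // gg ?mdeg_subm.
Qed.

Lemma agreeW M N f g : (M <= N)%N -> agree N f g -> agree M f g.
Proof. by move=> MN H c cM; rewrite H ?(leq_trans cM). Qed.

Lemma agreeM N f f' g g' : agree N f f' -> agree N g g' -> agree N (f * g) (f' * g').
Proof.
move=> ff gg c cN; rewrite !twM big_seq [RHS]big_seq; apply: eq_bigr => k.
rewrite mem_mbox => kc; rewrite ff ?(leq_ltn_trans (mdeg_lem kc)) //.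
by rewrite gg // (leq_ltn_trans (mdegB _ _)).
Qed.

Lemma agreeP f g : (forall N, agree N f g) -> f = g.
Proof. by move=> H; apply: twP => c; apply: (H (mdeg c).+1). Qed.

Definition suppin X f := forall c, ~~ X c -> f c = 0.
Definition submon X := X 0%MM /\ forall a b, X a -> X b -> X (a + b)%MM.

Lemma inner_supp X f g c : suppin X f -> suppin X g ->
  (forall k l, k != 0%MM -> l != 0%MM -> X k -> X l -> (k + l)%MM != c) ->
  inner f g c = 0.
Proof.
move=> fX gX irr; rewrite /inner big_seq_cond big1 // => k.
rewrite mem_mbox => /and3P[kc k0 nkc].
have [Xk|/fX->] := boolP (X k); last by rewrite mulr0 mul0r.
have [Xl|/gX->] := boolP (X (c - k)%MM); last by rewrite mulr0.
have := irr _ _ k0 (subm_neq0 kc nkc) Xk Xl.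
by rewrite addmC submK // eqxx.
Qed.

Lemma suppin1 X : X 0%MM -> suppin X 1.
Proof. by move=> X0 c; rewrite tw1; case: eqP => [->|//]; rewrite X0. Qed.

Lemma suppinM X f g : submon X -> suppin X f -> suppin X g -> suppin X (f * g).
Proof.
move=> [X0 XD] fX gX c Xc.
have c0 : c != 0%MM by apply: contraNneq Xc => ->.
rewrite tw_mulE // (fX c) // (gX c) // mulr0 mul0r !add0r.
by apply: (inner_supp fX gX) => k l _ _ Xk Xl; apply: contraNneq Xc => <-; apply: XD.
Qed.

Lemma suppinW X X' f : (forall c, X c -> X' c) -> suppin X f -> suppin X' f.
Proof. by move=> XX H c nX; apply: H; apply: contra nX; apply: XX. Qed.

(** Supports are located by induction on [N]: a submonoid together with all exponents of degree at
    least [N] is again a submonoid, so partial information is stable under products. *)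
Definition upto X N c := X c || (N <= mdeg c)%N.

Lemma submon_upto X N : submon X -> submon (upto X N).
Proof.
move=> [X0 XD]; split; first by rewrite /upto X0.
rewrite /upto => a b; rewrite mdegD => /orP[Xa|aN] /orP[Xb|bN].
- by rewrite XD.
- by rewrite (leq_trans bN) ?orbT // leq_addl.
- by rewrite (leq_trans aN) ?orbT // leq_addr.
- by rewrite (leq_trans aN) ?orbT // leq_addr.
Qed.

Lemma suppin_uptoP X f : (forall N, suppin (upto X N) f) -> suppin X f.
Proof. by move=> H c Xc; apply: (H (mdeg c).+1); rewrite /upto negb_or Xc ltnn. Qed.

Lemma suppin_upto0 X f : suppin (upto X 0) f.
Proof. by move=> c; rewrite /upto leq0n orbT. Qed.

(** If [c] is a sum of two non-zero exponents, both have smaller degree, so both would lie in [X]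
    and then [c] as well. *)
Lemma inner_upto X f g c : submon X -> ~~ X c ->
  suppin (upto X (mdeg c)) f -> suppin (upto X (mdeg c)) g -> inner f g c = 0.
Proof.
move=> [_ XD] Xc fX gX; apply: (inner_supp fX gX) => k l k0 l0.
rewrite /upto => Xk Xl; apply: contraNneq Xc => E; move: Xk Xl; rewrite -E mdegD.
have -> : (mdeg k + mdeg l <= mdeg k)%N = false.
  by rewrite -[X in (_ <= X)%N]addn0 leq_add2l leqn0 mdeg_eq0 (negPf l0).
have -> : (mdeg k + mdeg l <= mdeg l)%N = false.
  by rewrite -[X in (_ <= X)%N]add0n leq_add2r leqn0 mdeg_eq0 (negPf k0).
by rewrite !orbF; apply: XD.
Qed.

Lemma suppin_step X N f : X 0%MM ->
  suppin (upto X N) f ->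
  (forall c, ~~ X c -> mdeg c = N -> c != 0%MM -> f c = 0) -> suppin (upto X N.+1) f.
Proof.
move=> X0 H st c; rewrite /upto negb_or -ltnNge ltnS leq_eqVlt => /andP[Xc /orP[/eqP cN|cN]].
  by apply: st => //; apply: contraNneq Xc => ->.
by apply: H; rewrite /upto negb_or Xc -ltnNge.
Qed.

Lemma unip_inv f : unip f -> exists g, [/\ unip g, f * g = 1 & g * f = 1].
Proof.
move=> f1.
have [g gE] : exists g, forall c, g c = if c == 0%MM then 1 else - f c - inner f g c.
  apply: (local_fixpoint 0 (deg := @mdeg n)) => g g' c H; case: eqP => // _.
  by congr (_ - _); apply: inner_agree.
have [h hE] : exists h, forall c, h c = if c == 0%MM then 1 else - f c - inner h f c.
  apply: (local_fixpoint 0 (deg := @mdeg n)) => g' g'' c H; case: eqP => // _.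
  by congr (_ - _); apply: inner_agree.
have g1 : unip g by rewrite /unip gE eqxx.
have h1 : unip h by rewrite /unip hE eqxx.
have fg : f * g = 1.
  apply: twP => c; rewrite tw1; case: (eqVneq c 0%MM) => [->|c0].
    by rewrite tw_mul0 f1 g1 mulr1.
  by rewrite tw_mul_unip // gE (negPf c0) /=; ring.
have hf : h * f = 1.
  apply: twP => c; rewrite tw1; case: (eqVneq c 0%MM) => [->|c0].
    by rewrite tw_mul0 f1 h1 mulr1.
  by rewrite tw_mul_unip // hE (negPf c0) /=; ring.
have gh : g = h by rewrite -[LHS]mul1r -hf -mulrA fg mulr1.
by exists g; split => //; rewrite gh.
Qed.

Definition tinv f : tw := xget 0 [set g | [/\ unip g, f * g = 1 & g * f = 1]]%classic.

Lemma tinvP f : unip f -> [/\ unip (tinv f), f * tinv f = 1 & tinv f * f = 1].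
Proof. by move=> /unip_inv /(xgetPex 0). Qed.

Lemma suppin_inv X f : submon X -> unip f -> suppin X f -> suppin X (tinv f).
Proof.
move=> sX f1 fX; have [g1 fg _] := tinvP f1; apply: suppin_uptoP.
elim=> [|N IH]; first exact: suppin_upto0.
apply: (suppin_step sX.1 IH) => c Xc cN c0.
have := congr1 (fun h : tw => h c) fg; rewrite /= tw1 (negPf c0) tw_mul_unip //.
rewrite (inner_upto sX Xc) ?cN // => [|d].
  by rewrite fX // add0r addr0.
by rewrite /upto negb_or => /andP[Xd _]; apply: fX.
Qed.

Lemma mulVKu f g : unip f -> f * (tinv f * g) = g.
Proof. by move=> /tinvP[_ E _]; rewrite mulrA E mul1r. Qed.

Lemma mulKu f g : unip f -> tinv f * (f * g) = g.
Proof. by move=> /tinvP[_ _ E]; rewrite mulrA E mul1r. Qed.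

Lemma mulrVKu f g : unip f -> g * tinv f * f = g.
Proof. by move=> /tinvP[_ _ E]; rewrite -mulrA E mulr1. Qed.

Lemma mulrKu f g : unip f -> g * f * tinv f = g.
Proof. by move=> /tinvP[_ E _]; rewrite -mulrA E mulr1. Qed.

Lemma unip_mulrI f g h : unip f -> f * g = f * h -> g = h.
Proof. by move=> uf E; rewrite -(mulKu g uf) E mulKu. Qed.

End Unipotent.

(** * Factorization by the sign of a linear form *)

Section LinearForm.
Variables (n : nat) (F : realDomainType) (t : 'I_n -> F).
Implicit Types a b c : 'X_{1..n}.

Definition lin c : F := \sum_i t i *+ c i.

Lemma linD a b : lin (a + b)%MM = lin a + lin b.
Proof. by rewrite /lin -big_split; apply: eq_bigr => i _; rewrite mnmDE mulrnDr. Qed.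

Lemma lin0 : lin 0%MM = 0.
Proof. by apply: (addrI (lin 0%MM)); rewrite -linD addm0 addr0. Qed.

Lemma lin1 i : lin U_(i)%MM = t i.
Proof.
rewrite /lin (bigD1 i) //= big1 ?addr0 => [|j ji]; rewrite mnm1E ?eqxx ?mulr1n //.
by rewrite eq_sym (negPf ji).
Qed.

Lemma linMn c k : lin (c *+ k)%MM = lin c *+ k.
Proof. by elim: k => [|k IH]; rewrite ?mulm0n ?lin0 // mulmS linD IH mulrS. Qed.

Definition Xp c := (c == 0%MM) || (0 < lin c).
Definition Xz c := lin c == 0.
Definition Xn c := (c == 0%MM) || (lin c < 0).

Lemma submonXp : submon Xp.
Proof.
split; first by rewrite /Xp eqxx.
rewrite /Xp => a b /orP[/eqP->|a0] /orP[/eqP->|b0]; rewrite ?add0m ?addm0 ?eqxx //.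
- by rewrite b0 orbT.
- by rewrite a0 orbT.
- by rewrite linD addr_gt0 ?orbT.
Qed.

Lemma submonXn : submon Xn.
Proof.
split; first by rewrite /Xn eqxx.
rewrite /Xn => a b /orP[/eqP->|a0] /orP[/eqP->|b0]; rewrite ?add0m ?addm0 ?eqxx //.
- by rewrite b0 orbT.
- by rewrite a0 orbT.
- by rewrite linD -oppr_gt0 opprD addr_gt0 ?oppr_gt0 ?orbT.
Qed.

Lemma submonXz : submon Xz.
Proof.
split; first by rewrite /Xz lin0.
by rewrite /Xz => a b /eqP a0 /eqP b0; rewrite linD a0 b0 addr0.
Qed.

End LinearForm.

Section Decomposition.
Variables (n : nat) (W : 'I_n -> 'I_n -> int) (F : realDomainType).
Local Notation tw := (tw W).
Implicit Types (f g h p z r : tw) (a b c k : 'X_{1..n}) (t : 'I_n -> F)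
  (X : 'X_{1..n} -> bool).

Definition upart X f := unip f /\ suppin X f.

Lemma upartM X f g : submon X -> upart X f -> upart X g -> upart X (f * g).
Proof. by move=> sX [? ?] [? ?]; split; [exact: unipM | exact: suppinM]. Qed.

Lemma upart1 X : X 0%MM -> upart X (1 : tw).
Proof. by split; [exact: unip1 | exact: suppin1]. Qed.

Lemma upartV X f : submon X -> upart X f -> upart X (tinv f).
Proof. by move=> sX [uf ?]; split; [have [] := tinvP uf | exact: suppin_inv]. Qed.

(** For the group element of a consistent scattering diagram this is the path-ordered product from
    the positive to the negative chamber through the point [t], and [z] is the wall function met at
    [t]. *)
Definition decomp t f p z r :=
  [/\ f = p * z * r, upart (Xp t) p, upart (Xz t) z & upart (Xn t) r].

Lemma decomp_coef t f p z r c : decomp t f p z r -> c != 0%MM ->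
  f c = p c + z c + r c + (inner z r c + inner p (z * r) c).
Proof.
move=> [-> [up _] [uz _] [ur _]] c0.
by rewrite -mulrA !tw_mul_unip //; [ring | exact: unipM].
Qed.

(** In degree [c] the factors contribute [p c + z c + r c] plus terms of lower degree, and the sign
    of [lin t c] decides which of the three absorbs the discrepancy [u c]. *)
Lemma decomp_ex t f : unip f -> exists p z r, decomp t f p z r.
Proof.
move=> f1.
pose part (P : 'X_{1..n} -> bool) (u : tw) : tw :=
  fun c => if c == 0%MM then 1 else if P c then u c else 0.
pose p := part (Xp t); pose z := part (Xz t); pose r := part (Xn t).
have partA P N u v : agree N u v -> agree N (part P u) (part P v).
  by move=> H c cN; rewrite /part; case: eqP => // _; case: ifP => // _; apply: H.
have partS (P : 'X_{1..n} -> bool) u : P 0%MM -> upart P (part P u).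
  move=> P0; split; first by rewrite /unip /part eqxx.
  by move=> c Pc; rewrite /part (negPf Pc); case: eqP Pc => [->|//]; rewrite P0.
have [u uE] : exists u : tw, forall c, u c =
    f c - (inner (z u) (r u) c + inner (p u) (z u * r u) c).
  apply: (local_fixpoint 0 (deg := @mdeg n)) => g g' c H.
  by congr (_ - (_ + _)); apply: inner_agree; try apply: agreeM; apply: partA.
have [p0 [z0 r0]] : Xp t 0%MM /\ Xz t 0%MM /\ Xn t 0%MM.
  by rewrite /Xp /Xz /Xn eqxx lin0 eqxx.
exists (p u), (z u), (r u); split; try exact: partS.
have [[pu _] [zu _] [ru _]] := And3 (partS _ u p0) (partS _ u z0) (partS _ u r0).
apply: twP => c; case: (eqVneq c 0%MM) => [->|c0].
  by rewrite !tw_mul0 f1 [p u _]pu [z u _]zu [r u _]ru !mulr1.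
rewrite -mulrA tw_mul_unip // ?tw_mul_unip //; last exact: unipM.
have -> : f c = u c + (inner (z u) (r u) c + inner (p u) (z u * r u) c).
  by rewrite uE; ring.
have -> : u c = p u c + z u c + r u c.
  rewrite /p /z /r /part (negPf c0) /Xp /Xz /Xn (negPf c0) /=.
  by case: (ltgtP (lin t c) 0); rewrite ?addr0 ?add0r.
by ring.
Qed.

Lemma upart_sign t c p z r : c != 0%MM ->
  upart (Xp t) p -> upart (Xz t) z -> upart (Xn t) r ->
  [/\ (lin t c <= 0 -> p c = 0), (lin t c != 0 -> z c = 0) & (0 <= lin t c -> r c = 0)].
Proof.
move=> c0 [_ pX] [_ zX] [_ rX]; split => H.
- by apply: pX; rewrite /Xp (negPf c0) /= -leNgt.
- by apply: zX.
- by apply: rX; rewrite /Xn (negPf c0) /= -leNgt.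
Qed.

(** The same triangularity read backwards. It yields uniqueness of the factors and allows recursions
    that pass through the factorization. *)
Lemma decomp_agree t N f f' p p' z z' r r' :
  decomp t f p z r -> decomp t f' p' z' r' -> agree N f f' ->
  [/\ agree N p p', agree N z z' & agree N r r'].
Proof.
move=> D D'; elim: N => [|N IH] H; first by split.
have [Hp Hz Hr] := IH (agreeW (leqnSn _) H).
have [[_ up uz ur] [_ up' uz' ur']] := (D, D').
suff st c : mdeg c = N -> [/\ p c = p' c, z c = z' c & r c = r' c].
  by split=> c; rewrite ltnS leq_eqVlt => /orP[/eqP /st[]|] //; [apply: Hp|apply: Hz|apply: Hr].
move=> cN; case: (eqVneq c 0%MM) => [->|c0].
  by rewrite up.1 up'.1 uz.1 uz'.1 ur.1 ur'.1.
have := H c; rewrite cN ltnS leqnn (decomp_coef D) // (decomp_coef D') // => /(_ isT).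
have -> : inner z r c = inner z' r' c by apply: inner_agree; rewrite cN.
have -> : inner p (z * r) c = inner p' (z' * r') c.
  by apply: inner_agree; rewrite cN //; apply: agreeM.
move=> /addIr.
have [p1 z1 r1] := upart_sign c0 up uz ur.
have [p2 z2 r2] := upart_sign c0 up' uz' ur'.
case: (ltgtP (lin t c) 0) => [lt0|gt0|eq0].
- rewrite (p1 (ltW lt0)) (p2 (ltW lt0)) (z1 _) ?(z2 _) ?lt_eqF //.
  by rewrite !add0r.
- rewrite (r1 (ltW gt0)) (r2 (ltW gt0)) (z1 _) ?(z2 _) ?gt_eqF //.
  by rewrite !addr0.
- by rewrite p1 ?p2 ?r1 ?r2 ?eq0 // !addr0 !add0r.
Qed.

Lemma decomp_uniq t f p p' z z' r r' :
  decomp t f p z r -> decomp t f p' z' r' -> [/\ p = p', z = z' & r = r'].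
Proof.
move=> D D'; have H N := decomp_agree (N := N) D D' (fun c _ => erefl).
by split; apply: agreeP => N; have [] := H N.
Qed.

Lemma decomp_supp X t f p z r : submon X -> suppin X f ->
  decomp t f p z r -> [/\ suppin X p, suppin X z & suppin X r].
Proof.
move=> sX fX D.
have H N : [/\ suppin (upto X N) p, suppin (upto X N) z & suppin (upto X N) r].
  elim: N => [|N [Hp Hz Hr]]; first by split; apply: suppin_upto0.
  have [_ up uz ur] := D.
  suff st c : ~~ X c -> mdeg c = N -> c != 0%MM -> [/\ p c = 0, z c = 0 & r c = 0].
    by split; (apply: suppin_step; [exact: sX.1 | by [] |];
      move=> c Xc cN c0; have [] := st c Xc cN c0).
  move=> Xc cN c0; have := decomp_coef D c0; rewrite fX //.
  rewrite !(inner_upto sX Xc) ?cN //; last first.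
    by apply: suppinM => //; apply: submon_upto.
  have [p1 z1 r1] := upart_sign c0 up uz ur.
  case: (ltgtP (lin t c) 0) => [lt0|gt0|eq0].
  - by rewrite (p1 (ltW lt0)) (z1 _) ?lt_eqF // !addr0 !add0r => <-.
  - by rewrite (r1 (ltW gt0)) (z1 _) ?gt_eqF // !addr0 => <-.
  - by rewrite p1 ?r1 ?eq0 // !addr0 !add0r => <-.
by split; apply: suppin_uptoP => N; have [] := H N.
Qed.

End Decomposition.

(** * Wall functions *)

Section Incoming.
Variables (n : nat) (W : 'I_n -> 'I_n -> int).
Hypothesis Wskew : forall i j, W i j = - W j i.
Local Notation tw := (tw W).
Implicit Types (f g h p z r w : tw) (a b c k : 'X_{1..n}) (l : 'I_n -> rat).

Lemma mform_skew a b : mform W a b = - mform W b a.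
Proof.
rewrite /mform exchange_big -sumrN; apply: eq_bigr => i _.
by rewrite -sumrN; apply: eq_bigr => j _; rewrite Wskew; ring.
Qed.

Lemma mformcc c : mform W c c = 0.
Proof. by have := mform_skew c c; lia. Qed.

Lemma mform_lin k c : mform W k c = lin (fun i => mform W U_(i)%MM c) k.
Proof.
have E i : mform W U_(i)%MM c = \sum_j W i j * (c j)%:Z.
  rewrite /mform (bigD1 i) //= [X in _ + X]big1 ?addr0 => [|j ji].
    by apply: eq_bigr => j _; rewrite mnm1E eqxx mulr1.
  by apply: big1 => j' _; rewrite mnm1E eq_sym (negPf ji) mulr0 mul0r.
rewrite {1}/mform /lin; apply: eq_bigr => i _; rewrite E.
by rewrite -sumrMnl; apply: eq_bigr => j _; rewrite -mulr_natr; ring.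
Qed.

Definition Der l f : tw := fun c => lin l c * f c.

Lemma DerM l f g : Der l (f * g) = Der l f * g + f * Der l g.
Proof.
apply: twP => c; rewrite twD !twM /Der twM mulr_sumr -big_split /=.
rewrite big_seq [RHS]big_seq; apply: eq_bigr => k; rewrite mem_mbox => kc.
by rewrite -{1}(submK kc) linD; ring.
Qed.

Lemma DerC l l' f : Der l (Der l' f) = Der l' (Der l f).
Proof. by apply: twP => c; rewrite /Der mulrCA. Qed.

Lemma suppin_Der X l f : suppin X f -> suppin X (Der l f).
Proof. by move=> fX c /fX E; rewrite /Der E mulr0. Qed.

(** If [k + k' = c] and [W(k, c) = 0] then [W(k, k') = 0] by skewness, so the two monomials commute.
    The coefficient at [c] therefore behaves as a trace on these series. *)
Lemma tw_trace f g c :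
  suppin (fun k => mform W k c == 0) f -> suppin (fun k => mform W k c == 0) g ->
  (f * g) c = (g * f) c.
Proof.
move=> fX gX; rewrite !twM.
rewrite (big_mbox_sub c (fun k k' => twist W k k' * f k * g k')).
rewrite big_seq [RHS]big_seq; apply: eq_bigr => k; rewrite mem_mbox => kc.
have [/eqP Z|/gX->] := boolP (mform W k c == 0); last by rewrite !(mulr0, mul0r).
have Z' : mform W k (c - k)%MM = 0.
  by move: Z; rewrite -{1}(submK kc) mformDr mformcc addr0.
by rewrite /twist [mform W (c - k)%MM k]mform_skew Z' oppr0 expr0z; ring.
Qed.

(** A left logarithmic derivative takes the place of the non-commutative logarithm. By the trace
    property its coefficient at [c] is additive on products of series supported on exponents
    orthogonal to [c]. *)
Definition dlog l z : tw := tinv z * Der l z.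

Lemma dlogE l z : unip z -> Der l z = z * dlog l z.
Proof. by move=> uz; rewrite /dlog mulVKu. Qed.

Lemma dlog_uniq l z w : unip z -> Der l z = z * w -> w = dlog l z.
Proof. by move=> uz E; apply: (unip_mulrI uz); rewrite -E dlogE. Qed.

Lemma dlog_supp X l z : submon X -> upart X z -> suppin X (dlog l z).
Proof.
by move=> sX [uz zX]; apply: suppinM => //; [exact: suppin_inv | exact: suppin_Der].
Qed.

Lemma dlog0 l z : dlog l z 0%MM = 0.
Proof. by rewrite /dlog tw_mul0 /Der lin0 mul0r mulr0. Qed.

Lemma dlog_coef l z c : unip z -> c != 0%MM ->
  lin l c * z c = dlog l z c + inner z (dlog l z) c.
Proof.
move=> uz c0; have := congr1 (fun h : tw => h c) (dlogE l uz).
by rewrite /= {1}/Der tw_mulE // dlog0 mulr0 addr0 (uz : z 0%MM = 1) mul1r.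
Qed.

Lemma dlog_agree l N z z' : unip z -> unip z' -> agree N z z' ->
  agree N (dlog l z) (dlog l z').
Proof.
move=> uz uz'; elim: N => [|N IH] // H c.
rewrite ltnS leq_eqVlt => /orP[/eqP cN|cN]; last first.
  by apply: IH => //; apply: agreeW H.
case: (eqVneq c 0%MM) => [->|c0]; first by rewrite !dlog0.
have := dlog_coef l uz c0; rewrite H ?cN //.
rewrite (inner_agree (f' := z') (g' := dlog l z')) ?cN; first last.
- by apply: IH; apply: agreeW H.
- exact: agreeW H.
by rewrite dlog_coef // => /addIr.
Qed.

Definition Xc c k := mform W k c == 0.

Lemma submonXc c : submon (Xc c).
Proof.
split; first by rewrite /Xc mform0l.
by rewrite /Xc => a b /eqP a0 /eqP b0; rewrite mformDl a0 b0.
Qed.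

(* Flatness of the connection [dlog]. *)
Lemma dlog_flat l l' z c : upart (Xc c) z ->
  lin l' c * dlog l z c = lin l c * dlog l' z c.
Proof.
move=> Uz; have [uz zX] := Uz.
have [wX w'X] : suppin (Xc c) (dlog l z) /\ suppin (Xc c) (dlog l' z).
  by split; apply: dlog_supp => //; exact: submonXc.
move: (dlogE l uz) (dlogE l' uz) wX w'X; move: (dlog l z) (dlog l' z) => w w' Ew Ew' wX w'X.
(* Both sides are the inverse of [z] times a mixed second derivative of [z]. At [c] the two products
   of [w] and [w'] cancel by the trace property. *)
have E : w' * w + Der l' w = w * w' + Der l w'.
  apply: (unip_mulrI uz); rewrite !mulrDr !mulrA -Ew -Ew' -!DerM -Ew -Ew'.
  exact: DerC.
have := congr1 (fun h : tw => h c) E; rewrite /= !twD (tw_trace w'X wX).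
by move=> /addrI.
Qed.

Definition theta c (i : 'I_n) : int := mform W U_(i)%MM c.

Lemma lin_theta c k : lin (theta c) k = mform W k c.
Proof. by rewrite mform_lin. Qed.

(* At the point [theta c] of the hyperplane orthogonal to [c], the walls of
   direction [c] are incoming; [v] is the coefficient of [y^c] in the logarithm of
   the wall function there. *)
Definition incoming g c (v : rat) := forall p z r, decomp (theta c) g p z r ->
  forall l, dlog l z c = lin l c * v.

Lemma decomp_upartXc c g p z r : decomp (theta c) g p z r -> upart (Xc c) z.
Proof.
move=> [_ _ [uz zX] _]; split=> //; apply: suppinW zX => k.
by rewrite /Xz /Xc lin_theta.
Qed.

(** By flatness, a single weight [l] with [lin l c] non-zero decides the coefficient for all
    weights. *)
Lemma incoming_intro g c v p z r l : decomp (theta c) g p z r ->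
  lin l c != 0 -> dlog l z c = lin l c * v -> incoming g c v.
Proof.
move=> D l0 E p' z' r' D' l'; have [_ <- _] := decomp_uniq D D'.
have := dlog_flat l l' (decomp_upartXc D); rewrite E => /eqP.
by rewrite mulrCA eq_sym => /eqP /(mulfI l0).
Qed.

Lemma theta_cc c : lin (theta c) c = 0.
Proof. by rewrite lin_theta mformcc. Qed.

Lemma decomp_theta_coef c g p z r : decomp (theta c) g p z r -> c != 0%MM ->
  g c = z c + (inner z r c + inner p (z * r) c).
Proof.
move=> D c0; rewrite (decomp_coef D c0); have [_ up uz ur] := D.
have [p0 _ r0] := upart_sign c0 up uz ur.
by rewrite p0 ?r0 ?theta_cc ?lexx // add0r addr0.
Qed.

Definition one_wt : 'I_n -> rat := fun=> 1.

Lemma lin_one_wt c : lin one_wt c = (mdeg c)%:R.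
Proof. by rewrite /lin mdegE natr_sum; apply: eq_bigr. Qed.

Lemma lin_one_wt_neq0 c : c != 0%MM -> lin one_wt c != 0.
Proof. by rewrite lin_one_wt pnatr_eq0 mdeg_eq0. Qed.

(** Induction on the degree. The coefficient at [c] is that of the wall function plus lower terms,
    and differentiating by the degree, which is non-zero on [c], expresses it through [v c]. *)
Lemma incoming_uniq v g g' : unip g -> unip g' ->
  (forall c, c != 0%MM -> incoming g c (v c)) ->
  (forall c, c != 0%MM -> incoming g' c (v c)) -> g = g'.
Proof.
move=> ug ug' I I'; apply: agreeP; elim=> [|N IH] // c.
rewrite ltnS leq_eqVlt => /orP[/eqP cN|]; last exact: IH.
case: (eqVneq c 0%MM) => [->|c0]; first by rewrite ug ug'.
have [p [z [r D]]] := decomp_ex (theta c) ug.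
have [p' [z' [r' D']]] := decomp_ex (theta c) ug'.
have [Hp Hz Hr] := decomp_agree D D' IH.
have [[_ _ [uz _] _] [_ _ [uz' _] _]] := (D, D').
rewrite (decomp_theta_coef D) // (decomp_theta_coef D') //.
have -> : inner z r c = inner z' r' c by apply: inner_agree; rewrite cN.
have -> : inner p (z * r) c = inner p' (z' * r') c.
  by apply: inner_agree; rewrite cN //; apply: agreeM.
congr (_ + _); apply: (mulfI (lin_one_wt_neq0 c0)).
rewrite !dlog_coef // (I _ c0 _ _ _ D) (I' _ c0 _ _ _ D'); congr (_ + _).
by apply: inner_agree; rewrite cN //; apply: dlog_agree.
Qed.

Lemma incoming_ex (v : 'X_{1..n} -> rat) :
  exists g, unip g /\ forall c, c != 0%MM -> incoming g c (v c).
Proof.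
pose D c g := xget (1, 1, 1) [set t : tw * tw * tw | decomp (theta c) g t.1.1 t.1.2 t.2]%classic.
have DP c g : unip g -> decomp (theta c) g (D c g).1.1 (D c g).1.2 (D c g).2.
  move=> /(decomp_ex (theta c)) [p [z [r d]]].
  by apply: (@xgetPex _ _ [set t : tw * tw * tw | decomp (theta c) g t.1.1 t.1.2 t.2]%classic);
     exists (p, z, r).
(* [H] solves the uniqueness recursion for the coefficient at [c]: the quotient is the value of
   [z c] forced by [v c], the other terms are products of lower coefficients. *)
pose H c p z r := (lin one_wt c * v c + inner z (dlog one_wt z) c) / lin one_wt c +
                  (inner z r c + inner p (z * r) c).
pose u1 g : tw := fun c => if c == 0%MM then 1 else g c.
have uu g : unip (u1 g) by rewrite /unip /u1 eqxx.
have [g gE] : exists g : tw, forall c, g c = let t := D c (u1 g) in H c t.1.1 t.1.2 t.2.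
  apply: (local_fixpoint 0 (deg := @mdeg n)) => g g' c gg' /=.
  have A : agree (mdeg c) (u1 g) (u1 g').
    by move=> d dc; rewrite /u1; case: eqP => // _; apply: gg'.
  have [Hp Hz Hr] := decomp_agree (DP c _ (uu g)) (DP c _ (uu g')) A.
  have [[_ _ [uz _] _] [_ _ [uz' _] _]] := (DP c _ (uu g), DP c _ (uu g')).
  rewrite /H; congr (_ / _ + (_ + _)).
  - by congr (_ + _); apply: inner_agree => //; apply: dlog_agree.
  - exact: inner_agree.
  - by apply: inner_agree => //; apply: agreeM.
exists (u1 g); split; first exact: uu.
move=> c c0; have d := DP c _ (uu g).
apply: (incoming_intro d (lin_one_wt_neq0 c0)).
have := decomp_theta_coef d c0; rewrite {1}/u1 (negPf c0) gE /= /H => /addIr E.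
have [_ _ [uz _] _] := d; have := dlog_coef one_wt uz c0.
by rewrite -E mulrC mulfVK ?lin_one_wt_neq0 // => /addIr <-.
Qed.

(** Without an incoming wall at [c], the coefficient is assembled from pairs of non-zero exponents
    of the support with sum [c], and there are none. Supports are thus generated by the incoming
    walls. *)
Lemma incoming_irr X g c : submon X -> suppin X g -> unip g -> c != 0%MM ->
  (forall k k', k != 0%MM -> k' != 0%MM -> X k -> X k' -> (k + k')%MM != c) ->
  incoming g c 0 -> g c = 0.
Proof.
move=> sX gX ug c0 irr I.
have [p [z [r D]]] := decomp_ex (theta c) ug.
have [pX zX rX] := decomp_supp sX gX D.
have [_ [up _] [uz _] [ur _]] := D.
rewrite (decomp_theta_coef D) // !(inner_supp _ _ irr) ?addr0 //; last exact: suppinM.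
apply: (mulfI (lin_one_wt_neq0 c0)); rewrite dlog_coef // (I _ _ _ D) !mulr0 add0r.
by apply: (inner_supp _ _ irr) => //; apply: dlog_supp.
Qed.

Lemma incoming_out X g c : submon X -> suppin X g -> unip g -> ~~ X c ->
  incoming g c 0.
Proof.
move=> sX gX ug cX p z r D l.
have [_ zX _] := decomp_supp sX gX D; have [_ _ [uz _] _] := D.
by rewrite mulr0; apply: (dlog_supp l sX (conj uz zX)).
Qed.

End Incoming.

(** * The quantum dilogarithm *)

(* One-variable power series are sequences of coefficients; [lop s] is the
   multiplication by [1 + s t]. *)
Section Sequences.
Implicit Types (A B f g : nat -> rat) (s x y : rat).

Definition conv f g j : rat := \sum_(i < j.+1) f i * g (j - i)%N.

Definition lop s f j : rat := f j + s * (if j is j'.+1 then f j' else 0).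

Lemma lop_convl s f g : conv (lop s f) g = lop s (conv f g).
Proof.
apply: funext => -[|j]; rewrite /lop /conv.
  by rewrite !big_ord_recl !big_ord0 /=; ring.
under eq_bigr do rewrite mulrDl.
rewrite big_split /=; congr (_ + _).
rewrite big_ord_recl /= mulr0 mul0r add0r mulr_sumr; apply: eq_bigr => i _.
by rewrite /bump leq0n add1n /= subSS mulrA.
Qed.

Lemma lop_convr s f g : conv f (lop s g) = lop s (conv f g).
Proof.
apply: funext => -[|j]; rewrite /lop /conv.
  by rewrite !big_ord_recl !big_ord0 /=; ring.
under eq_bigr do rewrite mulrDr.
rewrite big_split /=; congr (_ + _).
rewrite big_ord_recr /= subnn !mulr0 addr0 mulr_sumr; apply: eq_bigr => i _.
by have ij : (i <= j)%N := ltn_ord i; rewrite subSn //= mulrCA.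
Qed.

Lemma lopC s s' f : lop s (lop s' f) = lop s' (lop s f).
Proof. by apply: funext => -[|[|j]]; rewrite /lop; ring. Qed.

Lemma lopZ s x f : lop s (fun i => x * f i) = fun j => x * lop s f j.
Proof. by apply: funext => -[|j]; rewrite /lop; ring. Qed.

Lemma conv_inj f A B : f 0%N = 1 -> conv f A = conv f B -> A = B.
Proof.
move=> f1 E; apply: funext; elim/ltn_ind => j IH.
have := congr1 (fun u => u j) E; rewrite /conv !big_ord_recl /= subn0 f1 !mul1r.
rewrite (eq_bigr (fun i : 'I_j => f (bump 0 i) * B (j - bump 0 i)%N)) => [/addIr //|i _].
by rewrite IH // /bump leq0n add1n; have := ltn_ord i; lia.
Qed.

(** The coefficients of [t^N A(1/t)]. Mutation reverses coefficients along the direction of the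
    mutated basis vector. *)
Definition rv N A j : rat := if (j <= N)%N then A (N - j)%N else 0.
Definition upto0 N A := forall j, (N < j)%N -> A j = 0.

Lemma upto0_lop N s A : upto0 N A -> upto0 N.+1 (lop s A).
Proof.
move=> H [|j] //; rewrite ltnS => Nj; rewrite /lop !H ?mulr0 ?addr0 //.
exact: leq_trans Nj _.
Qed.

Lemma rv_lop N s A : upto0 N A -> s != 0 ->
  rv N.+1 (lop s A) = fun j => s * lop s^-1 (rv N A) j.
Proof.
move=> H s0; apply: funext => j; rewrite /rv /lop.
case: j => [|j].
  by rewrite !leq0n subn0 H // mulr0 addr0 add0r subn0.
rewrite ltnS subSS; case: (ltngtP j N) => [jN|jN|->].
- have -> : (N - j)%N = (N - j.+1).+1 by rewrite subnSK.
  by rewrite mulrDr mulrA divff // mul1r [LHS]addrC.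
- by rewrite mulr0 addr0 mulr0.
- by rewrite subnn mulr0 addr0 add0r mulrA divff ?mul1r.
Qed.

End Sequences.

Section QuantumExponential.
Variable h : nat.
Hypothesis h_gt0 : (0 < h)%N.

Definition bp (x : int) : rat := 2%:R ^ (h%:Z * x).

Lemma bpD x y : bp (x + y) = bp x * bp y.
Proof. by rewrite /bp mulrDr expfzDr. Qed.

Lemma bp_neq0 x : bp x != 0. Proof. by rewrite expfz_neq0. Qed.

Lemma bp0 : bp 0 = 1. Proof. by rewrite /bp mulr0 expr0z. Qed.

Lemma bpN x : bp (- x) = (bp x)^-1.
Proof. by apply: (mulfI (bp_neq0 x)); rewrite -bpD subrr bp0 divff ?bp_neq0. Qed.

Lemma bp_gt1 j : 1 < bp j.+1%:Z.
Proof. by rewrite /bp -PoszM exprn_egt1 // muln_eq0 negb_or -lt0n h_gt0. Qed.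

(* The series [E(t)] with [E(b^2 t) = (1 + b t) E(t)], where [b = 2^h]. *)
Fixpoint qexp j : rat :=
  if j is j'.+1 then bp 1 * qexp j' / (bp (2 * j)%N - 1) else 1.

Lemma qexp_rec j : bp (2 * j.+1)%N * qexp j.+1 = qexp j.+1 + bp 1 * qexp j.
Proof.
rewrite [qexp j.+1]/=; set x := bp (2 * _)%N; set y := bp 1 * _.
have : x - 1 != 0 by rewrite subr_eq0 gt_eqF // /x mulnS; apply: bp_gt1.
by move=> x1; field.
Qed.

(** The coefficients of [E(b^x t)]. *)
Definition Es (x : int) j : rat := bp (x * j%:Z) * qexp j.

Lemma Es_step x : Es (x + 2%:Z) = lop (bp (x + 1)) (Es x).
Proof.
apply: funext => -[|j]; rewrite /lop /Es; first by rewrite !mulr0 addr0.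
have -> : (x + 2%:Z) * j.+1%:Z = x * j.+1%:Z + (2 * j.+1)%N by lia.
rewrite [in LHS]bpD -[LHS]mulrA qexp_rec mulrDr; congr (_ + _); rewrite !mulrA -!bpD.
by congr (bp _ * _); lia.
Qed.

(** Multiplication by [E(b^m t) / E(b^-m t)], the polynomial with the [m] factors [1 + b^j t] for
    [j = m-1, m-3, ..., 1-m]. Pairing [j] with [-j] makes it palindromic, which is what reversal
    needs. *)
Fixpoint Qop m (f : nat -> rat) : nat -> rat :=
  match m with
  | 0 => f
  | 1 => lop 1 f
  | (m'.+1 as m1).+1 => lop (bp m1) (lop (bp (- m1%:Z)) (Qop m' f))
  end.

Lemma nat_ind2 (P : nat -> Prop) :
  P 0%N -> P 1%N -> (forall m, P m -> P m.+2) -> forall m, P m.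
Proof.
move=> P0 P1 PS m; suff [] : P m /\ P m.+1 by [].
by elim: m => [|m [? ?]]; split => //; apply: PS.
Qed.

Lemma lop_Qop s m f : lop s (Qop m f) = Qop m (lop s f).
Proof.
elim/nat_ind2: m f => [||m IH] f //=; first by rewrite lopC.
by rewrite lopC [lop s (lop _ _)]lopC IH.
Qed.

Lemma Qop_convl m f g : conv (Qop m f) g = Qop m (conv f g).
Proof.
by elim/nat_ind2: m f => [||m IH] f //=; rewrite ?lop_convl ?IH.
Qed.

Lemma Qop_convr m f g : conv f (Qop m g) = Qop m (conv f g).
Proof.
by elim/nat_ind2: m g => [||m IH] g //=; rewrite ?lop_convr ?IH.
Qed.

Lemma Es_Qop (m : nat) : Es m = Qop m (Es (- m%:Z)).
Proof.
elim/nat_ind2: m => [||m IH] //=.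
  have -> : 1 = - 1%:Z + 2%:Z :> int by [].
  by rewrite Es_step /= -bp0.
have -> : Posz m.+2 = m%:Z + 2%:Z by lia.
rewrite Es_step IH; have -> : - m%:Z = - (m%:Z + 2%:Z) + 2%:Z by lia.
rewrite Es_step -lop_Qop; congr (lop (bp _) (lop (bp _) _)); lia.
Qed.

Lemma Es0 x : Es x 0 = 1. Proof. by rewrite /Es mulr0 bp0 mulr1. Qed.

Lemma strings_pos (m : nat) A B : conv (Es (- m%:Z)) A = conv (Es m) B <-> A = Qop m B.
Proof.
rewrite (Es_Qop m) Qop_convl -Qop_convr; split=> [|->//].
exact/conv_inj/Es0.
Qed.

Lemma strings_neg (m : nat) A B : conv (Es m) A = conv (Es (- m%:Z)) B <-> B = Qop m A.
Proof. by rewrite -strings_pos; split. Qed.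

Lemma upto0_Qop N m A : upto0 N A -> upto0 (N + m) (Qop m A).
Proof.
elim/nat_ind2: m => [||m IH] H /=; first by rewrite addn0.
  by rewrite addn1; apply: upto0_lop.
by rewrite !addnS; do 2!apply: upto0_lop; apply: IH.
Qed.

Lemma rv_Qop N m A : upto0 N A -> rv (N + m) (Qop m A) = Qop m (rv N A).
Proof.
move=> H; elim/nat_ind2: m => [||m IH] /=; first by rewrite addn0.
  by rewrite addn1 rv_lop // invr1; apply: funext => j; rewrite mul1r.
have H2 := upto0_Qop (m := m) H.
rewrite !addnS rv_lop ?bp_neq0 //; last exact: upto0_lop.
rewrite rv_lop ?bp_neq0 // IH -bpN -bpN opprK.
rewrite lopZ; apply: funext => j.
by rewrite mulrA -bpD subrr bp0 mul1r lopC.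
Qed.

Lemma klog_ex : exists k : nat -> rat, forall r,
  r%:R * qexp r = \sum_(s < r.+1) qexp (r - s) * k s.
Proof.
have [k kE] : exists k : nat -> rat, forall r,
    k r = r%:R * qexp r - \sum_(s < r) qexp (r - s) * k s.
  apply: (local_fixpoint 0 (deg := id)) => f g r H; congr (_ - _).
  by apply: eq_bigr => s _; rewrite H.
by exists k => r; rewrite big_ord_recr /= subnn mul1r [k r]kE; ring.
Qed.

(* Coefficients of [t E'(t) / E(t)]. *)
Definition klog : nat -> rat := xget (fun=> 0) [set k : nat -> rat | forall r,
  r%:R * qexp r = \sum_(s < r.+1) qexp (r - s) * k s]%classic.

Lemma klogE r : r%:R * qexp r = \sum_(s < r.+1) qexp (r - s) * klog s.
Proof. exact: (xgetPex (fun=> 0) klog_ex). Qed.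

Lemma klog0 : klog 0 = 0.
Proof. by have := klogE 0; rewrite big_ord1 subnn !mul1r mulr1 => <-. Qed.

End QuantumExponential.

Section PureMonomials.
Variables (n : nat) (k : 'I_n).
Implicit Types a b c x : 'X_{1..n}.

Definition pure c := c == (U_(k) *+ c k)%MM.

Lemma pureU r : ((U_(k) *+ r)%MM : 'X_{1..n}) k = r.
Proof. by rewrite mulmnE mnm1E eqxx mul1n. Qed.

Lemma pure_pow r : pure (U_(k) *+ r)%MM.
Proof. by rewrite /pure pureU. Qed.

Lemma pureP c : reflect (forall i, i != k -> c i = 0%N) (pure c).
Proof.
apply: (iffP eqP) => [-> i ik|H]; first by rewrite mulmnE mnm1E eq_sym (negPf ik).
apply/mnmP => i; rewrite mulmnE mnm1E; case: eqVneq => [<-|]; first by rewrite mul1n.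
by rewrite eq_sym => ik; rewrite H.
Qed.

Lemma pure_add a b : pure (a + b)%MM = pure a && pure b.
Proof.
apply/pureP/andP => [H|[/pureP Ha /pureP Hb] i ik]; last by rewrite mnmDE Ha ?Hb.
by split; apply/pureP => i /H /eqP; rewrite mnmDE addn_eq0 => /andP[/eqP ? /eqP ?].
Qed.

Lemma pure0 : pure 0%MM.
Proof. by apply/pureP => i _; rewrite mnm0E. Qed.

Lemma submon_pure : submon pure.
Proof. by split; [exact: pure0 | move=> a b pa pb; rewrite pure_add pa]. Qed.

(** What remains of the support of the group element once the dilogarithm in direction [k] is
    divided out. *)
Definition mixed c := (c == 0%MM) || ~~ pure c.

Lemma submon_mixed : submon mixed.
Proof.
split; first by rewrite /mixed eqxx.
rewrite /mixed => a b /orP[/eqP->|pa]; rewrite ?add0m // pure_add.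
by rewrite (negPf pa) orbT.
Qed.

Lemma lem_pure x r : (x <= U_(k) *+ r)%MM = pure x && (x k <= r)%N.
Proof.
apply/mnm_lepP/andP => [H|[/eqP px xr] i]; last first.
  by rewrite {1}px !mulmnE leq_mul.
split; last by have := H k; rewrite pureU.
apply/pureP => i ik; have := H i; rewrite mulmnE mnm1E eq_sym (negPf ik) mul0n.
by rewrite leqn0 => /eqP.
Qed.

Lemma big_pure (V : nmodType) c (F : 'X_{1..n} -> V) :
  (forall x, ~~ pure x -> F x = 0) ->
  \sum_(x <- mbox c) F x = \sum_(r < (c k).+1) F (U_(k) *+ r)%MM.
Proof.
move=> F0; rewrite (bigID pure) /= [X in _ + X]big1 ?addr0 => [|x /F0 //].
rewrite -big_filter -(big_mkord xpredT (fun r => F (U_(k) *+ r)%MM)) /index_iota subn0.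
rewrite -(big_map (fun r => (U_(k) *+ r)%MM) xpredT F); apply: perm_big.
apply: uniq_perm => [||x]; first exact/filter_uniq/mbox_uniq.
  by rewrite map_inj_uniq ?iota_uniq // => r s /(congr1 (fun x : 'X_{1..n} => x k)); rewrite !pureU.
rewrite mem_filter mem_mbox; apply/andP/mapP => [[/eqP px /mnm_lepP xc]|[r]].
  by exists (x k) => //; rewrite mem_iota add0n ltnS xc.
rewrite mem_iota add0n ltnS => rc ->; rewrite pure_pow; split=> //.
apply/mnm_lepP => i; rewrite mulmnE mnm1E; case: eqVneq => [<-|_]; first by rewrite mul1n.
by rewrite mul0n.
Qed.

Definition upd c j : 'X_{1..n} := [multinom if i == k then j else c i | i < n].

Lemma updk c j : upd c j k = j. Proof. by rewrite mnmE eqxx. Qed.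
Lemma updE c j i : i != k -> upd c j i = c i.
Proof. by rewrite mnmE => /negPf ->. Qed.
Lemma upd_id c : upd c (c k) = c.
Proof. by apply/mnmP => i; rewrite mnmE; case: eqP => [->|]. Qed.
Lemma upd_upd c j j' : upd (upd c j) j' = upd c j'.
Proof. by apply/mnmP => i; rewrite !mnmE; case: eqP. Qed.

Lemma upd_sub c j r : (upd c j - U_(k) *+ r)%MM = upd c (j - r).
Proof.
apply/mnmP => i; rewrite mnmBE !mnmE mulmnE mnm1E eq_sym.
by case: eqP => _; rewrite ?mul1n // mul0n subn0.
Qed.

Lemma pure_upd c j : pure (upd c j) = pure c.
Proof. by apply/pureP/pureP => H i ik; have := H i ik; rewrite updE. Qed.

Lemma pureMn r s : (U_(k) *+ (r + s) = U_(k) *+ r + U_(k) *+ s)%MM.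
Proof. by apply/mnmP => i; rewrite mnmDE !mulmnE mulnDr. Qed.

End PureMonomials.

Section Dilogarithm.
Variables (n : nat) (W : 'I_n -> 'I_n -> int) (k : 'I_n) (h : nat) (M : 'I_n -> int).
Hypothesis Wskew : forall i j, W i j = - W j i.
Hypothesis h_gt0 : (0 < h)%N.
Hypothesis WM : forall i, W i k = h%:Z * M i.
Local Notation tw := (tw W).
Local Notation pure := (pure k).
Local Notation upd := (upd k).
Local Notation bp := (bp h).
Local Notation Es := (Es h).
Local Notation qexp := (qexp h).
Implicit Types (f g : tw) (c x : 'X_{1..n}) (l : 'I_n -> rat).

Lemma Mk0 : M k = 0.
Proof. by have := Wskew k k; rewrite WM; nia. Qed.

(** The pairing with [e_k] divided by [h]. It ignores the exponent at [k], hence is constant on each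
    string obtained by varying that exponent. *)
Definition mdir c : int := lin M c.

Lemma mdir_upd c j : mdir (upd c j) = mdir c.
Proof.
rewrite /mdir /lin; apply: eq_bigr => i _; case: (eqVneq i k) => [->|ik].
  by rewrite Mk0 !mul0rn.
by rewrite updE.
Qed.

Lemma mform_r c r : mform W c (U_(k) *+ r)%MM = h%:Z * (mdir c * r%:Z).
Proof.
rewrite /mform /mdir /lin mulr_suml mulr_sumr; apply: eq_bigr => i _.
rewrite (bigD1 k) //= big1 ?addr0 => [|j jk].
  by rewrite pureU WM -mulr_natr natz; ring.
by rewrite mulmnE mnm1E eq_sym (negPf jk) mul0n mulr0.
Qed.

Lemma twist_r c r : twist W c (U_(k) *+ r)%MM = bp (mdir c * r%:Z).
Proof. by rewrite /twist mform_r. Qed.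

Lemma twist_l c r : twist W (U_(k) *+ r)%MM c = bp (- mdir c * r%:Z).
Proof. by rewrite /twist (mform_skew Wskew) mform_r; congr (_ ^ _); ring. Qed.

Lemma twist_pure r s : twist W (U_(k) *+ r)%MM (U_(k) *+ s)%MM = 1.
Proof. by rewrite twist_r /mdir linMn lin1 Mk0 mul0rn mul0r bp0. Qed.

Lemma mul_pure f g r :
  (f * g) (U_(k) *+ r)%MM = \sum_(s < r.+1) f (U_(k) *+ (r - s))%MM * g (U_(k) *+ s)%MM.
Proof.
set c := (U_(k) *+ r)%MM; have ck : c k = r by exact: pureU.
rewrite twM (big_mbox_sub _ (fun a b => twist W a b * f a * g b)) big_seq.
rewrite (eq_bigr (fun x => if pure x then f (U_(k) *+ (r - x k))%MM * g x else 0)).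
  rewrite -big_seq (big_pure (k := k)) => [|x /negPf -> //].
  by rewrite ck; apply: eq_bigr => s _; rewrite pure_pow pureU.
move=> x; rewrite mem_mbox lem_pure => /andP[px xr]; rewrite px.
have -> : (c - x)%MM = (U_(k) *+ (r - x k))%MM.
  by rewrite {1}(eqP px) /c -[in LHS](subnK xr) pureMn addmK.
by rewrite [X in twist W _ X](eqP px) twist_pure mul1r.
Qed.

Definition Eser : tw := fun c => if pure c then qexp (c k) else 0.

Lemma upart_E_pure : upart pure Eser.
Proof.
by split=> [|c /negPf pc]; rewrite ?/unip /Eser ?pure0 ?mnm0E ?pc.
Qed.

Lemma unip_E : unip Eser. Proof. by have [] := upart_E_pure. Qed.

Definition str f c j := f (upd c j).

Lemma mul_El f c j : (Eser * f) (upd c j) = conv (Es (- mdir c)) (str f c) j.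
Proof.
rewrite twM (big_pure (k := k)) => [|x /negPf px]; last first.
  by rewrite /Eser px mulr0 mul0r.
rewrite updk; apply: eq_bigr => r _; rewrite upd_sub twist_l mdir_upd /str.
by rewrite /Eser pure_pow pureU.
Qed.

Lemma mul_Er f c j : (f * Eser) (upd c j) = conv (Es (mdir c)) (str f c) j.
Proof.
rewrite twM (big_mbox_sub _ (fun a b => twist W a b * f a * Eser b)).
rewrite (big_pure (k := k)) => [|x /negPf px]; last by rewrite /Eser px mulr0.
rewrite updk; apply: eq_bigr => r _; rewrite upd_sub twist_r mdir_upd /str.
by rewrite /Eser pure_pow pureU /Es; ring.
Qed.

Lemma E_conj f g : Eser * f = g * Eser <->
  forall c, conv (Es (- mdir c)) (str f c) = conv (Es (mdir c)) (str g c).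
Proof.
split=> [E c|H]; first by apply: funext => j; rewrite -mul_El -mul_Er E.
by apply: twP => c; rewrite -[c](upd_id k) mul_El mul_Er H.
Qed.

(** On a string, left multiplication by [Eser] is convolution with [E(b^-m t)] and right
    multiplication with [E(b^m t)], where [m = mdir c]. The sign of [m] decides which quotient of
    the two is a polynomial. *)
Lemma E_conj_strings f g : Eser * f = g * Eser <->
  forall c, (0 <= mdir c -> str f c = Qop h `|mdir c|%N (str g c)) /\
            (mdir c <= 0 -> str g c = Qop h `|mdir c|%N (str f c)).
Proof.
rewrite E_conj; split=> H c.
  have := H c; case: (leP 0 (mdir c)) => m0 E; split=> // m0'.
  - by apply/strings_pos => //; rewrite gez0_abs.
  - have z : mdir c = 0 by apply/eqP; rewrite eq_le m0' m0.
    by apply/strings_neg => //; move: E; rewrite z /= oppr0.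
  - by apply/strings_neg => //; rewrite lez0_abs // opprK.
have [Hp Hn] := H c; case: (leP 0 (mdir c)) => m0.
  have := Hp m0; move: m0; case: (mdir c) => // m _ E; exact/strings_pos.
have := Hn (ltW m0); have -> : mdir c = - `|mdir c|%N%:Z by lia.
by move: `|mdir c|%N => m; rewrite opprK abszN /= => E; apply/strings_neg.
Qed.

Definition Klog l : tw := fun c => if pure c then l k * klog h (c k) else 0.

Lemma dlog_E l : dlog l Eser = Klog l.
Proof.
apply/esym/dlog_uniq; first exact: unip_E.
apply: twP => c; have [pc|npc] := boolP (pure c); last first.
  have [uE EX] := upart_E_pure; rewrite /Der EX // mulr0.
  apply/esym/(suppinM (submon_pure k) EX) => // x /negPf px; by rewrite /Klog px.
rewrite (eqP pc) mul_pure /Der linMn lin1 /Eser pure_pow pureU -mulr_natr -mulrA klogE //.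
rewrite mulr_sumr; apply: eq_bigr => s _.
by rewrite /Klog !pure_pow !pureU; ring.
Qed.

Section SignedDecomposition.
Variables (F : realDomainType) (t : 'I_n -> F).

Lemma lin_pure c : pure c -> lin t c = t k *+ c k.
Proof. by move=> /eqP pc; rewrite {1}pc linMn lin1. Qed.

Lemma pure_neq0 c : pure c -> c != 0%MM -> (0 < c k)%N.
Proof.
move=> /eqP pc; apply: contraNltn; rewrite leqn0 => /eqP z.
by rewrite pc z mulm0n.
Qed.

Lemma E_pos : 0 < t k -> upart (Xp t) Eser.
Proof.
move=> t0; have [uE EX] := upart_E_pure; split=> //; apply: suppinW EX => c pc.
rewrite /Xp; case: eqVneq => //= c0; rewrite lin_pure // pmulrn_lgt0 //.
exact: pure_neq0.
Qed.

Lemma E_neg : t k < 0 -> upart (Xn t) Eser.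
Proof.
move=> t0; have [uE EX] := upart_E_pure; split=> //; apply: suppinW EX => c pc.
rewrite /Xn; case: eqVneq => //= c0; rewrite lin_pure // pmulrn_llt0 //.
exact: pure_neq0.
Qed.

Lemma E_zero : t k = 0 -> upart (Xz t) Eser.
Proof.
move=> t0; have [uE EX] := upart_E_pure; split=> //; apply: suppinW EX => c pc.
by rewrite /Xz lin_pure // t0 mul0rn.
Qed.

End SignedDecomposition.

End Dilogarithm.

(** * Incoming walls of a product with a dilogarithm *)

Section IncomingProduct.
Variables (n : nat) (W : 'I_n -> 'I_n -> int).
Hypothesis Wskew : forall i j, W i j = - W j i.
Local Notation tw := (tw W).
Implicit Types (f g p z r : tw) (c x : 'X_{1..n}) (l : 'I_n -> rat).

Lemma suppinMM (X Y Z : 'X_{1..n} -> bool) f g :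
  (forall a b, X a -> Y b -> Z (a + b)%MM) ->
  suppin X f -> suppin Y g -> suppin Z (f * g).
Proof.
move=> XYZ fX gY c Zc; rewrite twM big_seq big1 // => x; rewrite mem_mbox => xc.
have [Xx|/fX->] := boolP (X x); last by rewrite mulr0 mul0r.
have [Yx|/gY->] := boolP (Y (c - x)%MM); last by rewrite mulr0.
by have := XYZ _ _ Xx Yx; rewrite addmC submK // (negPf Zc).
Qed.

Lemma suppin_sub1 (X : 'X_{1..n} -> bool) f : unip f ->
  suppin (fun c => (c == 0%MM) || X c) f -> suppin X (f - 1).
Proof.
move=> uf fX c Xc; rewrite twB tw1; case: eqVneq => [->|c0]; first by rewrite uf subrr.
by rewrite subr0 fX // (negPf c0).
Qed.

(** Writing [g = 1 + x], the conjugate is [1 + f x f^-1], and [X] absorbs exponents of [Y]. This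
    moves a factor of the zero part past the one-signed factors. *)
Lemma conj_upart (X : 'X_{1..n} -> bool) (Y : 'X_{1..n} -> bool) f g :
  (forall a b, Y a -> X b -> X (a + b)%MM) -> submon Y -> upart Y f ->
  upart (fun c => (c == 0%MM) || X c) g ->
  upart (fun c => (c == 0%MM) || X c) (f * g * tinv f).
Proof.
move=> YX sY [uf fY] [ug gX].
have [uV fV Vf] := tinvP uf.
have -> : f * g * tinv f = 1 + f * (g - 1) * tinv f.
  by rewrite mulrBr mulr1 mulrBl fV addrC subrK.
split.
  by rewrite /unip twD tw1 eqxx !tw_mul0 twB tw1 eqxx [g _]ug subrr mulr0 mul0r addr0.
move=> c; rewrite negb_or => /andP[c0 Xc]; rewrite twD tw1 (negPf c0) add0r.
have S1 : suppin X (f * (g - 1)) by apply: (suppinMM YX) => //; apply: suppin_sub1.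
have XY a b : X a -> Y b -> X (a + b)%MM by move=> Xa Yb; rewrite addmC; apply: YX.
exact: (suppinMM XY S1 (suppin_inv sY uf fY) Xc).
Qed.

Lemma dlogM l f g : unip f -> unip g ->
  dlog l (f * g) = tinv g * dlog l f * g + dlog l g.
Proof.
move=> uf ug; apply/esym/dlog_uniq; first exact: unipM.
rewrite DerM (dlogE l uf) (dlogE l ug) mulrDr -!mulrA; congr (_ + _).
by rewrite (mulVKu _ ug).
Qed.

Lemma dlogM_trace l c f g : upart (Xc W c) f -> upart (Xc W c) g ->
  dlog l (f * g) c = dlog l f c + dlog l g c.
Proof.
move=> uf ug; rewrite dlogM ?twD; [|by case: uf|by case: ug]; congr (_ + _).
have sX := submonXc W c.
rewrite -[tinv g * _ * g]mulrA tw_trace //.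
- by rewrite (mulrKu _ ug.1).
- by have [_ ?] := upartV sX ug.
- exact: (suppinM sX (dlog_supp l sX uf) ug.2).
Qed.

Lemma incoming_same f f' c v : unip f ->
  (forall p z r, decomp (theta W c) f p z r -> exists p' z' r',
     decomp (theta W c) f' p' z' r' /\ forall l, dlog l z' c = dlog l z c) ->
  incoming f c v <-> incoming f' c v.
Proof.
move=> uf H; have [p [z [r D]]] := decomp_ex (theta W c) uf.
have [p' [z' [r' [D' E]]]] := H p z r D.
split=> I q y s D2 l.
  by have [_ <- _] := decomp_uniq D' D2; rewrite E (I _ _ _ D).
by have [_ <- _] := decomp_uniq D D2; rewrite -E (I _ _ _ D').
Qed.

End IncomingProduct.

(* The weight of the incoming walls: the logarithmic coefficients of the quantum
   dilogarithms on the multiples of the basis vectors. *)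
Definition kbar n (h : 'I_n -> nat) (c : 'X_{1..n}) : rat :=
  \sum_i (if pure i c then klog (h i) (c i) / (c i)%:R else 0).

Section Kbar.
Variables (n : nat) (h : 'I_n -> nat).
Implicit Types c : 'X_{1..n}.

Lemma kbar_neq0 c : kbar h c != 0 -> exists i, pure i c.
Proof.
apply: contra_neqP => H; rewrite /kbar big1 // => i _.
by case: ifP => // pc; case: H; exists i.
Qed.

Lemma kbar_pure i c : pure i c -> c != 0%MM -> kbar h c = klog (h i) (c i) / (c i)%:R.
Proof.
move=> pc c0; rewrite /kbar (bigD1 i) //= pc big1 ?addr0 // => j ji.
case: ifP => // /pureP pj; case/eqP: c0.
apply/mnmP => x; rewrite mnm0E; case: (eqVneq x i) => [->|xi].
  by rewrite pj // eq_sym.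
by move/pureP: pc; apply.
Qed.

End Kbar.

Section IncomingE.
Variables (n : nat) (W : 'I_n -> 'I_n -> int) (k : 'I_n) (h : nat) (M : 'I_n -> int).
Hypothesis Wskew : forall i j, W i j = - W j i.
Hypothesis h_gt0 : (0 < h)%N.
Hypothesis WM : forall i, W i k = h%:Z * M i.
Local Notation tw := (tw W).
Local Notation pure := (pure k).
Local Notation E := (Eser W k h : tw).
Local Notation mdir := (mdir M).
Implicit Types (f g p z r : tw) (c x : 'X_{1..n}) (l : 'I_n -> rat).

Lemma mformUk c : mform W U_(k)%MM c = - (h%:Z * mdir c).
Proof.
rewrite (mform_skew Wskew); have -> : U_(k)%MM = (U_(k) *+ 1)%MM by rewrite mulm1n.
by rewrite (mform_r WM) mulr1.
Qed.

Lemma theta_k c : theta W c k = - (h%:Z * mdir c).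
Proof. exact: mformUk. Qed.

Section Decompositions.
Variables (F : realDomainType) (t : 'I_n -> F).

Lemma decomp_El_pos f p z r : 0 < t k -> decomp t f p z r -> decomp t (E * f) (E * p) z r.
Proof.
move=> t0 [-> up uz ur]; split; rewrite ?mulrA //.
by apply: upartM => //; [exact: submonXp | exact: E_pos].
Qed.

Lemma decomp_Er_neg f p z r : t k < 0 -> decomp t f p z r -> decomp t (f * E) p z (r * E).
Proof.
move=> t0 [-> up uz ur]; split; rewrite ?mulrA //.
by apply: upartM => //; [exact: submonXn | exact: E_neg].
Qed.

Lemma conj_Xp f p : upart (Xz t) f -> upart (Xp t) p -> upart (Xp t) (f * p * tinv f).
Proof.
move=> uf up; apply: (conj_upart (X := fun c => 0 < lin t c) _ (submonXz t) uf up).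
by move=> a b /eqP a0 b0; rewrite linD a0 add0r.
Qed.

Lemma conj_Xn f p : upart (Xz t) f -> upart (Xn t) p -> upart (Xn t) (f * p * tinv f).
Proof.
move=> uf up; apply: (conj_upart (X := fun c => lin t c < 0) _ (submonXz t) uf up).
by move=> a b /eqP a0 b0; rewrite linD a0 add0r.
Qed.

Lemma decomp_El_zero f p z r : t k = 0 -> decomp t f p z r ->
  decomp t (E * f) (E * p * tinv E) (E * z) r.
Proof.
move=> t0 [-> up uz ur]; have uE := E_zero W h t0; split=> //.
- by rewrite !mulrA mulrVKu //; case: uE.
- exact: conj_Xp.
- by apply: upartM => //; exact: submonXz.
Qed.

Lemma decomp_Er_zero f p z r : t k = 0 -> decomp t f p z r ->
  decomp t (f * E) p (z * E) (tinv E * r * E).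
Proof.
move=> t0 [-> up uz ur]; have uE := E_zero W h t0; have [u1 _] := uE; split=> //.
- by rewrite -!mulrA; congr (_ * (_ * _)); rewrite mulVKu.
- by apply: upartM => //; exact: submonXz.
have uV := upartV (submonXz t) uE.
have [uV1 EV VE] := tinvP u1.
have EE : tinv (tinv E) = E by apply: (unip_mulrI uV1); rewrite VE; have [] := tinvP uV1.
by have := conj_Xn uV ur; rewrite EE.
Qed.

End Decompositions.

(** Here [theta W c] is positive on [e_k], so the dilogarithm joins the positive factor and the wall
    function at [theta W c] does not change. *)
Lemma incoming_El_pos f c v : unip f -> mdir c < 0 -> incoming f c v <-> incoming (E * f) c v.
Proof.
move=> uf m0; apply: incoming_same => // p z r D; exists (E * p), z, r; split=> //.
by apply: decomp_El_pos => //; rewrite theta_k; nia.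
Qed.

Lemma incoming_Er_neg f c v : unip f -> 0 < mdir c -> incoming f c v <-> incoming (f * E) c v.
Proof.
move=> uf m0; apply: incoming_same => // p z r D; exists p, z, (r * E); split=> //.
by apply: decomp_Er_neg => //; rewrite theta_k; nia.
Qed.

Lemma E_upartXc c : mdir c = 0 -> upart (Xc W c) E.
Proof.
move=> m0; have t0 : theta W c k = 0 by rewrite theta_k m0 mulr0 oppr0.
have [uE EX] := E_zero W h t0; split=> //; apply: suppinW EX => x.
by rewrite /Xz /Xc lin_theta.
Qed.

Lemma dlog_E_mixed l c : ~~ pure c -> dlog l E c = 0.
Proof. by move=> /negPf pc; rewrite (dlog_E Wskew h_gt0 WM) /Klog pc. Qed.

(** Now [e_k] lies in the zero part and the dilogarithm multiplies the wall function, but its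
    logarithmic derivative only involves multiples of [e_k]. *)
Lemma incoming_El_zero f c v : unip f -> mdir c = 0 -> ~~ pure c ->
  incoming f c v <-> incoming (E * f) c v.
Proof.
move=> uf m0 pc; have t0 : theta W c k = 0 by rewrite theta_k m0 mulr0 oppr0.
apply: incoming_same => // p z r D.
exists (E * p * tinv E), (E * z), r; split; first exact: decomp_El_zero.
move=> l; rewrite dlogM_trace //; last exact: decomp_upartXc D.
  by rewrite dlog_E_mixed // add0r.
exact: E_upartXc.
Qed.

Lemma incoming_Er_zero f c v : unip f -> mdir c = 0 -> ~~ pure c ->
  incoming f c v <-> incoming (f * E) c v.
Proof.
move=> uf m0 pc; have t0 : theta W c k = 0 by rewrite theta_k m0 mulr0 oppr0.
apply: incoming_same => // p z r D.
exists p, (z * E), (tinv E * r * E); split; first exact: decomp_Er_zero.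
move=> l; rewrite dlogM_trace //; first by rewrite dlog_E_mixed // addr0.
  exact: decomp_upartXc D.
exact: E_upartXc.
Qed.

Lemma mdir_pure c : pure c -> mdir c = 0.
Proof. by move=> /eqP ->; rewrite /mdir linMn lin1 (Mk0 Wskew h_gt0 WM) mul0rn. Qed.

Lemma incoming_E_pure f c : unip f -> suppin (mixed k) f -> pure c -> c != 0%MM ->
  incoming (E * f) c (klog h (c k) / (c k)%:R).
Proof.
move=> uf fX pc c0.
have t0 : theta W c k = 0 by rewrite theta_k mdir_pure // mulr0 oppr0.
have [p [z [r D]]] := decomp_ex (theta W c) uf.
have D' := decomp_El_zero t0 D; move=> q y s D2 l.
have [_ <- _] := decomp_uniq D' D2; rewrite dlogM_trace //; first last.
- exact: decomp_upartXc D.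
- by apply: E_upartXc; apply: mdir_pure.
have [_ zX _] := decomp_supp (submon_mixed k) fX D.
have [_ _ [uz _] _] := D.
rewrite [X in _ + X](dlog_supp l (submon_mixed k) (conj uz zX)); last first.
  by rewrite /mixed negb_or c0 pc.
rewrite addr0 (dlog_E Wskew h_gt0 WM) /Klog pc {2}(eqP pc) linMn lin1 -mulr_natr.
by have := pure_neq0 pc c0; rewrite lt0n -(pnatr_eq0 rat) => ck; field.
Qed.

Variable g : tw.
Hypothesis ug : unip g.
Hypothesis gE : forall r : nat, g (U_(k) *+ r.+1)%MM = qexp h r.+1.

Lemma ginv_mixed f : unip f -> E * f = g \/ f * E = g -> suppin (mixed k) f.
Proof.
move=> uf Ef c; rewrite /mixed negb_or negbK => /andP[c0 pc].
have [r cr] : exists r : nat, c = (U_(k) *+ r.+1)%MM.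
  by move: (pure_neq0 pc c0) (eqP pc); case: (c k) => // r _ ->; exists r.
rewrite {}cr {c c0 pc}.
have E0 (s : nat) : E (U_(k) *+ s)%MM = qexp h s by rewrite /Eser pure_pow pureU.
elim/ltn_ind: r => r IH.
have S : forall s : nat, (0 < s <= r)%N -> f (U_(k) *+ s)%MM = 0.
  by move=> [|s] //= sr; apply: IH.
have Er := E0 r.+1; have E1 : E 0%MM = 1 by exact: unip_E.
have f1 : f 0%MM = 1 by [].
case: Ef => Ef; have := gE r; rewrite -Ef (mul_pure Wskew h_gt0 WM);
  move: Er; move: (qexp h r.+1) => q Er.
  rewrite big_ord_recr big_ord_recl /= subn0 subnn mulm0n f1 mulr1 Er.
  rewrite big1 => [|s _].
    by rewrite addr0 E1 mul1r -[RHS]addr0 => /addrI.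
  by rewrite S ?mulr0 // /bump leq0n add1n /=; have := ltn_ord s; lia.
rewrite big_ord_recr big_ord_recl /= subn0 subnn mulm0n f1 mul1r Er.
rewrite big1 => [|s _].
  by rewrite addr0 E1 mulr1 -[RHS]add0r => /addIr.
by rewrite S ?mul0r // /bump leq0n add1n /=; have := ltn_ord s; lia.
Qed.

End IncomingE.

(** * Mutation of scattering diagrams *)

Section Reflection.
Variables (n : nat) (k : 'I_n) (N : 'I_n -> nat).
Hypothesis Nk : N k = 0%N.
Implicit Types (a b c x : 'X_{1..n}).

(* Change of basis [e_k -> - e_k], [e_i -> e_i + N_i e_k], seen on linear forms. *)
Definition opP (V : zmodType) (F : 'I_n -> V) (i : 'I_n) : V :=
  if i == k then - F k else F i + F k *+ N i.

Definition nsum c : nat := \sum_i N i * c i.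

(** The exponents that the reflection keeps non-negative: the subtraction in [refl] is truncated,
    and exact only on these. *)
Definition XN c := (c k <= nsum c)%N.

Definition refl c : 'X_{1..n} := upd k c (nsum c - c k).

Lemma nsumD a b : nsum (a + b)%MM = (nsum a + nsum b)%N.
Proof. by rewrite /nsum -big_split; apply: eq_bigr => i _; rewrite mnmDE mulnDr. Qed.

Lemma nsum_upd c j : nsum (upd k c j) = nsum c.
Proof.
apply: eq_bigr => i _; case: (eqVneq i k) => [->|ik]; first by rewrite Nk !mul0n.
by rewrite updE.
Qed.

Lemma XN_refl c : XN (refl c).
Proof. by rewrite /XN /refl nsum_upd updk leq_subr. Qed.

Lemma reflK c : XN c -> refl (refl c) = c.
Proof. by move=> Xc; rewrite /refl nsum_upd updk upd_upd subKn // upd_id. Qed.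

Lemma nsum0 : nsum 0%MM = 0%N.
Proof. by rewrite /nsum big1 // => i _; rewrite mnm0E muln0. Qed.

Lemma refl0 : refl 0%MM = 0%MM.
Proof. by rewrite /refl nsum0 sub0n -[X in upd _ _ X](mnm0E k) upd_id. Qed.

Lemma refl_eq0 c : XN c -> (refl c == 0%MM) = (c == 0%MM).
Proof.
move=> Xc; apply/eqP/eqP => [z|->]; last exact: refl0.
by rewrite -(reflK Xc) z refl0.
Qed.

Lemma submonXN : submon XN.
Proof.
split; first by rewrite /XN mnm0E.
by rewrite /XN => a b Xa Xb; rewrite nsumD mnmDE leq_add.
Qed.

Lemma reflD a b : XN a -> XN b -> refl (a + b)%MM = (refl a + refl b)%MM.
Proof.
rewrite /XN /refl => Xa Xb; apply/mnmP => i; rewrite [RHS]mnmDE.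
case: (eqVneq i k) => [->|ik]; first by rewrite !updk nsumD mnmDE; lia.
by rewrite !updE // mnmDE.
Qed.

Lemma sum_opP (V : zmodType) (F : 'I_n -> V) c : XN c ->
  \sum_i opP F i *+ refl c i = \sum_i F i *+ c i.
Proof.
move=> Xc; rewrite (bigD1 k) //= [RHS](bigD1 k) //= /opP eqxx /refl updk.
rewrite (eq_bigr (fun i => F i *+ c i + F k *+ (N i * c i))) => [|i ik]; last first.
  by rewrite (negPf ik) updE // mulrnDl -mulrnA.
rewrite big_split /= sumrMnr addrCA [RHS]addrC; congr (_ + _).
have -> : (\sum_(i | i != k) N i * c i = nsum c)%N.
  by rewrite /nsum [RHS](bigD1 k) //= Nk mul0n.
by rewrite mulrnBr // !mulNrn opprK addrAC addNr add0r.
Qed.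

Lemma lin_opP (F : realDomainType) (t : 'I_n -> F) c : XN c ->
  lin (opP t) (refl c) = lin t c.
Proof. exact: sum_opP. Qed.

Lemma pure_refl c : pure k (refl c) = pure k c.
Proof. exact: pure_upd. Qed.

Variables (W W' : 'I_n -> 'I_n -> int).
Hypothesis Wskew : forall i j, W i j = - W j i.
Hypothesis W'skew : forall i j, W' i j = - W' j i.
Hypothesis W'E : forall i j, W' i j = opP (fun p => opP (W p) j) i.

Lemma thetaE (V : 'I_n -> 'I_n -> int) c i : theta V c i = \sum_j V i j *+ c j.
Proof.
rewrite /theta /mform (bigD1 i) //= [X in _ + X]big1 ?addr0 => [|j ji].
  by apply: eq_bigr => j _; rewrite mnm1E eqxx mulr1 -mulr_natr natz.
by apply: big1 => j' _; rewrite mnm1E eq_sym (negPf ji) mulr0 mul0r.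
Qed.

Lemma theta_refl c i : XN c -> theta W' (refl c) i = opP (theta W c) i.
Proof.
move=> Xc; rewrite thetaE; under eq_bigr do rewrite W'E.
rewrite /opP; case: ifP => _.
  by under eq_bigr do rewrite mulNrn; rewrite sumrN sum_opP // thetaE.
under eq_bigr do rewrite mulrnDl -mulrnA mulnC mulrnA.
by rewrite big_split /= sumrMnl !sum_opP // !thetaE.
Qed.

Lemma mform_refl a b : XN a -> XN b -> mform W' (refl a) (refl b) = mform W a b.
Proof.
move=> Xa Xb; rewrite !mform_lin -/(theta _ _) -(lin_opP _ Xa).
by apply: eq_bigr => i _; rewrite -/(theta W' (refl b) i) theta_refl.
Qed.

Definition trans (f : tw W) : tw W' := fun c => if XN c then f (refl c) else 0.

Lemma trans_supp f : suppin XN (trans f).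
Proof. by move=> c /negPf Xc; rewrite /trans Xc. Qed.

Lemma trans_unip f : unip f -> unip (trans f).
Proof. by move=> uf; rewrite /unip /trans (submonXN).1 refl0. Qed.

Lemma transE f c : XN c -> trans f (refl c) = f c.
Proof. by move=> Xc; rewrite /trans XN_refl reflK. Qed.

(** [refl] is an additive involution of [XN] carrying [W] to [W'], so it matches the terms of the
    two products one to one. *)
Lemma transM f g : suppin XN f -> suppin XN g -> trans (f * g) = trans f * trans g.
Proof.
move=> fX gX; apply: twP => c.
have [Xc|Xc] := boolP (XN c); last first.
  rewrite /trans (negPf Xc); apply/esym.
  exact: (suppinM submonXN (@trans_supp f) (@trans_supp g) Xc).
rewrite {1}/trans Xc !twM.
pose S d := filter (fun x => XN x && XN (d - x)%MM) (mbox d).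
have red (V : 'I_n -> 'I_n -> int) (u v : tw V) d : suppin XN u -> suppin XN v ->
    \sum_(x <- mbox d) twist V x (d - x)%MM * u x * v (d - x)%MM =
    \sum_(x <- S d) twist V x (d - x)%MM * u x * v (d - x)%MM.
  move=> uX vX; rewrite big_filter [LHS](bigID (fun x => XN x && XN (d - x)%MM)) /=.
  rewrite [X in _ + X]big1 ?addr0 // => x; rewrite negb_and => /orP[/uX->|/vX->].
    by rewrite mulr0 mul0r.
  by rewrite mulr0.
rewrite !red //; try exact: trans_supp.
have memS d x : XN d -> x \in S d -> [/\ XN x, XN (d - x)%MM, refl x \in S (refl d)
                                      & (refl d - refl x)%MM = refl (d - x)%MM].
  move=> Xd; rewrite mem_filter mem_mbox => /andP[/andP[Xx Xdx] xd].
  have E : refl d = (refl (d - x) + refl x)%MM by rewrite -reflD // submK.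
  have E' : (refl d - refl x)%MM = refl (d - x)%MM by rewrite E addmK.
  by split=> //; rewrite mem_filter mem_mbox E' !XN_refl E lem_addl.
rewrite (perm_big [seq refl x | x <- S c]); last first.
  apply: uniq_perm => [||x]; first exact/filter_uniq/mbox_uniq.
    rewrite map_inj_in_uniq ?filter_uniq ?mbox_uniq // => x y.
    by move=> /(memS _ _ Xc)[Xx _ _ _] /(memS _ _ Xc)[Xy _ _ _] /(congr1 refl); rewrite !reflK.
  apply/idP/mapP => [xS|[y /(memS _ _ Xc)[_ _ ? _] -> //]].
  have [Xx _ ? _] := memS _ _ (XN_refl c) xS.
  by exists (refl x); rewrite ?reflK // -{1}(reflK Xc).
rewrite big_map big_seq [RHS]big_seq; apply: eq_bigr => x /(memS _ _ Xc)[Xx Xcx _ E].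
rewrite E /twist -(mform_refl (XN_refl x) (XN_refl (c - x)%MM)) !reflK //.
by rewrite /trans Xx Xcx.
Qed.

Lemma trans_suppW (X X' : 'X_{1..n} -> bool) f : (forall c, XN c -> X c -> X' (refl c)) ->
  suppin X f -> suppin X' (trans f).
Proof.
move=> XX fX c X'c; rewrite /trans; case: ifP => // Xc.
have [Xr|/fX //] := boolP (X (refl c)).
by have := XX _ (XN_refl c) Xr; rewrite reflK // (negPf X'c).
Qed.

Lemma decomp_trans (F : realDomainType) (t : 'I_n -> F) f p z r : suppin XN f ->
  decomp t f p z r -> decomp (opP t) (trans f) (trans p) (trans z) (trans r).
Proof.
move=> fX D; have [pX zX rX] := decomp_supp submonXN fX D.
have [-> [up pX'] [uz zX'] [ur rX']] := D; split.
- by rewrite !transM //; apply: suppinM submonXN _ _.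
- split; first exact: trans_unip.
  by apply: trans_suppW pX' => c Xc; rewrite /Xp refl_eq0 // lin_opP.
- split; first exact: trans_unip.
  by apply: trans_suppW zX' => c Xc; rewrite /Xz lin_opP.
- split; first exact: trans_unip.
  by apply: trans_suppW rX' => c Xc; rewrite /Xn refl_eq0 // lin_opP.
Qed.

Lemma dlog_trans z l : unip z -> suppin XN z ->
  dlog l (trans z) = trans (dlog (opP l) z).
Proof.
move=> uz zX; apply/esym/dlog_uniq; first exact: trans_unip.
have wX := dlog_supp (opP l) submonXN (conj uz zX); rewrite -transM //.
rewrite -dlogE //; apply: twP => c; rewrite /Der /trans.
by case: ifP => [Xc|]; rewrite ?mulr0 // lin_opP.
Qed.

Lemma incoming_trans f c v : unip f -> suppin XN f -> XN c -> c != 0%MM ->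
  incoming f c v -> incoming (trans f) (refl c) v.
Proof.
move=> uf fX Xc c0 I.
have [p [z [r D]]] := decomp_ex (theta W c) uf.
have [_ zX _] := decomp_supp submonXN fX D; have [_ _ [uz _] _] := D.
have D' := decomp_trans fX D.
have E : opP (theta W c) = theta W' (refl c) by apply: funext => i; rewrite theta_refl.
rewrite E in D'; have rc0 : refl c != 0%MM by rewrite refl_eq0.
apply: (incoming_intro W'skew D' (lin_one_wt_neq0 rc0)).
rewrite dlog_trans // transE // (I _ _ _ D); congr (_ * _).
by rewrite -[in LHS](reflK Xc) lin_opP ?XN_refl.
Qed.

End Reflection.

Section Scattering.
Variables (n : nat) (hh : 'I_n -> nat).
Hypothesis hh_gt0 : forall i, (0 < hh i)%N.

(* The group element of the consistent scattering diagram all of whose incoming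
   walls are the hyperplanes [e_i^perp]. *)
Definition scatter (W : 'I_n -> 'I_n -> int) : tw W :=
  xget 1 [set g : tw W | unip g /\ forall c, c != 0%MM -> incoming g c (kbar hh c)]%classic.

Section Fixed.
Variable W : 'I_n -> 'I_n -> int.
Hypothesis Wskew : forall i j, W i j = - W j i.
Local Notation g := (scatter W).

Lemma scatterP : unip g /\ forall c, c != 0%MM -> incoming g c (kbar hh c).
Proof.
exact: (xgetPex (1 : tw W) (incoming_ex Wskew (kbar hh))).
Qed.

Lemma scatter_uniq (g' : tw W) : unip g' ->
  (forall c, c != 0%MM -> incoming g' c (kbar hh c)) -> g' = g.
Proof. by move=> u I; have [u' I'] := scatterP; apply: (incoming_uniq Wskew u u' I I'). Qed.

(** A basis vector is not a sum of two non-zero exponents, so its coefficient is the incoming one,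
    [b / (b^2 - 1)] with [b = 2 ^ hh i]. This is why no point of the hyperplane [e_i^perp] can avoid
    the walls. *)
Lemma scatter_e i : g U_(i)%MM != 0.
Proof.
have [ug I] := scatterP; set c := U_(i)%MM : 'X_{1..n}.
have c0 : c != 0%MM by rewrite mnm1_eq0.
have irr k l : k != 0%MM -> l != 0%MM -> predT k -> predT l -> (k + l)%MM != c.
  move=> k0 l0 _ _; apply: contra_neq k0 => /(congr1 (@mdeg n)).
  rewrite mdegD mdeg1 => E; apply/eqP; rewrite -mdeg_eq0.
  by move: l0; rewrite -mdeg_eq0; lia.
have sT (f : tw W) : suppin predT f by [].
have [p [z [r D]]] := decomp_ex (theta W c) ug; have [_ _ [uz _] _] := D.
rewrite (decomp_theta_coef Wskew D c0) !(inner_supp _ _ irr) // !addr0.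
have := dlog_coef (@one_wt n) uz c0; rewrite (inner_supp _ _ irr) // addr0.
rewrite (I _ c0 _ _ _ D) => /(mulfI (lin_one_wt_neq0 c0)) ->.
have pc : pure i c by rewrite /c -[U_(i)%MM]mulm1n pure_pow.
rewrite (kbar_pure _ pc c0) /c mnm1E eqxx divr1.
have := klogE (hh i) 1; rewrite big_ord_recr big_ord1 /= klog0 mulr0 add0r !mul1r => <-.
have := bp_gt1 (hh_gt0 i) 0; have := bp_gt1 (hh_gt0 i) 1 => b2 b1.
rewrite mulr1 mulf_neq0 ?invr_eq0 ?subr_eq0 ?gt_eqF //.
by rewrite (lt_trans _ b1).
Qed.

Lemma decomp_theta_scale c r (f p z q : tw W) : (0 < r)%N ->
  decomp (theta W c) f p z q -> decomp (theta W (c *+ r)%MM) f p z q.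
Proof.
move=> r0 [E [up pX] [uz zX] [uq qX]].
have T x : lin (theta W (c *+ r)%MM) x = lin (theta W c) x *+ r.
  rewrite !lin_theta; elim: r {r0} => [|r IH]; first by rewrite mulm0n mform0r.
  by rewrite mulmS mformDr IH mulrS.
split=> //; split=> // x.
- by move=> Hx; apply: pX; move: Hx; rewrite /Xp T pmulrn_lgt0.
- by move=> Hx; apply: zX; move: Hx; rewrite /Xz T mulrn_eq0 eqn0Ngt r0.
- by move=> Hx; apply: qX; move: Hx; rewrite /Xn T pmulrn_llt0.
Qed.

Variables (k : 'I_n) (M : 'I_n -> int).
Hypothesis WM : forall i, W i k = (hh k)%:Z * M i.

Lemma scatter_pure r : g (U_(k) *+ r)%MM = qexp (hh k) r.
Proof.
have [ug I] := scatterP; have hk := hh_gt0 k.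
have [p [z [q D]]] := decomp_ex (theta W U_(k)%MM) ug.
have [gE [up pX] [uz zX] [uq qX]] := D.
have T s : lin (theta W U_(k)%MM) (U_(k) *+ s)%MM = 0.
  by rewrite linMn theta_cc // mul0rn.
have p0 (s : nat) : (0 < s)%N -> p (U_(k) *+ s)%MM = 0.
  move=> s0; apply: pX; rewrite /Xp T ltxx orbF.
  by apply/eqP => /(congr1 (fun x : 'X_{1..n} => x k)); rewrite pureU mnm0E; lia.
have q0 (s : nat) : (0 < s)%N -> q (U_(k) *+ s)%MM = 0.
  move=> s0; apply: qX; rewrite /Xn T ltxx orbF.
  by apply/eqP => /(congr1 (fun x : 'X_{1..n} => x k)); rewrite pureU mnm0E; lia.
have gz s : g (U_(k) *+ s)%MM = z (U_(k) *+ s)%MM.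
  rewrite gE (mul_pure Wskew hk WM) big_ord_recl /= subn0 mulm0n (uq : q _ = 1) mulr1.
  rewrite [X in _ + X]big1 ?addr0 => [|i _]; last by rewrite q0 ?mulr0.
  rewrite (mul_pure Wskew hk WM) big_ord_recr /= subnn mulm0n (up : p _ = 1) mul1r.
  by rewrite big1 ?add0r // => i _; rewrite p0 ?mul0r // subn_gt0.
rewrite gz; elim/ltn_ind: r => r IH.
case: (posnP r) => [->|r0]; first by rewrite mulm0n.
have := congr1 (fun h : tw W => h (U_(k) *+ r)%MM) (dlogE (@one_wt n) uz).
rewrite /= (mul_pure Wskew hk WM) /Der lin_one_wt mdegMn mdeg1 mul1n.
rewrite big_ord_recl /= mulm0n dlog0 mulr0 add0r.
rewrite (eq_bigr (fun s : 'I_r => qexp (hh k) (r - bump 0 s) * klog (hh k) (bump 0 s))).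
  have := klogE (hh k) r; rewrite big_ord_recl /= klog0 mulr0 add0r => <-.
  by apply: mulfI; rewrite pnatr_eq0 -lt0n.
move=> s _; rewrite IH; last by rewrite /bump leq0n add1n; have := ltn_ord s; lia.
congr (_ * _); set t := bump 0 s; have t0 : (0 < t)%N by rewrite /t /bump leq0n.
have c0 : (U_(k) *+ t)%MM != 0%MM :> 'X_{1..n}.
  by apply/eqP => /(congr1 (fun x : 'X_{1..n} => x k)); rewrite pureU mnm0E; lia.
rewrite (I _ c0 _ _ _ (decomp_theta_scale t0 D)) (kbar_pure _ (pure_pow k t) c0) pureU.
rewrite lin_one_wt mdegMn mdeg1 mul1n mulrC divfK //.
by rewrite pnatr_eq0 -lt0n.
Qed.

End Fixed.

Definition pz (x : int) : nat := if x is Posz m then m else 0%N.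

Lemma pzE (x : int) : (pz x)%:Z - (pz (- x))%:Z = x.
Proof. by case: x => [[|m]|m] //=; lia. Qed.

Lemma pz_le0 (x : int) : x <= 0 -> pz x = 0%N.
Proof. by case: x => [[|m]|m]. Qed.

Section Mutation.
Variables (W W' : 'I_n -> 'I_n -> int) (k : 'I_n) (M : 'I_n -> int).
Hypothesis Wskew : forall i j, W i j = - W j i.
Hypothesis W'skew : forall i j, W' i j = - W' j i.
Hypothesis WM : forall i, W i k = (hh k)%:Z * M i.

Let Na i := pz (M i).
Let Nb i := pz (- M i).
Hypothesis W'b : forall i j, W' i j = opP k Nb (fun p => opP k Nb (W p) j) i.

Local Notation g := (scatter W).
Local Notation E := (Eser W k (hh k) : tw W).
Local Notation E' := (Eser W' k (hh k) : tw W').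
Local Notation md := (mdir M).
(** The dilogarithm in direction [k] is split off on the left or on the right. The two remaining
    series are transported by the two linear pieces of the tropical mutation, and the mutated
    dilogarithm is multiplied back on the opposite side. *)
Let a : tw W := tinv E * g.
Let b : tw W := g * tinv E.
Let hk := hh_gt0 k.
Implicit Types c : 'X_{1..n}.

Let Mk : M k = 0 := Mk0 Wskew hk WM.
Let Nak : Na k = 0%N. Proof. by rewrite /Na Mk. Qed.
Let Nbk : Nb k = 0%N. Proof. by rewrite /Nb Mk. Qed.

(** The two linear pieces differ by the transvection [e_i -> e_i + M_i e_k], an isometry of [W]
    because [M_i] is proportional to [W(i, k)]. *)
Let W'a i j : W' i j = opP k Na (fun p => opP k Na (W p) j) i.
Proof.
have Wkk : W k k = 0 by rewrite WM Mk mulr0.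
have Wk x : W k x = - ((hh k)%:Z * M x) by rewrite Wskew WM.
rewrite W'b /opP Wkk oppr0 !mul0rn; case: (i == k) => //; case: (j == k); first by rewrite !mul0rn.
have := pzE (M i); have := pzE (M j); rewrite -/(Na i) -/(Na j) -/(Nb i) -/(Nb j).
have mz (x : int) m : x *+ m = x * m%:Z by rewrite -mulr_natr natz.
by rewrite WM Wk !mz => <- <-; ring.
Qed.

Let W'M i : W' i k = (hh k)%:Z * - M i.
Proof.
have Wkk : W k k = 0 by rewrite WM Mk mulr0.
rewrite W'b /opP eqxx; case: eqP => [->|_]; first by rewrite Wkk Mk; ring.
by rewrite Wkk oppr0 mul0rn addr0 WM; ring.
Qed.

Let mdirN c : mdir (fun i => - M i) c = - md c.
Proof. by rewrite /mdir /lin -sumrN; apply: eq_bigr => i _; rewrite mulNrn. Qed.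

Let mdir_nsum c : md c = (nsum Na c)%:Z - (nsum Nb c)%:Z.
Proof.
rewrite /mdir /lin /nsum -[X in X - _]natz -[X in _ - X]natz !natr_sum -sumrB.
apply: eq_bigr => i _; rewrite -[M i]pzE -mulr_natr !natz !PoszM -/(Na i) -/(Nb i); ring.
Qed.

Let ug : unip g. Proof. by have [] := scatterP Wskew. Qed.
Let gI c : c != 0%MM -> incoming g c (kbar hh c). Proof. by have [_] := scatterP Wskew; apply. Qed.
Let uE : unip E. Proof. exact: unip_E. Qed.

Let Ea : E * a = g. Proof. exact: mulVKu. Qed.
Let bE : b * E = g. Proof. exact: mulrVKu. Qed.
Let uV : unip (tinv E). Proof. by have [] := tinvP uE. Qed.
Let ua : unip a. Proof. exact: unipM. Qed.
Let ub : unip b. Proof. exact: unipM. Qed.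
Let am : suppin (mixed k) a.
Proof. by apply: (ginv_mixed Wskew hk WM (fun r => scatter_pure Wskew WM r.+1)) => //; left. Qed.
Let bm : suppin (mixed k) b.
Proof. by apply: (ginv_mixed Wskew hk WM (fun r => scatter_pure Wskew WM r.+1)) => //; right. Qed.

Let strings c :
  (0 <= md c -> str k a c = Qop (hh k) `|md c|%N (str k b c)) /\
  (md c <= 0 -> str k b c = Qop (hh k) `|md c|%N (str k a c)).
Proof. by move: c; apply/(E_conj_strings Wskew hk WM); rewrite Ea bE. Qed.

Let dd c : nat := \sum_(i | i != k) c i.

Let ddD c c' : dd (c + c')%MM = (dd c + dd c')%N.
Proof. by rewrite /dd -big_split; apply: eq_bigr => i _; rewrite mnmDE. Qed.

Let dd_gt0 c : ~~ pure k c -> (0 < dd c)%N.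
Proof.
apply: contraNltn; rewrite leqn0 sum_nat_eq0 => /forallP H.
by apply/pureP => i ik; have := H i; rewrite ik => /eqP.
Qed.

Let dd_upd c j : dd (upd k c j) = dd c.
Proof. by apply: eq_bigr => i ik; rewrite updE. Qed.

Let kbar_out N c : ~~ XN k N c -> ~~ pure k c -> kbar hh c = 0.
Proof.
move=> Xc pc; apply: contraNeq Xc => /kbar_neq0 [i pic].
have ik : i != k by apply: contraNneq pc => <-.
by rewrite /XN; move/pureP: pic => -> //; rewrite eq_sym.
Qed.

(* Supports propagate: the vectors whose degree transverse to [e_k] is either
   small and in the cone, or large, form a monoid. *)
Let support_step (f : tw W) N s c : unip f -> suppin (mixed k) f -> N k = 0%N ->
  (forall x, (dd x < s)%N -> ~~ XN k N x -> f x = 0) ->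
  dd c = s -> ~~ XN k N c -> ~~ pure k c -> incoming f c (kbar hh c) -> f c = 0.
Proof.
move=> uf fm Nk0 IH cs Xc pc; rewrite (kbar_out Xc pc) => I.
pose X x := mixed k x && ((dd x < s)%N ==> XN k N x).
have sX : submon X.
  have [m0 mD] := submon_mixed k; have [n0 nD] := submonXN k N.
  split; first by rewrite /X m0 n0 implybT.
  rewrite /X => x y /andP[mx Xx] /andP[my Xy]; rewrite mD //=.
  apply/implyP; rewrite ddD => xy.
  apply: nD; [move: Xx|move: Xy]; move/implyP; apply; lia.
have fX : suppin X f.
  move=> x; rewrite negb_and => /orP[/fm //|]; rewrite negb_imply => /andP[xs Xx].
  exact: IH.
have c0 : c != 0%MM by apply: contraNneq pc => ->; exact: pure0.
apply: (incoming_irr Wskew sX fX uf c0 _ I) => x y x0 y0.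
rewrite /X /mixed (negPf x0) (negPf y0) /= => /andP[/dd_gt0 dx Xx] /andP[/dd_gt0 dy Xy].
apply: contraNneq Xc => cxy; move: cs; rewrite -cxy ddD => E0.
by apply: (submonXN k N).2; [move: Xx|move: Xy]; move/implyP; apply; lia.
Qed.

Let incoming_a c : ~~ pure k c -> md c <= 0 -> incoming a c (kbar hh c).
Proof.
move=> pc; have c0 : c != 0%MM by apply: contraNneq pc => ->; exact: pure0.
rewrite le_eqVlt => /orP[/eqP m0|m0].
  by apply/(incoming_El_zero Wskew hk WM _ ua m0 pc); rewrite Ea; apply: gI.
by apply/(incoming_El_pos Wskew hk WM _ ua m0); rewrite Ea; apply: gI.
Qed.

Let incoming_b c : ~~ pure k c -> 0 <= md c -> incoming b c (kbar hh c).
Proof.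
move=> pc; have c0 : c != 0%MM by apply: contraNneq pc => ->; exact: pure0.
rewrite le_eqVlt => /orP[/eqP m0|m0].
  by apply/(incoming_Er_zero Wskew hk WM _ ub (esym m0) pc); rewrite bE; apply: gI.
by apply/(incoming_Er_neg Wskew hk WM _ ub m0); rewrite bE; apply: gI.
Qed.

(** Away from multiples of [e_k]: when [md c <= 0] the series [a] has the incoming walls of [g] and
    [support_step] applies; when [md c >= 0] its string is a string of [b] times a polynomial of
    degree [md c]. The roles are exchanged for [b], so both supports are found in one induction on
    [dd]. *)
Let supports : suppin (XN k Na) a /\ suppin (XN k Nb) b.
Proof.
suff H s c : dd c = s -> (~~ XN k Na c -> a c = 0) /\ (~~ XN k Nb c -> b c = 0).
  by split=> c; have [] := H _ c erefl.
elim/ltn_ind: s c => s IH.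
have pureX N c : pure k c -> ~~ XN k N c -> mixed k c = false.
  move=> pc Xc; rewrite /mixed pc orbF; apply: contraNF Xc => /eqP ->.
  by rewrite (submonXN k N).1.
have str_upto (f : tw W) N c : N k = 0%N ->
    (forall x, dd x = dd c -> md x = md c -> ~~ XN k N x -> f x = 0) ->
    upto0 (nsum N c) (str k f c).
  move=> N0 Hf j Nj; apply: Hf; rewrite ?dd_upd ?(mdir_upd Wskew hk WM) //.
  by rewrite /XN updk nsum_upd // -ltnNge.
have strE (f : tw W) c : f c = str k f c (c k) by rewrite /str upd_id.
have A c : dd c = s -> md c <= 0 -> ~~ XN k Na c -> a c = 0.
  move=> cs m0 Xc; have [pc|pc] := boolP (pure k c).
    by apply: am; rewrite (pureX _ _ pc Xc).
  apply: (support_step ua am Nak _ cs Xc pc (incoming_a pc m0)) => x xs.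
  by have [] := IH _ xs x erefl.
have B c : dd c = s -> 0 <= md c -> ~~ XN k Nb c -> b c = 0.
  move=> cs m0 Xc; have [pc|pc] := boolP (pure k c).
    by apply: bm; rewrite (pureX _ _ pc Xc).
  apply: (support_step ub bm Nbk _ cs Xc pc (incoming_b pc m0)) => x xs.
  by have [] := IH _ xs x erefl.
move=> c cs; have [m0|m0] := leP 0 (md c); split.
- move=> Xc; rewrite strE (strings c).1 // (@upto0_Qop (hh k) (nsum Nb c) _ (str k b c)) //.
    by apply: str_upto => // x xc mx; apply: B; rewrite ?mx // xc.
  by move: Xc; rewrite /XN -ltnNge; have := mdir_nsum c; lia.
- exact: B.
- exact: A cs (ltW m0).
- move=> Xc; rewrite strE (strings c).2 ?(ltW m0) // (@upto0_Qop (hh k) (nsum Na c) _ (str k a c)) //.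
    by apply: str_upto => // x xc mx; apply: A; rewrite ?mx ?(ltW m0) // xc.
  by move: Xc; rewrite /XN -ltnNge; have := mdir_nsum c; lia.
Qed.

Let a' : tw W' := trans k Nb W' b.
Let b' : tw W' := trans k Na W' a.

Let str_trans N (f : tw W) c : N k = 0%N ->
  str k (trans k N W' f) c = rv (nsum N c) (str k f c).
Proof.
move=> N0; apply: funext => j.
by rewrite /str /trans /rv /XN updk nsum_upd // /refl nsum_upd // updk upd_upd.
Qed.

(** The strings of [a'] and [b'] are the reversed strings of [b] and [a], [mdir] changes sign with
    [e_k], and the polynomials linking the strings are palindromic. *)
Let conj' : E' * a' = b' * E'.
Proof.
have [aX bX] := supports.
have up (f : tw W) N c : N k = 0%N -> suppin (XN k N) f -> upto0 (nsum N c) (str k f c).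
  by move=> N0 fX j Nj; apply: fX; rewrite /XN updk nsum_upd // -ltnNge.
apply/(E_conj_strings W'skew hk W'M) => c; rewrite mdirN !str_trans // abszN.
split=> m0.
  rewrite (strings c).2 -?oppr_ge0 // -rv_Qop; last exact: up.
  by congr (rv _ _); have := mdir_nsum c; lia.
rewrite (strings c).1 -?oppr_le0 // -rv_Qop; last exact: up.
by congr (rv _ _); have := mdir_nsum c; lia.
Qed.

(** By uniqueness it suffices to test the incoming walls of [E' * a']. Those along [e_k] come from
    [E']; the others are tested on [a'] or on [b'] according to the sign of [md c], using both
    factorizations. *)
Lemma scatter_mut : [/\ scatter W' = E' * a', scatter W' = b' * E',
  suppin (XN k Na) a & suppin (XN k Nb) b].
Proof.
have [aX bX] := supports.
have ua' : unip a' by apply: trans_unip.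
have ub' : unip b' by apply: trans_unip.
have a'm : suppin (mixed k) a'.
  apply: trans_suppW bm => //.
  by move=> c Xc; rewrite /mixed refl_eq0 // pure_refl.
suff <- : E' * a' = scatter W' by split=> //; exact: conj'.
apply: (scatter_uniq W'skew) => [|c c0]; first exact: unipM.
have [pc|pc] := boolP (pure k c).
  by rewrite (kbar_pure _ pc c0); apply: (incoming_E_pure W'skew hk W'M).
(* On the side where a transported series is tested, a basis vector carrying an incoming wall has
   [N i = 0] and the reflection fixes its multiples, so incoming walls go to incoming walls. *)
have fixed N x i : N k = 0%N -> ~~ pure k x -> pure i x -> N i = 0%N -> refl k N x = x.
  move=> N0 pkx /pureP pix Ni; rewrite -[RHS](upd_id k); congr (upd _ _ _).
  have -> : nsum N x = 0%N.
    rewrite /nsum big1 // => j _; case: (eqVneq j i) => [->|ji]; first by rewrite Ni.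
    by rewrite pix ?muln0.
  rewrite pix // eq_sym; apply: contraNneq pkx => <-; exact/pureP.
have kb N : N k = 0%N -> (forall i x, pure i x -> ~~ pure k x -> md x = md c -> N i = 0%N) ->
    XN k N c -> kbar hh (refl k N c) = kbar hh c.
  move=> N0 H Xc; have mr : md (refl k N c) = md c by rewrite (mdir_upd Wskew hk WM).
  have [[i pic]|nP] := EM (exists i, pure i c).
    by rewrite (fixed _ _ _ N0 pc pic) // (H _ _ pic pc).
  have [[i pic]|nP'] := EM (exists i, pure i (refl k N c)).
    have pc' : ~~ pure k (refl k N c) by rewrite pure_refl.
    have := fixed _ _ _ N0 pc' pic (H _ _ pic pc' mr); rewrite reflK // => E0.
    by case: nP; exists i; rewrite E0.
  transitivity (0 : rat).
    by apply/eqP; apply/negPn; apply/negP => /kbar_neq0.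
  by apply/esym/eqP; apply/negPn; apply/negP => /kbar_neq0.
have tr N (f : tw W) : N k = 0%N -> (forall i j, W' i j = opP k N (fun p => opP k N (W p) j) i) ->
    unip f -> suppin (XN k N) f ->
    (forall i x, pure i x -> ~~ pure k x -> md x = md c -> N i = 0%N) ->
    (forall x, ~~ pure k x -> md x = md c -> incoming f x (kbar hh x)) ->
    incoming (trans k N W' f) c (kbar hh c).
  move=> N0 W'N uf fX H fI; have [Xc|Xc] := boolP (XN k N c); last first.
    rewrite (kbar_out Xc pc).
    by apply: (incoming_out (submonXN k N) (@trans_supp _ _ _ _ _ _) _ Xc); apply: trans_unip.
  rewrite -{1}(reflK N0 Xc) -(kb N N0 H Xc).
  have r0 : refl k N c != 0%MM by rewrite refl_eq0.
  have rI : incoming f (refl k N c) (kbar hh (refl k N c)).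
    by apply: fI; rewrite ?pure_refl // (mdir_upd Wskew hk WM).
  by apply: incoming_trans => //; exact: XN_refl.
have mdpure i x : pure i x -> ~~ pure k x -> 0 < (x i)%:Z /\ md x = M i * (x i)%:Z.
  move=> pix pkx; split; last by rewrite {1}(eqP pix) /mdir linMn lin1 -mulr_natr natz.
  rewrite ltz_nat (pure_neq0 pix) //; apply: contraNneq pkx => ->; exact: pure0.
have [m0|m0] := leP 0 (md c); last first.
  rewrite conj'; apply/(incoming_Er_neg W'skew hk W'M _ ub'); first by rewrite mdirN; lia.
  apply: tr => // [i x pix pkx mx|x pkx mx]; last by apply: incoming_a; rewrite ?mx // ltW.
  by have [xi E0] := mdpure _ _ pix pkx; apply: pz_le0; move: m0; rewrite -mx E0; nia.
have ia' : incoming a' c (kbar hh c).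
  apply: tr => // [i x pix pkx mx|x pkx mx]; last by apply: incoming_b; rewrite ?mx.
  by have [xi E0] := mdpure _ _ pix pkx; apply: pz_le0; move: m0; rewrite -mx E0; nia.
move: m0; rewrite le_eqVlt => /orP[/eqP m0|m0].
  by apply/(incoming_El_zero W'skew hk W'M _ ua' _ pc) => //; rewrite mdirN -m0 oppr0.
by apply/(incoming_El_pos W'skew hk W'M _ ua') => //; rewrite mdirN; lia.
Qed.

(* [t] lies on no wall of the scattering diagram. *)
Definition generic (V : 'I_n -> 'I_n -> int) (F : realDomainType) (t : 'I_n -> F) :=
  exists p r, decomp t (scatter V) p 1 r.

Lemma trans1 N : N k = 0%N -> trans k N W' (1 : tw W) = 1.
Proof.
move=> N0; apply: twP => c; rewrite /trans !tw1.
case: ifP => [Xc|/negP Xc]; first by rewrite refl_eq0.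
by case: eqP Xc => // ->; rewrite (submonXN k N).1.
Qed.

(** As [t k] is non-zero, the dilogarithm belongs to a one-signed factor and is divided out without
    creating a middle factor; the sign of [t k] selects the linear piece. *)
Lemma generic_mut (F : realDomainType) (t : 'I_n -> F) : generic W t -> t k != 0 ->
  generic W' (opP k (if t k < 0 then Nb else Na) t).
Proof.
move=> [p [r D]] tk; have [E1 E2 aX bX] := scatter_mut; have [gE up _ ur] := D.
case: (ltP (t k) 0) => tk0.
  have Db : decomp t b p 1 (r * tinv E).
    split=> //; first by rewrite /b gE !mulrA.
      exact: upart1 (submonXz t).1.
    apply: upartM => //; first exact: submonXn.
    by apply: upartV; [exact: submonXn | exact: E_neg].
  have : decomp (opP k Nb t) a' (trans k Nb W' p) (trans k Nb W' (1 : tw W)) (trans k Nb W' (r * tinv E)).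
    exact: (decomp_trans Nbk W'b bX Db).
  rewrite trans1 // => D'.
  exists (E' * trans k Nb W' p), (trans k Nb W' (r * tinv E)).
  rewrite E1; apply: decomp_El_pos => //.
  by rewrite /opP eqxx oppr_gt0.
have {}tk0 : 0 < t k by rewrite lt_def tk.
have Da : decomp t a (tinv E * p) 1 r.
  split=> //; first by rewrite /a gE !mulrA.
    apply: upartM => //; first exact: submonXp.
    by apply: upartV; [exact: submonXp | exact: E_pos].
  exact: upart1 (submonXz t).1.
have : decomp (opP k Na t) b' (trans k Na W' (tinv E * p)) (trans k Na W' (1 : tw W)) (trans k Na W' r).
  exact: (decomp_trans Nak W'a aX Da).
rewrite trans1 // => D'.
exists (trans k Na W' (tinv E * p)), (trans k Na W' r * E').
rewrite E2; apply: decomp_Er_neg => //.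
by rewrite /opP eqxx oppr_lt0.
Qed.

End Mutation.

Lemma generic_pos (V : 'I_n -> 'I_n -> int) (F : realDomainType) (t : 'I_n -> F) :
  (forall i j, V i j = - V j i) -> (forall i, 0 < t i) -> generic V t.
Proof.
move=> Vs t0; have [ug _] := scatterP Vs; exists (scatter V), 1; split.
- by rewrite !mulr1.
- split=> // c; rewrite /Xp negb_or => /andP[c0]; suff -> : 0 < lin t c by [].
  have [i ci] : exists i, c i != 0%N.
    apply/existsP; apply: contraNT c0; rewrite negb_exists => /forallP H.
    by apply/eqP/mnmP => i; rewrite mnm0E; apply/eqP; have := H i; rewrite negbK.
  rewrite /lin (bigD1 i) //= ltr_pwDl ?pmulrn_rgt0 ?lt0n //.
  by apply: sumr_ge0 => j _; rewrite mulrn_wge0 // ltW.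
- exact: upart1 (submonXz t).1.
- exact: upart1 (submonXn t).1.
Qed.

(** If [t i = 0], the coefficient at the indecomposable exponent [e_i] would have to come from the
    middle factor 1, against [scatter_e]. *)
Lemma generic_neq0 (V : 'I_n -> 'I_n -> int) (F : realDomainType) (t : 'I_n -> F) i :
  (forall i j, V i j = - V j i) -> generic V t -> t i != 0.
Proof.
move=> Vs [p [r D]]; apply: contraTneq (scatter_e Vs i) => ti.
have c0 : U_(i)%MM != 0%MM :> 'X_{1..n} by rewrite mnm1_eq0.
have [gE up uz ur] := D; rewrite gE mulr1 tw_mul_unip //; [|exact: up.1|exact: ur.1].
have [p0 _ r0] := upart_sign c0 up uz ur.
rewrite p0 ?r0 ?lin1 ?ti // !add0r (inner_supp (X := predT)) //.
move=> x y x0 y0 _ _; apply: contra_neq x0 => /(congr1 (@mdeg n)).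
rewrite mdegD mdeg1 => E; apply/eqP; rewrite -mdeg_eq0.
by move: y0; rewrite -mdeg_eq0; lia.
Qed.

End Scattering.

(** * Seeds in coordinates *)

(* [B i j] is the form [{e_i, e_j}] and [x i] is the value
   of [e_i] at a tropical point. *)
Section Dynamics.
Variables (n : nat) (d : 'I_n -> nat).
Implicit Types (B : 'I_n -> 'I_n -> rat) (i j k l : 'I_n) (w : seq 'I_n) (U : {set 'I_n}).

Definition eps B i j : rat := B i j * (d j)%:R.

Definition mutB k B i j : rat :=
  if i == k then - B k j else if j == k then - B i k
  else B i j + (pospart (eps B i k))%:R * B k j + (pospart (eps B j k))%:R * B i k.

(** The gluing map [T_k] in coordinates: the mutated basis evaluated at the image point. The
    subtracted term is the contribution of [v_k], with the factor [d_k] absorbed into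
    [eps B i k]. *)
Definition tau (R : realFieldType) k B (x : 'I_n -> R) i : R :=
  if i == k then - x k
  else x i + (pospart (eps B i k))%:R * x k - Num.max (x k) 0 * ratr (eps B i k).

Fixpoint Bpath B w := if w is k :: w' then Bpath (mutB k B) w' else B.

Fixpoint tpath (R : realFieldType) B w (x : 'I_n -> R) : 'I_n -> R :=
  if w is k :: w' then tpath (mutB k B) w' (tau k B x) else x.

Lemma Bpath_cat B w w' : Bpath B (w ++ w') = Bpath (Bpath B w) w'.
Proof. by elim: w B => /=. Qed.

Lemma tpath_cat (R : realFieldType) B w w' (x : 'I_n -> R) :
  tpath B (w ++ w') x = tpath (Bpath B w) w' (tpath B w x).
Proof. by elim: w B x => /=. Qed.

Lemma pospart_intr (m : int) : pospart m%:~R = pz m.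
Proof.
by rewrite /pospart truncEfloor intrKfloor; case: m. Qed.

Lemma pospartE (q : rat) : q \is a Num.int ->
  (pospart q)%:R - (pospart (- q))%:R = q :> rat.
Proof.
move=> /intrP[m ->]; rewrite -rmorphN !pospart_intr !pmulrn -rmorphB /=.
by rewrite pzE.
Qed.

Lemma pospart_max (q : rat) : q \is a Num.int -> (pospart q)%:R = Num.max q 0 :> rat.
Proof.
move=> /intrP[m ->]; rewrite pospart_intr pmulrn maxEle lerz0.
by case: m => [[|m]|m].
Qed.

Definition valid (U : {set 'I_n}) B :=
  (forall i j, B i j = - B j i) /\
  forall i k, k \in U -> eps B i k \is a Num.int /\ eps B k i \is a Num.int.

Lemma valid_diag U B k : valid U B -> B k k = 0.
Proof. by move=> [sB _]; have := sB k k; lra. Qed.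

Lemma pospart_int_mul (q r : rat) : q \is a Num.int -> q * r \is a Num.int ->
  (pospart q)%:R * r \is a Num.int.
Proof.
move=> qi qr; rewrite pospart_max // maxEle; case: ifP => // _.
by rewrite mul0r rpred0.
Qed.

Lemma valid_mut U B k : k \in U -> valid U B -> valid U (mutB k B).
Proof.
move=> kU vB; have [sB iB] := vB; have Bkk := valid_diag k vB; split.
  move=> i j; rewrite /mutB; case: (eqVneq i k) => ik; case: (eqVneq j k) => jk.
  - by rewrite ik jk Bkk oppr0.
  - by rewrite (sB k j).
  - by rewrite (sB i k).
  - by rewrite (sB i j) (sB k j) (sB i k); ring.
move=> i l lU; rewrite /eps /mutB.
have [il li] := iB i l lU; have [kl lk] := iB k l lU; have [ik ki] := iB i k kU.
have [kl' lk'] := iB l k kU.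
case: (eqVneq i k) => [->|nik]; case: (eqVneq l k) => [->|nlk].
- by rewrite Bkk oppr0 mul0r rpred0.
- by rewrite !mulNr !rpredN.
- by rewrite !mulNr !rpredN; split; [have [] := iB i k kU|have [] := iB i k kU].
have E1 : (pospart (eps B i k))%:R * B k l * (d l)%:R \is a Num.int.
  by rewrite -mulrA rpredM // rpred_nat.
have E2 : (pospart (eps B l k))%:R * B k i * (d i)%:R \is a Num.int.
  by rewrite -mulrA rpredM // rpred_nat.
(* [B i k * d l] alone need not be integral; multiplied by [eps B l k] it is, up to sign, a product
   of two integral exchange entries. *)
have E3 : (pospart (eps B l k))%:R * B i k * (d l)%:R \is a Num.int.
  rewrite -mulrA; apply: pospart_int_mul => //.
  have -> : eps B l k * (B i k * (d l)%:R) = - (eps B k l * eps B i k).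
    by rewrite /eps (sB l k); ring.
  by rewrite rpredN rpredM.
have E4 : (pospart (eps B i k))%:R * B l k * (d i)%:R \is a Num.int.
  rewrite -mulrA; apply: pospart_int_mul => //.
  have -> : eps B i k * (B l k * (d i)%:R) = - (eps B k i * eps B l k).
    by rewrite /eps (sB i k); ring.
  by rewrite rpredN rpredM.
by split; rewrite !mulrDl !rpredD.
Qed.

Lemma mutB_inv U B k : k \in U -> valid U B -> mutB k (mutB k B) = B.
Proof.
move=> kU vB; have [sB iB] := vB; have Bkk := valid_diag k vB.
have N x : x != k -> eps (mutB k B) x k = - eps B x k.
  by move=> xk; rewrite /eps /mutB eqxx (negPf xk) mulNr.
apply: funext => i; apply: funext => j; rewrite {1}/mutB.
case: (eqVneq i k) => [->|ik].
  by rewrite /mutB eqxx opprK.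
case: (eqVneq j k) => [->|jk]; first by rewrite /mutB eqxx (negPf ik) opprK.
rewrite !N // /mutB eqxx (negPf ik) (negPf jk).
have Ei := pospartE (iB i k kU).1; have Ej := pospartE (iB j k kU).1.
have -> : (pospart (eps B i k))%:R = eps B i k + (pospart (- eps B i k))%:R :> rat.
  by move: Ei; lra.
have -> : (pospart (eps B j k))%:R = eps B j k + (pospart (- eps B j k))%:R :> rat.
  by move: Ej; lra.
by rewrite /eps (sB j k); ring.
Qed.

Lemma ratr_pospart (R : realFieldType) (q : rat) : q \is a Num.int ->
  ratr q = (pospart q)%:R - (pospart (- q))%:R :> R.
Proof. by move=> qi; rewrite -[X in ratr X](pospartE qi) rmorphB /= !ratr_nat. Qed.

Section Tau.
Variable R : realFieldType.
Implicit Types x y : 'I_n -> R.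

Lemma tau_le0 U B k x : k \in U -> valid U B -> x k <= 0 ->
  tau k B x = fun i => if i == k then - x k else x i + (pospart (eps B i k))%:R * x k.
Proof.
move=> kU [sB iB] xk; apply: funext => i; rewrite /tau; case: eqP => // _.
by rewrite maxEle xk mul0r subr0.
Qed.

Lemma tau_ge0 U B k x : k \in U -> valid U B -> 0 <= x k ->
  tau k B x = fun i => if i == k then - x k else x i + (pospart (- eps B i k))%:R * x k.
Proof.
move=> kU [sB iB] xk; apply: funext => i; rewrite /tau; case: eqP => // _.
by rewrite max_l // ratr_pospart ?(iB i k kU).1 //; ring.
Qed.

Lemma tau_inv U B k x : k \in U -> valid U B -> tau k (mutB k B) (tau k B x) = x.
Proof.
move=> kU vB; have vB' := valid_mut kU vB.
have N i : i != k -> eps (mutB k B) i k = - eps B i k.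
  by move=> xk; rewrite /eps /mutB eqxx (negPf xk) mulNr.
have Tk : tau k B x k = - x k by rewrite /tau eqxx.
have [xk|xk] := leP (x k) 0.
  rewrite (tau_ge0 (U := U)) // ?Tk ?oppr_ge0 //; apply: funext => i.
  case: eqVneq => [->|ik]; first by rewrite opprK.
  by rewrite N // opprK (tau_le0 (U := U)) // (negPf ik); ring.
rewrite (tau_le0 (U := U)) // ?Tk ?oppr_le0 ?ltW //; apply: funext => i.
case: eqVneq => [->|ik]; first by rewrite opprK.
by rewrite N // (tau_ge0 (U := U)) ?ltW // (negPf ik); ring.
Qed.

End Tau.

Lemma valid_path U B w : all (mem U) w -> valid U B -> valid U (Bpath B w).
Proof.
elim: w B => //= k w IH B /andP[kU wU] vB.
by apply: IH => //; apply: valid_mut.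
Qed.

Lemma Bpath_rev U B w : all (mem U) w -> valid U B -> Bpath (Bpath B w) (rev w) = B.
Proof.
elim: w B => //= k w IH B /andP[kU wU] vB; rewrite rev_cons -cats1 Bpath_cat IH //.
  by rewrite /= (mutB_inv kU vB).
exact: valid_mut.
Qed.

Lemma tpath_rev (R : realFieldType) U B w (x : 'I_n -> R) : all (mem U) w -> valid U B ->
  tpath (Bpath B w) (rev w) (tpath B w x) = x.
Proof.
elim: w B x => //= k w IH B x /andP[kU wU] vB; have vB' := valid_mut kU vB.
by rewrite rev_cons -cats1 tpath_cat IH // (Bpath_rev wU vB') /= (tau_inv _ kU vB).
Qed.

(** * Non-vanishing of coordinates along mutation paths *)

Section Nonvanishing.
Variables (R : realFieldType) (U : {set 'I_n}).
Hypothesis d_gt0 : forall i, (0 < d i)%N.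

(** The sign gives [M i = - eps B i k], so that the reflection with [pz (- M i)] is the rule
    mutating seeds. For unfrozen [k] the exponent [D / d k] of the dilogarithm divides the column of
    [e_k]. *)
Definition form_at D (W : 'I_n -> 'I_n -> int) B := forall i j, (W i j)%:~R = - (D%:R * B i j).

Definition generic_at D B (x : 'I_n -> R) :=
  exists W, form_at D W B /\ generic (fun i => (D %/ d i)%N) W x.

Lemma form_at_skew D W B : valid U B -> form_at D W B -> forall i j, W i j = - W j i.
Proof.
move=> [sB _] F i j; apply: (intr_inj (R := rat)); rewrite rmorphN /= !F (sB i j).
by rewrite mulrN.
Qed.

Lemma generic_at_mut D B k x : (0 < D)%N -> (forall i, d i %| D)%N ->
  k \in U -> valid U B -> generic_at D B x -> generic_at D (mutB k B) (tau k B x).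
Proof.
move=> D0 dD kU vB [W [F g]]; have [sB iB] := vB.
have sW := form_at_skew vB F.
have hh0 i : (0 < D %/ d i)%N by rewrite divn_gt0 //; apply: dvdn_leq.
have Dd i : (D%:R : rat) = (D %/ d i)%N%:R * (d i)%:R by rewrite -natrM divnK.
pose M i := - Num.floor (eps B i k).
have ME i : (M i)%:~R = - eps B i k.
  by rewrite /M rmorphN /= floorK ?(iB i k kU).1.
have WM i : W i k = (D %/ d k)%N%:Z * M i.
  apply: (intr_inj (R := rat)); rewrite rmorphM /= F ME (Dd k) -pmulrn.
  by rewrite /eps; ring.
have Mk : M k = 0.
  by apply: (intr_inj (R := rat)); rewrite ME /eps (valid_diag k vB) mul0r oppr0.
have Nb i : pz (- M i) = pospart (eps B i k).
  by rewrite -pospart_intr rmorphN /= ME opprK.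
have Na i : pz (M i) = pospart (- eps B i k) by rewrite -pospart_intr ME.
pose W' i j := opP k (fun i => pz (- M i)) (fun p => opP k (fun i => pz (- M i)) (W p) j) i.
have F' : form_at D W' (mutB k B).
  move=> i j; rewrite /W' /opP /mutB !Nb; have Wkk : W k k = 0 by rewrite WM Mk mulr0.
  have Fk := valid_diag k vB.
  case: (eqVneq i k) => ik; case: (eqVneq j k) => jk.
  - by rewrite jk Fk Wkk !oppr0 mulr0 oppr0.
  - by rewrite Wkk mul0rn addr0 rmorphN /= F; ring.
  - by rewrite Wkk oppr0 mul0rn addr0 rmorphN /= F; ring.
  by rewrite Wkk mul0rn addr0 !rmorphD /= !rmorphMn /= !F; ring.
have xk : x k != 0 by exact: (generic_neq0 hh0 k sW g).
have sW' := form_at_skew (valid_mut kU vB) F'.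
exists W'; split=> //.
have := generic_mut hh0 sW sW' WM (fun i j => erefl) g xk.
set v := opP _ _ _; suff -> : tau k B x = v by [].
apply: funext => i; rewrite /v /opP; case: (ltP (x k) 0) => xk0.
  by rewrite (tau_le0 kU vB) ?ltW // Nb mulr_natl.
by rewrite (tau_ge0 kU vB) // Na mulr_natl.
Qed.

(* Points of the open positive chamber never meet the walls of another seed. *)
Theorem tpath_neq0 B w (x : 'I_n -> R) i : all (mem U) w -> valid U B ->
  (forall j, 0 < x j) -> tpath B w x i != 0.
Proof.
move=> wU vB x0.
(* A common multiple of the multipliers and of the denominators of the form. The same [D] serves
   along the whole path, since mutation acts integrally on [W]. *)
pose D := (\prod_j d j * \prod_i \prod_j `|denq (B i j)|)%N.
have D0 : (0 < D)%N.
  rewrite muln_gt0 prodn_gt0 //=; apply: prodn_gt0 => j; apply: prodn_gt0 => l.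
  by rewrite absz_gt0 denq_neq0.
have dD j : (d j %| D)%N by rewrite dvdn_mulr // (bigD1 j) //= dvdn_mulr.
have [W F] : exists W, form_at D W B.
  exists (fun j l => Num.floor (- (D%:R * B j l))) => j l; rewrite floorK //.
  have /dvdnP[q ->] : (`|denq (B j l)| %| D)%N.
    by rewrite dvdn_mull // (bigD1 j) //= (bigD1 l) //= -mulnA dvdn_mulr.
  rewrite rpredN natrM -mulrA rpredM ?rpred_nat // -[X in _%:R * X]divq_num_den.
  rewrite pmulrn gtz0_abs ?denq_gt0 // mulrCA divff ?mulr1 ?rpred_int //.
  by rewrite intr_eq0 denq_neq0.
have hh0 j : (0 < D %/ d j)%N by rewrite divn_gt0 //; apply: dvdn_leq.
have gx : generic_at D B x.
  by exists W; split=> //; apply: generic_pos => //; exact: form_at_skew F.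
have nz B' (y : 'I_n -> R) : valid U B' -> generic_at D B' y -> y i != 0.
  by move=> vB' [W' [F' g]]; apply: (generic_neq0 hh0 i (form_at_skew vB' F') g).
clearbody D; elim: w B x wU vB gx {W F x0} => [|k w IH] B x /=.
  by move=> _; apply: nz.
move=> /andP[kU wU] vB gx; apply: IH => //; first exact: valid_mut.
exact: generic_at_mut.
Qed.

End Nonvanishing.

End Dynamics.

(** * Linearity and sign coherence of the transition maps on a chamber *)

Section Chambers.
Variables (n : nat) (d : 'I_n -> nat) (U : {set 'I_n}) (R : realFieldType).
Hypothesis d_gt0 : forall i, (0 < d i)%N.
Local Notation Bpath := (Bpath d).
Local Notation tpath := (tpath d).
Local Notation valid := (valid d U).
Implicit Types (B : 'I_n -> 'I_n -> rat) (i j k l : 'I_n) (w : seq 'I_n) (x y : 'I_n -> R).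

Definition nonneg x := forall i, i \in U -> 0 <= x i.
Definition positive x := forall i, i \in U -> 0 < x i.

(** Frozen coordinates never enter the mutation rule of other coordinates; they are only translated,
    by an amount depending on the unfrozen ones. Later arguments may therefore choose them
    freely. *)
Lemma tpath_auto B w x y : all (mem U) w -> (forall i, i \in U -> x i = y i) ->
  (forall i, i \in U -> tpath B w x i = tpath B w y i) /\
  (forall i, i \notin U -> tpath B w x i - x i = tpath B w y i - y i).
Proof.
elim: w B x y => [|k w IH] B x y /=; first by move=> _ E; split=> // i _; rewrite !subrr.
move=> /andP[kU wU] E.
have E1 i : i \in U -> tau d k B x i = tau d k B y i.
  by move=> iU; rewrite /tau !(E _ kU) (E _ iU).
have E2 i : i \notin U -> tau d k B x i - x i = tau d k B y i - y i.
  move=> iU; have /negPf ik : i != k by apply: contraNneq iU => ->.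
  by rewrite /tau ik !(E _ kU); ring.
have [I1 I2] := IH (mutB d k B) _ _ wU E1; split=> // i iU.
by have := I2 i iU; have := E2 i iU; lra.
Qed.

Definition lift_pos x i : R := if i \in U then x i else 1.

Lemma tpath_neq0_U B w x i : all (mem U) w -> valid B -> positive x -> i \in U ->
  tpath B w x i != 0.
Proof.
move=> wU vB x0 iU.
have -> : tpath B w x i = tpath B w (lift_pos x) i.
  have E j : j \in U -> x j = lift_pos x j by move=> jU; rewrite /lift_pos jU.
  exact: (tpath_auto B wU E).1.
apply: (tpath_neq0 (U := U)) => // j; rewrite /lift_pos.
by case: ifP => [/x0 //|_]; exact: ltr01.
Qed.

(** A non-zero coefficient on an unconstrained coordinate, or two coefficients of opposite signs,
    would allow the coordinates to be tuned so that the sum vanishes. *)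
Lemma sign_coherence (c : 'I_n -> int) :
  (forall x, positive x -> \sum_j x j * (c j)%:~R != 0) ->
  (forall j, j \notin U -> c j = 0) /\ ((forall j, 0 <= c j) \/ (forall j, c j <= 0)).
Proof.
move=> H.
have cR j : (c j)%:~R = 0 :> R -> c j = 0 by move/eqP; rewrite intr_eq0 => /eqP.
have upd1 (t : R) i x : \sum_j (if j == i then t else x j) * (c j)%:~R =
    t * (c i)%:~R + \sum_(j | j != i) x j * (c j)%:~R.
  rewrite (bigD1 i) //= eqxx; congr (_ + _); apply: eq_bigr => j /negPf -> //.
have F j : j \notin U -> c j = 0.
  move=> jU; apply: cR; apply/eqP; apply: contraT => cj.
  pose s : R := \sum_(i | i != j) 1 * (c i)%:~R.
  have := H (fun i => if i == j then - s / (c j)%:~R else 1); rewrite upd1 divfK // addNr eqxx.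
  apply=> i iU; case: eqP => [ij|_]; last exact: ltr01.
  by move: jU; rewrite -ij iU.
split=> //.
have [[p cp]|np] := EM (exists p, 0 < c p); last first.
  by right=> j; rewrite leNgt; apply/negP => cj; case: np; exists j.
have [[q cq]|nq] := EM (exists q, c q < 0); last first.
  by left=> j; rewrite leNgt; apply/negP => cj; case: nq; exists j.
exfalso.
have pq : q != p by apply: contraTneq cq => ->; rewrite -leNgt ltW.
have cpR : 0 < (c p)%:~R :> R by rewrite ltr0z.
have cqR : (c q)%:~R < 0 :> R by rewrite ltrz0.
pose s : R := \sum_(j | (j != p) && (j != q)) 1 * (c j)%:~R.
have S (tp tq : R) : 0 < tp -> 0 < tq -> tp * (c p)%:~R + (tq * (c q)%:~R + s) != 0.
  move=> tp0 tq0.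
  have := H (fun j => if j == p then tp else if j == q then tq else 1).
  rewrite upd1 (bigD1 q) //= eqxx (eq_bigr (fun j => 1 * (c j)%:~R)); last first.
    by move=> j /andP[_ /negPf ->].
  by apply=> j _; case: ifP => // _; case: ifP => // _; exact: ltr01.
have [s0|s0] := leP 0 s.
  have := S 1 (((c p)%:~R + s) / - (c q)%:~R) ltr01 _.
  rewrite divr_gt0 ?oppr_gt0 ?ltr_wpDr // => /(_ isT) /eqP; apply.
  by field; rewrite lt_eqF // andbT.
have := S ((- (c q)%:~R - s) / (c p)%:~R) 1 _ ltr01.
rewrite divr_gt0 // ?subr_gt0 => [/(_ isT) /eqP|]; last first.
  by rewrite (lt_trans s0) // oppr_gt0.
by apply; field; rewrite gt_eqF.
Qed.

Lemma mutB_opP B k N i j : valid B -> k \in U ->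
  (N = (fun i => pospart (eps d B i k))) \/ (N = fun i => pospart (- eps d B i k)) ->
  mutB d k B i j = opP k N (fun p => opP k N (B p) j) i.
Proof.
move=> vB kU HN; have [sB iB] := vB; have Bkk := valid_diag k vB.
rewrite /mutB /opP; case: (eqVneq i k) => ik; case: (eqVneq j k) => jk.
- by rewrite jk Bkk oppr0.
- by rewrite Bkk mul0rn addr0.
- by rewrite Bkk oppr0 mul0rn addr0.
rewrite Bkk mul0rn addr0 -[B i k *+ _]mulr_natr -[B k j *+ _]mulr_natr.
case: HN => -> /=; first by ring.
have Ei := pospartE (iB i k kU).1; have Ej := pospartE (iB j k kU).1.
have -> : (pospart (eps d B i k))%:R = eps d B i k + (pospart (- eps d B i k))%:R :> rat.
  by move: Ei; lra.
have -> : (pospart (eps d B j k))%:R = eps d B j k + (pospart (- eps d B j k))%:R :> rat.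
  by move: Ej; lra.
by rewrite /eps (sB j k); ring.
Qed.

Lemma opP_sum (S : pzRingType) (k : 'I_n) (N : 'I_n -> nat) (v : 'I_n -> S)
    (F : 'I_n -> 'I_n -> int) i :
  opP k N (fun l => \sum_j v j * (F j l)%:~R) i = \sum_j v j * (opP k N (F j) i)%:~R.
Proof.
rewrite /opP; case: ifP => _.
  by rewrite -sumrN; apply: eq_bigr => j _; rewrite rmorphN mulrN.
rewrite -sumrMnl -big_split /=; apply: eq_bigr => j _.
by rewrite rmorphD rmorphMn /= mulrDr mulrnAr.
Qed.

(** The second clause transports the form by the same matrix. The third says that [C] respects the
    sublattice spanned by the [d_i e_i]; it later shows that a permutation of seeds preserves the
    multipliers. *)
Definition chart_matrix B w (C : 'I_n -> 'I_n -> int) :=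
  [/\ forall x, nonneg x -> forall i, tpath B w x i = \sum_j x j * (C j i)%:~R,
      forall i l, Bpath B w i l = \sum_p (\sum_q B p q * (C q l)%:~R) * (C p i)%:~R
    & forall j i, exists m : int, (d i)%:Z * C j i = (d j)%:Z * m].

Lemma positive_nonneg x : positive x -> nonneg x.
Proof. by move=> x0 i /x0 /ltW. Qed.

Lemma chart_matrix_sign B w C i : all (mem U) w -> valid B -> chart_matrix B w C ->
  i \in U -> (forall j, j \notin U -> C j i = 0) /\
             ((forall j, 0 <= C j i) \/ (forall j, C j i <= 0)).
Proof.
move=> wU vB [L _ _] iU; apply: (@sign_coherence (fun j => C j i)) => x x0.
by rewrite -L; [exact: tpath_neq0_U | exact: positive_nonneg].
Qed.

Lemma col_ge0 (c : 'I_n -> int) x : nonneg x -> (forall j, j \notin U -> c j = 0) ->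
  (forall j, 0 <= c j) -> 0 <= \sum_j x j * (c j)%:~R.
Proof.
move=> x0 cU c0; apply: sumr_ge0 => j _; have [jU|/cU->] := boolP (j \in U).
  by rewrite mulr_ge0 ?x0 ?ler0z.
by rewrite mulr0.
Qed.

Lemma col_le0 (c : 'I_n -> int) x : nonneg x -> (forall j, j \notin U -> c j = 0) ->
  (forall j, c j <= 0) -> \sum_j x j * (c j)%:~R <= 0.
Proof.
move=> x0 cU c0; rewrite -oppr_ge0 -sumrN.
under eq_bigr do rewrite -mulrN -rmorphN.
by apply: (col_ge0 (c := fun j => - c j)) => // j; rewrite ?oppr_ge0 // => /cU->; rewrite oppr0.
Qed.

Lemma chart_matrix_ex B w : all (mem U) w -> valid B -> exists C, chart_matrix B w C.
Proof.
move=> + vB; elim/last_ind: w => [|w k IH].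
  move=> _; exists (fun j i => (j == i)%:Z); split.
  - move=> x _ i /=; rewrite (bigD1 i) //= eqxx mulr1 big1 ?addr0 // => j /negPf ->.
    by rewrite mulr0.
  - move=> i l /=; rewrite (bigD1 i) //= eqxx mulr1 [X in _ + X]big1 ?addr0 => [|j /negPf ->].
      rewrite (bigD1 l) //= eqxx mulr1 big1 ?addr0 // => j /negPf ->.
      by rewrite mulr0.
    by rewrite mulr0.
  - move=> j i; exists (j == i)%:Z; case: eqP => [->//|_]; by rewrite !mulr0.
rewrite all_rcons => /andP[kU wU]; have [C HC] := IH wU; have [L1 L2 L3] := HC.
have vB' := valid_path wU vB; set B' := Bpath B w in vB' L2.
have [Z S] := chart_matrix_sign wU vB HC kU.
(* Sign coherence of column [k] keeps that coordinate of one sign on the whole chamber, so a single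
   linear branch of [tau] applies there. *)
have [N HN TN] : exists2 N : 'I_n -> nat,
    (N = (fun i => pospart (eps d B' i k))) \/ (N = fun i => pospart (- eps d B' i k)) &
    forall x, nonneg x -> tau d k B' (tpath B w x) = opP k N (tpath B w x).
  have ht (y : 'I_n -> R) N i : opP k N y i = if i == k then - y k else y i + (N i)%:R * y k.
    by rewrite /opP mulr_natl.
  case: S => S; [exists (fun i => pospart (- eps d B' i k)); first by right
                |exists (fun i => pospart (eps d B' i k)); first by left];
    move=> x x0; apply: funext => i; rewrite ht.
    by rewrite (tau_ge0 kU vB') // L1 // col_ge0.
  by rewrite (tau_le0 kU vB') // L1 // col_le0.
exists (fun j => opP k N (C j)); split.
- move=> x x0 i; rewrite -cats1 tpath_cat /= -/B' TN // -opP_sum.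
  by congr opP; apply: funext => l; exact: L1.
- move=> i l; rewrite -cats1 Bpath_cat /= -/B' (mutB_opP _ _ vB' kU HN).
  rewrite -(opP_sum _ _ (fun p => \sum_q B p q * (opP k N (C q) l)%:~R)).
  congr opP; apply: funext => a.
  under [RHS]eq_bigr do rewrite -opP_sum.
  rewrite (_ : B' a = fun l => \sum_p (\sum_q B p q * (C q l)%:~R) * (C p a)%:~R); last first.
    by apply: funext => b; exact: L2.
  rewrite /opP; case: ifP => _; first by rewrite -sumrN; apply: eq_bigr => p _; rewrite mulNr.
  by rewrite -sumrMnl -big_split; apply: eq_bigr => p _ /=; rewrite mulrDl mulrnAl.
- move=> j i; have [m Hm] := L3 j i; have [m' Hm'] := L3 j k.
  rewrite /opP; case: eqP => [->|_]; first by exists (- m'); rewrite !mulrN Hm'.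
  have [N' HN'] : exists N' : int, (d i)%:Z * (N i)%:Z = (d k)%:Z * N'.
    have [_ iB] := vB'; have [i1 i2] := iB i k kU.
    have E : (d i)%:R * eps d B' i k = - ((d k)%:R * eps d B' k i).
      by have [sB _] := vB'; rewrite /eps (sB i k); ring.
    have P q r : q \is a Num.int -> r \is a Num.int -> (d i)%:R * q = (d k)%:R * r ->
        exists N' : int, (d i)%:Z * (pospart q)%:Z = (d k)%:Z * N'.
      move=> qi ri qr; exists (pospart r); apply: (intr_inj (R := rat)).
      rewrite !rmorphM /= -!pmulrn !pospart_max // !maxr_pMr ?ler0n //.
      by rewrite qr !mulr0.
    case: HN => ->; first by apply: (P _ (- eps d B' k i)); rewrite ?rpredN // E mulrN.
    by apply: (P _ (eps d B' k i)); rewrite ?rpredN // mulrN E opprK.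
  exists (m + N' * m'); rewrite -mulr_natr natz mulrDr Hm mulrDr; congr (_ + _).
  transitivity ((d i)%:Z * (N i)%:Z * C j k); first by ring.
  rewrite HN'; transitivity (N' * ((d k)%:Z * C j k)); first by ring.
  by rewrite Hm'; ring.
Qed.

End Chambers.

Section FrozenMonotone.
Variables (n : nat) (d : 'I_n -> nat) (U : {set 'I_n}) (R : realFieldType).
Hypothesis d_gt0 : forall i, (0 < d i)%N.
Local Notation Bpath := (Bpath d).
Local Notation tpath := (tpath d).
Local Notation valid := (valid d U).
Local Notation nonneg := (nonneg U).
Local Notation positive := (positive U).
Implicit Types (B : 'I_n -> 'I_n -> rat) (i j k l : 'I_n) (w : seq 'I_n) (x y : 'I_n -> R).

(* Otherwise a suitable value of the frozen coordinate would make the image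
   vanish. *)
Lemma frozen_le_pos B w x i : all (mem U) w -> valid B -> positive x -> i \notin U ->
  x i <= tpath B w x i.
Proof.
move=> wU vB x0 iU; rewrite leNgt; apply/negP => lt.
pose c := x i - tpath B w x i.
pose y j := if j \in U then x j else if j == i then c else 1.
have E j : j \in U -> x j = y j by move=> jU; rewrite /y jU.
have := (tpath_auto d B wU E).2 i iU; rewrite {2}/y (negPf iU) eqxx => Ey.
have : tpath B w y i != 0.
  apply: (tpath_neq0 (U := U)) => // j; rewrite /y; case: ifP => [/x0 //|_].
  by case: eqP => _; rewrite /c ?subr_gt0.
by apply/negP; rewrite negbK; apply/eqP; move: Ey; rewrite /c; lra.
Qed.

Lemma tpath_lin B w : all (mem U) w -> valid B -> exists C : 'I_n -> 'I_n -> R,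
  forall x, nonneg x -> forall i, tpath B w x i = \sum_j x j * C j i.
Proof.
by move=> wU vB; have [C [L _ _]] := chart_matrix_ex R d_gt0 wU vB; exists (fun j i => (C j i)%:~R).
Qed.

Lemma frozen_le B w x i : all (mem U) w -> valid B -> nonneg x -> i \notin U ->
  x i <= tpath B w x i.
Proof.
move=> wU vB x0 iU; have [C L] := tpath_lin wU vB.
pose f x := \sum_j x j * C j i - x i.
suff : 0 <= f x by rewrite /f -L // subr_ge0.
have fD (t : R) : f (fun j => x j + t * 1) = f x + t * f (fun=> 1).
  rewrite /f; under eq_bigr do rewrite mulrDl -mulrA.
  by rewrite big_split /= -[X in _ + X - _]mulr_sumr; ring.
have pf y : positive y -> 0 <= f y.
  move=> y0; rewrite /f -L; last exact: positive_nonneg.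
  by rewrite subr_ge0; exact: frozen_le_pos.
have f1 : 0 <= f (fun=> 1) by apply: pf => j _; exact: ltr01.
rewrite leNgt; apply/negP => fx.
have z : 0 < f (fun=> 1) + 1 by rewrite ltr_wpDl.
(* At the perturbed point [f] takes the value [f x / (f (fun=> 1) + 1)], still negative although the
   point is now positive. *)
pose t := - f x / (f (fun=> 1) + 1).
have t0 : 0 < t by rewrite divr_gt0 ?oppr_gt0.
have : 0 <= f x + t * f (fun=> 1).
  by rewrite -fD; apply: pf => j jU; rewrite mulr1 ltr_wpDl ?x0.
have -> : f x + t * f (fun=> 1) = f x / (f (fun=> 1) + 1).
  by rewrite /t; field; rewrite gt_eqF.
by rewrite pmulr_lge0 ?invr_gt0 // leNgt fx.
Qed.

End FrozenMonotone.

(** * Tropical cluster variables *)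

Section TropicalCluster.
Variables (n : nat) (d : 'I_n -> nat).
Implicit Types (B : 'I_n -> 'I_n -> rat) (i j k l : 'I_n) (w : seq 'I_n) (T u : 'I_n -> int)
  (U : {set 'I_n}).

Definition Tplus B k T : int := \sum_j (pospart (eps d B k j))%:Z * T j.
Definition Tminus B k T : int := \sum_j (pospart (- eps d B k j))%:Z * T j.

(** The exchange relation read in the max-plus semiring. *)
Definition mutT k B T i : int :=
  if i == k then - T k + Num.max (Tplus B k T) (Tminus B k T) else T i.

Fixpoint Tpath B w T := if w is k :: w' then Tpath (mutB d k B) w' (mutT k B T) else T.

Lemma Tpath_cat B w w' T : Tpath B (w ++ w') T = Tpath (Bpath d B w) w' (Tpath B w T).
Proof. by elim: w B T => /=. Qed.

Lemma eps_diag U B k : valid d U B -> eps d B k k = 0.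
Proof. by move=> vB; rewrite /eps (valid_diag k vB) mul0r. Qed.

Lemma pospart0 : pospart 0 = 0%N.
Proof. by rewrite -[0]/((0 : int)%:~R) pospart_intr. Qed.

Lemma eq_Tpm U B k T T' : valid d U B -> (forall i, i != k -> T i = T' i) ->
  Tplus B k T = Tplus B k T' /\ Tminus B k T = Tminus B k T'.
Proof.
move=> vB E; split; apply: eq_bigr => j _; case: (eqVneq j k) => [->|/E-> //].
  by rewrite (eps_diag k vB) pospart0 !mul0r.
by rewrite (eps_diag k vB) oppr0 pospart0 !mul0r.
Qed.

Lemma mutT_inv U B k T : k \in U -> valid d U B -> mutT k (mutB d k B) (mutT k B T) = T.
Proof.
move=> kU vB; have vB' := valid_mut kU vB.
have N j : j != k -> eps d (mutB d k B) k j = - eps d B k j.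
  by move=> jk; rewrite /eps /mutB eqxx mulNr.
have E0 i : i != k -> mutT k B T i = T i by rewrite /mutT => /negPf ->.
have [E1 E2] := eq_Tpm vB' E0.
have S1 : Tplus (mutB d k B) k T = Tminus B k T.
  apply: eq_bigr => j _; case: (eqVneq j k) => [->|jk]; last by rewrite N.
  by rewrite !(eps_diag _ vB, eps_diag _ vB') oppr0.
have S2 : Tminus (mutB d k B) k T = Tplus B k T.
  apply: eq_bigr => j _; case: (eqVneq j k) => [->|jk]; last by rewrite N // opprK.
  by rewrite !(eps_diag _ vB, eps_diag _ vB') oppr0.
apply: funext => i; rewrite {1}/mutT E1 E2 S1 S2; case: eqP => [->|/eqP ik].
  by rewrite /mutT eqxx maxC; ring.
by rewrite /mutT (negPf ik).
Qed.

Lemma Tpath_rev U B w T : all (mem U) w -> valid d U B ->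
  Tpath (Bpath d B w) (rev w) (Tpath B w T) = T.
Proof.
elim: w B T => //= k w IH B T /andP[kU wU] vB; have vB' := valid_mut kU vB.
by rewrite rev_cons -cats1 Tpath_cat IH // (Bpath_rev wU vB') /= (mutT_inv _ kU vB).
Qed.

Lemma dpos U B k l : k \in U -> valid d U B ->
  (d l * pospart (eps d B l k) = d k * pospart (- eps d B k l))%N.
Proof.
move=> kU vB; have [sB iB] := vB; have [i1 i2] := iB l k kU.
apply/eqP; rewrite -(eqr_nat rat) !natrM !pospart_max ?rpredN // !maxr_pMr ?ler0n //.
by rewrite !mulr0; apply/eqP; congr Num.max; rewrite /eps (sB l k); ring.
Qed.

(* The value on [e_j] of the form [{., sum_l T_l d_l e_l}]. *)
Definition Yrow B T j : rat := \sum_l B j l * ((d l)%:R * (T l)%:~R).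

Lemma YrowE U B k T : k \in U -> valid d U B ->
  Yrow B T k = (Tplus B k T - Tminus B k T)%:~R.
Proof.
move=> kU [sB iB]; rewrite /Yrow /Tplus /Tminus -sumrB rmorph_sum /=.
apply: eq_bigr => l _; rewrite -mulrBl rmorphM rmorphB /= -!pmulrn.
by rewrite pospartE ?(iB l k kU).2 // /eps; ring.
Qed.

Lemma max_sub (V : realDomainType) (a b : V) : Num.max a b - b = Num.max (a - b) 0.
Proof. by rewrite -[X in _ - X]addr0 opprD oppr0 addr0 -(subrr b) -addr_maxl. Qed.

Lemma intr_max (V : realDomainType) (a b : int) :
  (Num.max a b)%:~R = Num.max a%:~R b%:~R :> V.
Proof. by rewrite !maxEle ler_int; case: ifP. Qed.

Definition rstep B k (r : 'I_n -> rat) j : rat :=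
  if j == k then - r k
  else r j + (pospart (r k * (d k)%:R))%:R * B k j + (pospart (eps d B j k))%:R * r k.

(** Max-plus mutation of [T] becomes the matrix mutation of one more frozen row, because
    [max (a, b) - b] is the positive part of [a - b]. A tropical cluster point can thus be treated
    as a frozen direction. *)
Lemma Yrow_mut U B k T : k \in U -> valid d U B ->
  Yrow (mutB d k B) (mutT k B T) = rstep B k (Yrow B T).
Proof.
move=> kU vB; have [sB iB] := vB; have Bkk := valid_diag k vB.
have YE := YrowE T kU vB.
apply: funext => j; rewrite /rstep; case: (eqVneq j k) => [->|jk].
  rewrite /Yrow -sumrN; apply: eq_bigr => l _; rewrite /mutB /mutT eqxx.
  by case: (eqVneq l k) => [->|_]; rewrite ?Bkk mulNr // !mul0r.
rewrite {1}/Yrow (bigD1 k) //= {1}/mutB {1}/mutT (negPf jk) eqxx.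
rewrite (eq_bigr (fun l => B j l * ((d l)%:R * (T l)%:~R) +
   (pospart (eps d B j k))%:R * (B k l * ((d l)%:R * (T l)%:~R)) +
   B j k * (d k)%:R * ((pospart (- eps d B k l))%:R * (T l)%:~R))); last first.
  move=> l lk; rewrite /mutB /mutT (negPf jk) (negPf lk).
  have := dpos l kU vB => /(congr1 (fun m => m%:R : rat)); rewrite !natrM => E.
  rewrite -[_ * _ * (_ * (T l)%:~R)]mulrA [(d k)%:R * _]mulrA -E; ring.
rewrite !big_split /= -!mulr_sumr.
have S1 : \sum_(l | l != k) B k l * ((d l)%:R * (T l)%:~R) = Yrow B T k.
  by rewrite /Yrow [RHS](bigD1 k) //= Bkk mul0r add0r.
have S2 : \sum_(l | l != k) (pospart (- eps d B k l))%:R * (T l)%:~R = (Tminus B k T)%:~R :> rat.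
  rewrite /Tminus rmorph_sum [RHS](bigD1 k) //= (eps_diag k vB) oppr0 pospart0 mul0r add0r.
  by apply: eq_bigr => l _; rewrite rmorphM.
have S3 : \sum_(l | l != k) B j l * ((d l)%:R * (T l)%:~R) =
    Yrow B T j - B j k * ((d k)%:R * (T k)%:~R).
  by rewrite /Yrow [X in _ = X - _](bigD1 k) //= addrC addrK.
rewrite S1 S2 S3.
have -> : (pospart (Yrow B T k * (d k)%:R))%:R =
    (d k)%:R * ((Num.max (Tplus B k T) (Tminus B k T))%:~R - (Tminus B k T)%:~R) :> rat.
  rewrite pospart_max; last by rewrite YE rpredM ?rpred_int ?rpred_nat.
  rewrite intr_max max_sub mulrC maxr_pMr ?ler0n // mulr0; congr Num.max.
  by rewrite YE rmorphB.
by rewrite (sB k j) rmorphD rmorphN /=; ring.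
Qed.

End TropicalCluster.

(** * A monotone pairing of tropical cluster variables with tropical points *)

Section Pairing.
Variables (n : nat) (d : 'I_n -> nat) (U : {set 'I_n}) (R : realFieldType).
Hypothesis d_gt0 : forall i, (0 < d i)%N.

Implicit Types (B : 'I_n -> 'I_n -> rat) (i j k l : 'I_n) (w : seq 'I_n) (x y : 'I_n -> R)
  (T u : 'I_n -> int) (r : 'I_n -> rat).

Definition pairT T x : R := \sum_l (d l)%:R * (T l)%:~R * x l.

Definition fstep B k r x : R :=
  (pospart (r k * (d k)%:R))%:R * x k - Num.max (x k) 0 * ratr (r k * (d k)%:R).

Lemma pairT_step B k T x : k \in U -> valid d U B ->
  pairT (mutT d k B T) (tau d k B x) + fstep B k (Yrow d B T) x = pairT T x.
Proof.
move=> kU vB; have [sB iB] := vB; have Bkk := valid_diag k vB.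
rewrite /pairT (bigD1 k) //= /mutT /tau eqxx.
rewrite (eq_bigr (fun l => (d l)%:R * (T l)%:~R * x l +
   x k * (d k)%:R * ((pospart (- eps d B k l))%:R * (T l)%:~R) +
   Num.max (x k) 0 * (d k)%:R * (ratr (eps d B k l) * (T l)%:~R))); last first.
  move=> l lk; rewrite (negPf lk).
  have := dpos l kU vB => /(congr1 (fun m => m%:R : R)); rewrite !natrM => E.
  have E2 : (d l)%:R * ratr (eps d B l k) = - ((d k)%:R * ratr (eps d B k l)) :> R.
    rewrite -!(ratr_nat R) -!rmorphM -rmorphN /=; congr ratr.
    by rewrite /eps (sB l k); ring.
  rewrite -[x k * _ * _]mulrA [(d k)%:R * (_ * _)]mulrA -E.
  have -> : Num.max (x k) 0 * (d k)%:R * (ratr (eps d B k l) * (T l)%:~R) =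
     - Num.max (x k) 0 * (T l)%:~R * - ((d k)%:R * ratr (eps d B k l)) by ring.
  by rewrite -E2; ring.
rewrite !big_split /= -!mulr_sumr.
have S2 : \sum_(l | l != k) (pospart (- eps d B k l))%:R * (T l)%:~R = (Tminus d B k T)%:~R :> R.
  rewrite /Tminus rmorph_sum [RHS](bigD1 k) //= (eps_diag k vB) oppr0 pospart0 mul0r add0r.
  by apply: eq_bigr => l _; rewrite rmorphM.
have S3 : \sum_(l | l != k) ratr (eps d B k l) * (T l)%:~R = ratr (Yrow d B T k) :> R.
  rewrite /Yrow rmorph_sum [RHS](bigD1 k) //= Bkk mul0r rmorph0 add0r.
  apply: eq_bigr => l _; rewrite rmorphM /= rmorphM /= !ratr_nat rmorphM /= ratr_nat ratr_int.
  by rewrite mulrA.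
have S1 : \sum_(l | l != k) (d l)%:R * (T l)%:~R * x l = pairT T x - (d k)%:R * (T k)%:~R * x k.
  by rewrite /pairT [X in _ = X - _](bigD1 k) //= addrC addrK.
rewrite S1 S2 S3 -/(pairT T x) /fstep.
have -> : (pospart (Yrow d B T k * (d k)%:R))%:R =
    (d k)%:R * ((Num.max (Tplus d B k T) (Tminus d B k T))%:~R - (Tminus d B k T)%:~R) :> R.
  have YE := YrowE T kU vB.
  have E : Yrow d B T k * (d k)%:R = ((Tplus d B k T - Tminus d B k T) * (d k)%:Z)%:~R.
    by rewrite YE rmorphM.
  rewrite -rmorphB /= max_sub E pospart_intr.
  set t : int := Tplus _ _ _ _ - _; rewrite -[(d k)%:R]/((d k)%:Z%:~R) -rmorphM /=.
  have -> : (pz (t * (d k)%:Z))%:R = (pz (t * (d k)%:Z))%:Z%:~R :> R by [].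
  congr (_%:~R); rewrite maxEle; case: leP => t0.
    by rewrite mulr0 pz_le0 // mulr_le0_ge0.
  by move: t0; case: t => // t _; rewrite mulrC -PoszM.
rewrite rmorphM /= ratr_nat rmorphD rmorphN /=; ring.
Qed.

(** The matrix is enlarged by a frozen index with row [Yrow d B u], whose coordinate starts at 0.
    Traversed backwards the path leaves a chamber, so [frozen_le] makes the final value at most 0;
    by conservation the pairing has not decreased. *)
Lemma mutT_path_nonneg B w u x : all (mem U) w -> valid d U B ->
  nonneg U (tpath d B w x) -> pairT u x <= pairT (Tpath d B w u) (tpath d B w x).
Proof.
move=> wU vB y0.
pose io := lshift 1 : 'I_n -> 'I_(n + 1); pose f := rshift n ord0 : 'I_(n + 1).
pose dh (i : 'I_(n + 1)) := if fintype.split i is inl a then d a else 1%N.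
pose Uh : {set 'I_(n + 1)} := io @: U.
have spi a : fintype.split (io a) = inl a by exact: (unsplitK (inl a)).
have spf : fintype.split f = inr ord0 by exact: (unsplitK (inr ord0)).
have dio a : dh (io a) = d a by rewrite /dh spi.
have fio a : (f == io a) = false by apply/negP => /eqP E; have := spf; rewrite E spi.
have ioI : injective io by exact: lshift_inj.
have ioE a b : (io a == io b) = (a == b) by rewrite (inj_eq ioI).
have dh0 (i : 'I_(n + 1)) : (0 < dh i)%N by rewrite /dh; case: (fintype.split i).
have cover (i : 'I_(n + 1)) : (exists a, i = io a) \/ i = f.
  case: (splitP i) => j E; [left; exists j | right]; apply: val_inj => //=.
  by rewrite E (ord1 j).
have memU a : (io a \in Uh) = (a \in U) by rewrite mem_imset.
have fU : f \notin Uh by apply/imsetP => -[a _ /eqP]; rewrite fio.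
pose ext (Bh : 'I_(n + 1) -> 'I_(n + 1) -> rat) B' r :=
  (forall i j, Bh (io i) (io j) = B' i j) /\ (forall j, Bh f (io j) = r j).
have ext_step Bh B' r k : ext Bh B' r -> ext (mutB dh (io k) Bh) (mutB d k B') (rstep d B' k r).
  move=> [E1 E2]; split=> [i j|j]; rewrite /mutB /rstep ?fio !ioE /eps !dio ?E1 ?E2 //.
have tau_step Bh B' r k (xh : 'I_(n + 1) -> R) : ext Bh B' r ->
   (forall i, tau dh (io k) Bh xh (io i) = tau d k B' (fun i => xh (io i)) i) /\
   tau dh (io k) Bh xh f = xh f + fstep B' k r (fun i => xh (io i)).
  move=> [E1 E2]; split=> [i|]; rewrite /tau /fstep ?fio ?ioE /eps !dio ?E1 ?E2 //.
  by rewrite addrA.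
have inv Bh B' T (xh : 'I_(n + 1) -> R) w' : all (mem U) w' -> valid d U B' ->
    ext Bh B' (Yrow d B' T) ->
    (forall i, tpath dh Bh (map io w') xh (io i) = tpath d B' w' (fun i => xh (io i)) i) /\
    tpath dh Bh (map io w') xh f + pairT (Tpath d B' w' T) (tpath d B' w' (fun i => xh (io i)))
      = xh f + pairT T (fun i => xh (io i)).
  elim: w' Bh B' T xh => [|k w' IH] Bh B' T xh /=; first by [].
  move=> /andP[kU w'U] vB' E.
  have E' := ext_step _ _ _ k E; rewrite -(Yrow_mut T kU vB') in E'.
  have [t1 t2] := tau_step _ _ _ k xh E.
  have [I1 I2] := IH _ _ _ (tau dh (io k) Bh xh) w'U (valid_mut kU vB') E'.
  have tE : (fun i => tau dh (io k) Bh xh (io i)) = tau d k B' (fun i => xh (io i)).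
    by apply: funext => i; rewrite t1.
  rewrite tE in I1 I2; split=> //; rewrite I2 t2 -(pairT_step T (fun i => xh (io i)) kU vB').
  by rewrite -addrA; congr (_ + _); rewrite addrC.
pose r := Yrow d B u.
pose Bh (i j : 'I_(n + 1)) : rat := match fintype.split i, fintype.split j with
  | inl a, inl b => B a b | inr _, inl b => r b | inl a, inr _ => - r a | inr _, inr _ => 0 end.
have vBh : valid dh Uh Bh.
  have [sB iB] := vB; split=> [i j|i k].
    by rewrite /Bh; case: (fintype.split i) => a; case: (fintype.split j) => b; rewrite ?opprK ?oppr0.
  case: (cover k) => [[a ->]|->]; last by rewrite (negPf fU).
  rewrite memU => aU; case: (cover i) => [[b ->]|->].
    by rewrite /eps /Bh !spi !dio; exact: iB.
  rewrite /eps /Bh spi spf /dh spi spf mulr1 rpredN /r (YrowE u aU vB).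
  by rewrite rpredM ?rpred_nat ?rpred_int.
have extB : ext Bh B r by split=> [i j|j]; rewrite /Bh ?spf !spi.
pose xh (i : 'I_(n + 1)) : R := if fintype.split i is inl a then x a else 0.
have xhio : (fun i => xh (io i)) = x by apply: funext => i; rewrite /xh spi.
have xhf : xh f = 0 by rewrite /xh spf.
have whU : all (mem Uh) (map io w).
  by rewrite all_map; apply: sub_all wU => a /= aU; rewrite memU.
have [I1 I2] := inv _ _ u xh w wU vB extB; rewrite xhio xhf in I1 I2.
have yh0 : nonneg Uh (tpath dh Bh (map io w) xh).
  by move=> i; case: (cover i) => [[a ->]|->]; [rewrite memU I1; apply: y0 | rewrite (negPf fU)].
have rU : all (mem Uh) (rev (map io w)) by rewrite all_rev.
have := frozen_le dh0 rU (valid_path whU vBh) yh0 fU.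
rewrite (tpath_rev _ whU vBh) xhf => le; move: I2; rewrite add0r => <-.
by rewrite -[X in _ <= X]add0r lerD2r.
Qed.

End Pairing.

Section SameChamber.
Variables (n : nat) (d : 'I_n -> nat) (U : {set 'I_n}) (R : realFieldType).
Hypothesis d_gt0 : forall i, (0 < d i)%N.
Implicit Types (B : 'I_n -> 'I_n -> rat) (i j k l : 'I_n) (q w : seq 'I_n) (x y : 'I_n -> R)
  (T u : 'I_n -> int) (p : 'S_n).

Definition same_chamber B q :=
  forall x, nonneg U x <-> nonneg U (tpath d B q x).

Lemma tpath_revK B q y : all (mem U) q -> valid d U B ->
  tpath d B q (tpath d (Bpath d B q) (rev q) y) = y.
Proof.
move=> qU vB; have rU : all (mem U) (rev q) by rewrite all_rev.
have := tpath_rev y rU (valid_path qU vB).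
by rewrite revK (Bpath_rev qU vB).
Qed.

Lemma same_chamber_rev B q : all (mem U) q -> valid d U B -> same_chamber B q ->
  same_chamber (Bpath d B q) (rev q).
Proof.
move=> qU vB S y; set x := tpath d (Bpath d B q) (rev q) y.
have E : tpath d B q x = y by exact: tpath_revK.
by have [S1 S2] := S x; split=> [y0|/S1]; [apply: S2; rewrite E | rewrite E].
Qed.

Definition delta j i : R := (i == j)%:R.

Lemma sum_delta (c : 'I_n -> int) j : \sum_l delta j l * (c l)%:~R = (c j)%:~R.
Proof.
rewrite (bigD1 j) //= /delta eqxx mul1r big1 ?addr0 // => l /negPf ->.
by rewrite mul0r.
Qed.

Lemma delta_nonneg j : nonneg U (delta j).
Proof. by move=> i _; rewrite ler0n. Qed.

Lemma delta_inj i j : delta i = delta j -> i = j.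
Proof.
move=> /(congr1 (fun f => f i)); rewrite /delta eqxx => /esym/eqP.
by rewrite pnatr_eq1 eqb1 => /eqP.
Qed.

Section Fixed.
Variables (B : 'I_n -> 'I_n -> rat) (q : seq 'I_n).
Hypothesis qU : all (mem U) q.
Hypothesis vB : valid d U B.
Hypothesis S : same_chamber B q.
Let B' := Bpath d B q.
Let rU : all (mem U) (rev q). Proof. by rewrite all_rev. Qed.
Let vB' : valid d U B' := valid_path qU vB.
Let S' : same_chamber B' (rev q) := same_chamber_rev qU vB S.
Let TK x : tpath d B' (rev q) (tpath d B q x) = x := tpath_rev x qU vB.

Lemma same_chamber_frozen x f : nonneg U x -> f \notin U -> tpath d B q x f = x f.
Proof.
move=> x0 fU; apply/eqP; rewrite eq_le (frozen_le d_gt0 qU vB x0 fU) andbT.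
have /S y0 := x0; have := frozen_le d_gt0 rU vB' y0 fU.
by rewrite TK.
Qed.

(** The transition matrices in the two directions are integral, non-negative and mutually inverse,
    hence permutation matrices. *)
Lemma same_chamber_delta : exists s : 'I_n -> 'I_n,
  forall j, tpath d B q (delta j) = delta (s j).
Proof.
have [C [L _ _]] := chart_matrix_ex R d_gt0 qU vB.
have [C' [L' _ _]] := chart_matrix_ex R d_gt0 rU vB'.
have yE j i : tpath d B q (delta j) i = (C j i)%:~R.
  by rewrite L; [rewrite sum_delta | exact: delta_nonneg].
have y'E j i : tpath d B' (rev q) (delta j) i = (C' j i)%:~R.
  by rewrite L'; [rewrite sum_delta | exact: delta_nonneg].
have Cpos j i : i \in U -> 0 <= C j i.
  by move=> iU; rewrite -(ler0z R) -yE; apply: (S _).1 => //; exact: delta_nonneg.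
have C'pos j i : i \in U -> 0 <= C' j i.
  by move=> iU; rewrite -(ler0z R) -y'E; apply: (S' _).1 => //; exact: delta_nonneg.
have Cf j f : f \notin U -> C j f = (f == j)%:Z.
  move=> fU; apply: (intr_inj (R := R)); rewrite -yE (same_chamber_frozen (delta_nonneg j) fU).
  by rewrite /delta; case: (f == j).
have S'' : same_chamber (Bpath d B' (rev q)) (rev (rev q)).
  by apply: same_chamber_rev.
have C'f j f : f \notin U -> C' j f = (f == j)%:Z.
  move=> fU; apply: (intr_inj (R := R)); rewrite -y'E.
  have := same_chamber_frozen (x := tpath d B' (rev q) (delta j)) _ fU.
  have E : tpath d B q (tpath d B' (rev q) (delta j)) = delta j.
    exact: tpath_revK.
  rewrite E => <-; last by apply: (S' _).1; exact: delta_nonneg.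
  by rewrite /delta; case: (f == j).
have CC j l : \sum_i C j i * C' i l = (l == j)%:Z.
  apply: (intr_inj (R := R)); rewrite rmorph_sum /=.
  have /(congr1 (fun f => f l)) := TK (delta j).
  rewrite L'; last by apply: (S _).1; exact: delta_nonneg.
  have -> : ((l == j)%:Z)%:~R = delta j l by rewrite /delta; case: (l == j).
  by move=> <-; apply: eq_bigr => i _; rewrite rmorphM yE.
have C'C j l : \sum_i C' j i * C i l = (l == j)%:Z.
  apply: (intr_inj (R := R)); rewrite rmorph_sum /=.
  have E : tpath d B q (tpath d B' (rev q) (delta j)) = delta j.
    exact: tpath_revK.
  have /(congr1 (fun f => f l)) := E.
  rewrite L; last by apply: (S' _).1; exact: delta_nonneg.
  have -> : ((l == j)%:Z)%:~R = delta j l by rewrite /delta; case: (l == j).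
  by move=> <-; apply: eq_bigr => i _; rewrite rmorphM y'E.
have C0 j i : 0 <= C j i.
  by have [iU|iU] := boolP (i \in U); [exact: Cpos | rewrite Cf // lez_nat].
have C'0 j i : 0 <= C' j i.
  by have [iU|iU] := boolP (i \in U); [exact: C'pos | rewrite C'f // lez_nat].
(* Row sums of the inverse matrix. They are at least 1 and [\sum_i C j i * t i = 1], so each row of
   [C] has a single non-zero entry, equal to 1. *)
pose t i := \sum_l C' i l.
have t1 i : 1 <= t i.
  rewrite -gtz0_ge1 lt_neqAle eq_sym sumr_ge0 ?andbT //; apply/negP => /eqP t0.
  have z l : C' i l = 0.
    by have /psumr_eq0P -> // := t0 => l' _; exact: C'0.
  by have := C'C i i; rewrite eqxx big1 // => l _; rewrite z mul0r.
have sum1 j : \sum_i C j i * t i = 1.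
  under eq_bigr do rewrite mulr_sumr.
  rewrite exchange_big /= (eq_bigr _ (fun l _ => CC j l)) (bigD1 j) //= eqxx.
  by rewrite big1 ?addr0 // => l /negPf ->.
have ex j : exists i, forall l, C j l = (l == i)%:Z.
  have [i Ci] : exists i, C j i != 0.
    apply/existsP; apply: contraT; rewrite negb_exists => /forallP H.
    have := sum1 j; rewrite big1 // => i _; have := H i; rewrite negbK => /eqP ->.
    by rewrite mul0r.
  have Ci1 : 1 <= C j i by rewrite -gtz0_ge1 lt_def Ci C0.
  have := sum1 j; rewrite (bigD1 i) //=; set r := \sum_(l | l != i) _ => E.
  have r0 : 0 <= r by apply: sumr_ge0 => l _; rewrite mulr_ge0 ?C0 // (le_trans _ (t1 l)).
  have ti := t1 i; have rz : r = 0 by nia.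
  exists i => l; case: (eqVneq l i) => [->|li]; first by nia.
  have : C j l * t l = 0.
    have /psumr_eq0P := rz; apply=> // l' _.
    by rewrite mulr_ge0 ?C0 // (le_trans _ (t1 l')).
  by move/eqP; rewrite mulf_eq0 => /orP[/eqP //|/eqP tl]; have := t1 l; rewrite tl.
have [s sE] := choice ex; exists s => j; apply: funext => l.
by rewrite yE sE /delta; case: (l == s j).
Qed.

Theorem same_chamber_perm : exists p : 'S_n,
  [/\ forall i, i \notin U -> p i = i,
      forall i, d (p i) = d i,
      forall i j, Bpath d B q i j = B (p i) (p j),
      forall x, nonneg U x -> forall i, tpath d B q x i = x (p i)
    & forall u i, Tpath d B q u i = u (p i)].
Proof.
have [s sE] := same_chamber_delta.
have sI : injective s.
  by move=> i j E; apply: delta_inj; rewrite -(TK (delta i)) -(TK (delta j)) !sE E.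
pose p : 'S_n := (perm sI)^-1%g.
have ps j : p (s j) = j by rewrite -{1}(permE sI) permK.
have sp i : s (p i) = i by rewrite -{1}(permE sI) permKV.
have [C [L L2 L3]] := chart_matrix_ex R d_gt0 qU vB.
have CE j i : C j i = (i == s j)%:Z.
  apply: (intr_inj (R := R)); have := L _ (delta_nonneg j) i.
  by rewrite sum_delta sE => <-; rewrite /delta; case: eqP.
have [C' [L' _ L3']] := chart_matrix_ex R d_gt0 rU vB'.
have C'E j i : C' (s j) i = (i == j)%:Z.
  apply: (intr_inj (R := R)); have := L' _ (delta_nonneg (s j)) i.
  by rewrite sum_delta -sE TK => <-; rewrite /delta; case: eqP.
have dp i : d (p i) = d i.
  have [m E] := L3 (p i) i; have [m' E'] := L3' i (p i).
  have C'1 : C' i (p i) = 1 by have := C'E (p i) (p i); rewrite sp eqxx.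
  move: E E'; rewrite CE sp eqxx C'1 !mulr1 => E E'.
  apply/eqP; rewrite eqn_dvd; apply/andP; split.
    have : ((d (p i))%:Z %| (d i)%:Z)%Z by apply/dvdzP; exists m; rewrite mulrC.
    by [].
  have : ((d i)%:Z %| (d (p i))%:Z)%Z by apply/dvdzP; exists m'; rewrite mulrC.
  by [].
have xp x : nonneg U x -> forall i, tpath d B q x i = x (p i).
  move=> x0 i; rewrite L // (bigD1 (p i)) //= CE sp eqxx mulr1 big1 ?addr0 // => j jp.
  by rewrite CE -[i in i == _]sp (inj_eq sI) eq_sym (negPf jp) mulr0.
exists p; split=> //.
- move=> i iU; have := xp _ (delta_nonneg i) i.
  rewrite (same_chamber_frozen (delta_nonneg i) iU) /delta eqxx => /esym/eqP.
  by rewrite pnatr_eq1 eqb1 => /eqP.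
- move=> i j; rewrite L2 (bigD1 (p i)) //= CE sp eqxx mulr1 [X in _ + X]big1 ?addr0; last first.
    by move=> l lp; rewrite CE -[i in i == _]sp (inj_eq sI) eq_sym (negPf lp) mulr0.
  rewrite (bigD1 (p j)) //= CE sp eqxx mulr1 big1 ?addr0 // => l lp.
  by rewrite CE -[j in j == _]sp (inj_eq sI) eq_sym (negPf lp) mulr0.
(* Monotonicity along [q] and along its reverse gives equal pairings at the basis point
   [delta (p i)], which isolates one tropical variable. *)
move=> u i; set T := Tpath d B q u.
have x0 := delta_nonneg (p i); set x := delta (p i) in x0.
have y0 := (S x).1 x0.
have le1 := mutT_path_nonneg d_gt0 u qU vB y0; rewrite -/T in le1.
have := mutT_path_nonneg d_gt0 T rU vB' (x := tpath d B q x).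
rewrite TK (Tpath_rev _ qU vB) => /(_ x0) le2.
have : pairT d u x = pairT d T (tpath d B q x) by apply/eqP; rewrite eq_le le1.
rewrite /pairT (bigD1 (p i)) //= big1 ?addr0 => [|l lp]; last first.
  by rewrite /x /delta (negPf lp) mulr0.
rewrite (bigD1 i) //= [X in _ + X]big1 ?addr0 => [|l li]; last first.
  by rewrite xp // /x /delta (inj_eq perm_inj) (negPf li) mulr0.
rewrite xp // /x /delta eqxx !mulr1 dp => /mulfI; rewrite pnatr_eq0 -lt0n d_gt0.
by move=> /(_ isT) /(intr_inj) ->.
Qed.

End Fixed.

(** Monotonicity for [u] and for [-u], both transported linearly by [p], forces equal pairings.
    Indicator vectors then identify the coordinates of [x] with positive multiples of those of the
    end point. *)
Lemma tropical_perm_sub B q p : all (mem U) q -> valid d U B ->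
  (forall i, i \in U -> p i \in U) ->
  (forall u i, Tpath d B q u i = u (p i)) ->
  forall x, nonneg U (tpath d B q x) -> nonneg U x.
Proof.
move=> qU vB pU TE x y0; set y := tpath d B q x in y0.
have E u : pairT d u x = pairT d (fun i => u (p i)) y.
  have TE' v : Tpath d B q v = fun i => v (p i) by apply: funext => i.
  have le1 v : pairT d v x <= pairT d (fun i => v (p i)) y.
    by rewrite -TE'; apply: (mutT_path_nonneg d_gt0 v qU vB y0).
  have N v (z : 'I_n -> R) : pairT d (fun i => - v i) z = - pairT d v z.
    by rewrite /pairT -sumrN; apply: eq_bigr => l _; rewrite rmorphN mulrN mulNr.
  by apply/eqP; rewrite eq_le le1 /= -lerN2 -!N; exact: le1.
have pU' i : i \in U -> p^-1%g i \in U.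
  have pUU : p @: U = U.
    apply/eqP; rewrite eqEcard card_imset ?leqnn ?andbT; last exact: perm_inj.
    by apply/fintype.subsetP => _ /imsetP[j jU ->]; exact: pU.
  by rewrite -{1}pUU => /imsetP[j jU ->]; rewrite permK.
move=> i iU; have := E (fun l => (l == i)%:Z).
rewrite /pairT (bigD1 i) //= eqxx big1 ?addr0 => [|l /negPf ->]; last by rewrite mulr0 mul0r.
rewrite (bigD1 (p^-1%g i)) //= permKV eqxx [X in _ + X]big1 ?addr0 => [|l li]; last first.
  by rewrite -(inj_eq (@perm_inj _ p)) permKV in li; rewrite (negPf li) mulr0 mul0r.
rewrite !mulr1 => Exy; have := y0 _ (pU' i iU).
rewrite -(pmulr_rge0 _ (_ : 0 < (d (p^-1%g i))%:R)) ?ltr0n // -Exy.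
by rewrite pmulr_rge0 ?ltr0n.
Qed.

Theorem tropical_perm_chamber B q p : all (mem U) q -> valid d U B ->
  (forall i, i \in U -> p i \in U) ->
  (forall u i, Tpath d B q u i = u (p i)) -> same_chamber B q.
Proof.
move=> qU vB pU TE x; split; last exact: tropical_perm_sub TE _.
have rU : all (mem U) (rev q) by rewrite all_rev.
have vB' := valid_path qU vB.
have pU' i : i \in U -> p^-1%g i \in U.
  have pUU : p @: U = U.
    apply/eqP; rewrite eqEcard card_imset ?leqnn ?andbT; last exact: perm_inj.
    by apply/fintype.subsetP => _ /imsetP[j jU ->]; exact: pU.
  by rewrite -{1}pUU => /imsetP[j jU ->]; rewrite permK.
move=> x0; apply: (tropical_perm_sub rU vB' pU'); last by rewrite (tpath_rev _ qU vB).
move=> u i; have := Tpath_rev (fun l => u (p^-1%g l)) qU vB.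
have -> : Tpath d B q (fun l => u (p^-1%g l)) = u.
  by apply: funext => l; rewrite TE permK.
by move=> ->.
Qed.

End SameChamber.

(** * The Laurent phenomenon *)

Section Laurent.
Variable n : nat.
Implicit Types (a : 'I_n -> rat) (f g h phi psi : ('I_n -> rat) -> rat) (i j s : 'I_n).

Definition pos_pt a := forall i, 0 < a i.

Definition set_at a s (x : rat) : 'I_n -> rat := fun i => if i == s then x else a i.

Lemma pos_set_at a s x : pos_pt a -> 0 < x -> pos_pt (set_at a s x).
Proof. by move=> pa x0 i; rewrite /set_at; case: eqP. Qed.

Lemma set_at_id a s : set_at a s (a s) = a.
Proof. by apply: funext => i; rewrite /set_at; case: eqP => // ->. Qed.

Lemma set_at_same a s x : set_at a s x s = x.
Proof. by rewrite /set_at eqxx. Qed.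

(* Laurent polynomials with integer coefficients, as functions on the positive
   orthant. *)
Inductive Lau : (('I_n -> rat) -> rat) -> Prop :=
| Lau_const (c : int) : Lau (fun=> c%:~R)
| Lau_var i : Lau (fun a => a i)
| Lau_inv i : Lau (fun a => (a i)^-1)
| Lau_add f g : Lau f -> Lau g -> Lau (fun a => f a + g a)
| Lau_mul f g : Lau f -> Lau g -> Lau (fun a => f a * g a)
| Lau_ext f g : (forall a, pos_pt a -> f a = g a) -> Lau f -> Lau g.

Lemma Lau0 : Lau (fun=> 0). Proof. exact: (Lau_const 0). Qed.
Lemma Lau1 : Lau (fun=> 1). Proof. exact: (Lau_const 1). Qed.

Lemma Lau_nat (m : nat) : Lau (fun=> m%:R).
Proof. exact: Lau_ext (Lau_const m). Qed.

Lemma Lau_shift (F : nat -> ('I_n -> rat) -> rat) (b : bool) m :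
  (forall m, Lau (F m)) -> Lau (fun a => if b then 0 else F m a).
Proof. by move=> LF; case: b; [apply: Lau0|apply: LF]. Qed.

Lemma Lau_opp f : Lau f -> Lau (fun a => - f a).
Proof.
move=> Lf; apply: Lau_ext (Lau_mul (Lau_const (-1)) Lf) => a _.
by rewrite rmorphN /= mulN1r.
Qed.

Lemma Lau_sub f g : Lau f -> Lau g -> Lau (fun a => f a - g a).
Proof. by move=> Lf Lg; apply: Lau_add => //; apply: Lau_opp. Qed.

Lemma Lau_exp f m : Lau f -> Lau (fun a => f a ^+ m).
Proof.
move=> Lf; elim: m => [|m IH]; first exact: Lau_ext Lau1.
by apply: Lau_ext (Lau_mul Lf IH) => a _; rewrite exprS.
Qed.

Lemma Lau_sum (I : Type) (r : seq I) (P : pred I) (F : I -> ('I_n -> rat) -> rat) :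
  (forall x, Lau (F x)) -> Lau (fun a => \sum_(x <- r | P x) F x a).
Proof.
move=> LF; elim: r => [|x r IH].
  by apply: Lau_ext Lau0 => a _; rewrite big_nil.
case Px: (P x).
  by apply: Lau_ext (Lau_add (LF x) IH) => a _; rewrite big_cons Px.
by apply: Lau_ext IH => a _; rewrite big_cons Px.
Qed.

Lemma Lau_prod (I : Type) (r : seq I) (P : pred I) (F : I -> ('I_n -> rat) -> rat) :
  (forall x, Lau (F x)) -> Lau (fun a => \prod_(x <- r | P x) F x a).
Proof.
move=> LF; elim: r => [|x r IH].
  by apply: Lau_ext Lau1 => a _; rewrite big_nil.
case Px: (P x).
  by apply: Lau_ext (Lau_mul (LF x) IH) => a _; rewrite big_cons Px.
by apply: Lau_ext IH => a _; rewrite big_cons Px.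
Qed.

Lemma pospoly_eq0 (p : {poly rat}) : (forall x, 0 < x -> p.[x] = 0) -> p = 0.
Proof.
move=> p0; apply/eqP; apply: contraT => pn0.
pose r := [seq (m.+1)%:R : rat | m <- iota 0 (size p)].
have := @max_poly_roots _ p r pn0; rewrite size_map size_iota ltnn => -> //.
  by apply/allP => x /mapP[m _ ->]; rewrite rootE p0 // ltr0Sn.
rewrite map_inj_uniq ?iota_uniq // => x y /eqP.
by rewrite eqr_nat eqSS => /eqP.
Qed.

Lemma pospoly_eq (p q : {poly rat}) : (forall x, 0 < x -> p.[x] = q.[x]) -> p = q.
Proof.
move=> pq; apply/eqP; rewrite -subr_eq0; apply/eqP/pospoly_eq0 => x x0.
by rewrite hornerD hornerN pq // subrr.
Qed.

(* [f] as a Laurent polynomial in the coordinate [s], whose coefficients are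
   Laurent in the other coordinates *)
Definition expansion s f (N e : nat) (P : ('I_n -> rat) -> {poly rat}) :=
  [/\ forall a, (size (P a) <= N)%N, forall m, Lau (fun a => (P a)`_m),
      forall a x, P (set_at a s x) = P a
    & forall a, pos_pt a -> a s ^+ e * f a = (P a).[a s]].

Lemma Lau_expansion s f : Lau f -> exists N e P, expansion s f N e P.
Proof.
elim=> {f} [c|i|i|f g _ [N [e [P [sP LP uP EP]]]] _ [N' [e' [Q [sQ LQ uQ EQ]]]]
  |f g _ [N [e [P [sP LP uP EP]]]] _ [N' [e' [Q [sQ LQ uQ EQ]]]]
  |f g fg _ [N [e [P [sP LP uP EP]]]]].
- exists 1%N, 0%N, (fun=> (c%:~R)%:P); split=> // [a|m|a pa].
  + exact: size_polyC_leq1.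
  + have [->|m0] := posnP m; first by apply: Lau_ext (Lau_const c) => a _; rewrite coefC.
    by apply: Lau_ext Lau0 => a _; rewrite coefC eqn0Ngt m0.
  + by rewrite hornerC mul1r.
- have [->|is_] := eqVneq i s.
    exists 2%N, 0%N, (fun=> 'X); split=> // [a|m|a pa].
    + by rewrite size_polyX.
    + by apply: Lau_ext (Lau_nat (m == 1%N)) => a _; rewrite coefX.
    + by rewrite hornerX mul1r.
  exists 1%N, 0%N, (fun a => (a i)%:P); split=> // [a|m|a x|a pa].
  + exact: size_polyC_leq1.
  + have [->|m0] := posnP m; first by apply: Lau_ext (Lau_var i) => a _; rewrite coefC.
    by apply: Lau_ext Lau0 => a _; rewrite coefC eqn0Ngt m0.
  + by rewrite /set_at (negPf is_).
  + by rewrite hornerC mul1r.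
- have [->|is_] := eqVneq i s.
    exists 1%N, 1%N, (fun=> 1); split=> // [a|m|a pa].
    + by rewrite size_poly1.
    + by apply: Lau_ext (Lau_nat (m == 0%N)) => a _; rewrite coef1.
    + by rewrite hornerC expr1 divff // gt_eqF.
  exists 1%N, 0%N, (fun a => (a i)^-1%:P); split=> // [a|m|a x|a pa].
  + exact: size_polyC_leq1.
  + have [->|m0] := posnP m; first by apply: Lau_ext (Lau_inv i) => a _; rewrite coefC.
    by apply: Lau_ext Lau0 => a _; rewrite coefC eqn0Ngt m0.
  + by rewrite /set_at (negPf is_).
  + by rewrite hornerC mul1r.
- exists (maxn (N + e') (N' + e))%N, (e + e')%N, (fun a => P a * 'X^e' + Q a * 'X^e).
  split=> [a|m|a x|a pa].
  + apply: leq_trans (size_polyD _ _) _; rewrite geq_max.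
    have sM p m : (size (p * 'X^m : {poly rat})%R <= size p + m)%N.
      have [->|p0] := eqVneq p 0; first by rewrite mul0r size_poly0.
      by rewrite size_mulXn // addnC.
    by apply/andP; split; apply: leq_trans (sM _ _) _; rewrite leq_max !leq_add2r ?sP ?sQ ?orbT.
  + apply: (Lau_ext (f := fun a => (if (m < e')%N then 0 else (P a)`_(m - e')) +
      (if (m < e)%N then 0 else (Q a)`_(m - e)))) => [a _|].
      by rewrite coefD !coefMXn.
    by apply: Lau_add; apply: (Lau_shift (F := fun m a => (_ a : {poly rat})`_m)).
  + by rewrite uP uQ.
  + by rewrite hornerD !hornerM !hornerXn -EP // -EQ // exprD; ring.
- exists (N + N')%N, (e + e')%N, (fun a => P a * Q a); split=> [a|m|a x|a pa].
  + apply: leq_trans (size_polyMleq _ _) _.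
    by apply: leq_trans (leq_pred _) _; rewrite leq_add.
  + apply: (Lau_ext (f := fun a => \sum_(i < m.+1) (P a)`_i * (Q a)`_(m - i))) => [a _|].
      by rewrite coefM.
    by apply: Lau_sum => i; apply: Lau_mul.
  + by rewrite uP uQ.
  + by rewrite hornerM -EP // -EQ // exprD; ring.
- by exists N, e, P; split=> // a pa; rewrite -fg // EP.
Qed.

Lemma expansion_raise s f N e P e' : expansion s f N e P -> 
  expansion s f (N + e') (e + e') (fun a => P a * 'X^e').
Proof.
case=> [sP LP uP EP]; split=> [a|m|a x|a pa].
- have [->|p0] := eqVneq (P a) 0; first by rewrite mul0r size_poly0.
  by rewrite size_mulXn // addnC leq_add2r.
- apply: (Lau_ext (f := fun a => (if (m < e')%N then 0 else (P a)`_(m - e')))) => [a _|].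
    by rewrite !coefMXn.
  exact: (Lau_shift (F := fun m a => (P a)`_m)).
- by rewrite uP.
- by rewrite hornerM hornerXn -EP // exprD; ring.
Qed.

Definition free_of s f := forall a x, pos_pt a -> 0 < x -> f (set_at a s x) = f a.

(* Synthetic division: the expansion in [a s] of [phi * (a s + kappa)] determines
   the coefficients of [phi] one by one from the top. *)
Lemma Lau_divide s M kappa phi : Lau M -> Lau kappa -> free_of s M -> free_of s kappa ->
  (forall a, pos_pt a -> M a != 0) ->
  Lau (fun a => phi a * M a) -> Lau (fun a => phi a * (a s + kappa a)) -> Lau phi.
Proof.
move=> LM Lk fM fk M0 L1 L2.
have [N [e [P xP]]] := Lau_expansion s L1.
have [N' [e' [H xH]]] := Lau_expansion s L2.
have [sP LP uP EP] := expansion_raise e' xP.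
have [sQ LQ uQ EQ] := expansion_raise e xH.
set P' := (fun a => P a * 'X^e') in sP LP uP EP.
set H' := (fun a => H a * 'X^e) in sQ LQ uQ EQ.
have PH a : pos_pt a -> P' a * ('X + (kappa a)%:P) = M a *: H' a.
  move=> pa; apply: pospoly_eq => x x0; have pu := pos_set_at s pa x0.
  rewrite hornerM hornerD hornerX hornerC hornerZ.
  have := EP _ pu; have := EQ _ pu; rewrite uP uQ fM // fk // set_at_same => <- <-.
  by rewrite (addnC e'); ring.
have LC r m : (N + e' <= m + r)%N -> Lau (fun a => (P' a)`_m / M a).
  elim: r m => [|r IH] m; rewrite ?addn0 => Nm.
    by apply: Lau_ext Lau0 => a pa; rewrite nth_default ?mul0r // (leq_trans (sP a)).
  have LS := IH m.+1; rewrite addSnnS in LS.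
  apply: Lau_ext (Lau_sub (LQ m.+1) (Lau_mul Lk (LS Nm))) => a pa.
  have := congr1 (fun p : {poly rat} => p`_m.+1) (PH a pa).
  rewrite mulrDr coefD coefMX coefMC coefZ /= => E.
  have -> : (H' a)`_m.+1 = ((P' a)`_m + (P' a)`_m.+1 * kappa a) / M a.
    by rewrite E mulrC mulKf // M0.
  by field; apply: M0.
have LL : Lau (fun a => (a s)^-1 ^+ (e + e') * \sum_(m < N + e') (P' a)`_m / M a * a s ^+ m).
  apply: Lau_mul; first by apply: Lau_exp; apply: Lau_inv.
  apply: Lau_sum => m; apply: Lau_mul; last by apply: Lau_exp; apply: Lau_var.
  by apply: (LC (N + e')%N); rewrite leq_addl.
apply: Lau_ext LL => a pa.
have -> : \sum_(m < N + e') (P' a)`_m / M a * a s ^+ m = (P' a).[a s] / M a.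
  rewrite (horner_coef_wide _ (sP a)) mulr_suml; apply: eq_bigr => m _.
  by rewrite mulrAC.
rewrite -EP // exprVn; field; rewrite expf_neq0 ?M0 //.
by rewrite gt_eqF.
Qed.

End Laurent.

(** Only inverses of variables can fail to stay Laurent under substitution; [D] is a common multiple
    of the substituted functions, so a power of it clears them. *)
Lemma Lau_subst n n' (b : ('I_n' -> rat) -> 'I_n -> rat) D phi :
  (forall a, pos_pt a -> pos_pt (b a)) -> (forall a, pos_pt a -> D a != 0) ->
  Lau D -> (forall i, Lau (fun a => b a i)) -> (forall i, Lau (fun a => D a / b a i)) ->
  Lau phi -> exists e, Lau (fun a => phi (b a) * D a ^+ e).
Proof.
move=> pb D0 LD Lb Lib; elim=> {phi} [c|i|i|f g _ [e Le] _ [e' Le']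
  |f g _ [e Le] _ [e' Le']|f g fg _ [e Le]].
- by exists 0%N; apply: Lau_ext (Lau_const _ c) => a _; rewrite mulr1.
- by exists 0%N; apply: Lau_ext (Lb i) => a _; rewrite mulr1.
- by exists 1%N; apply: Lau_ext (Lib i) => a _; rewrite mulrC.
- exists (e + e')%N.
  apply: Lau_ext (Lau_add (Lau_mul Le (Lau_exp e' LD)) (Lau_mul Le' (Lau_exp e LD))) => a _.
  by rewrite exprD; ring.
- exists (e + e')%N; apply: Lau_ext (Lau_mul Le Le') => a _.
  by rewrite exprD; ring.
- by exists e; apply: Lau_ext Le => a pa; rewrite fg //; apply: pb.
Qed.

Section Cluster.
Variables (n : nat) (d : 'I_n -> nat).
Implicit Types (B : 'I_n -> 'I_n -> rat) (i j k l s : 'I_n) (w : seq 'I_n) (U : {set 'I_n})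
  (e : 'I_n -> nat).

Definition mon (K : fieldType) e (a : 'I_n -> K) : K := \prod_j a j ^+ e j.

Definition epos B k j := pospart (eps d B k j).
Definition eneg B k j := pospart (- eps d B k j).

Definition mutA (K : fieldType) k B (a : 'I_n -> K) : 'I_n -> K :=
  fun i => if i == k then (mon (epos B k) a + mon (eneg B k) a) / a k else a i.

Fixpoint Apath (K : fieldType) B w (a : 'I_n -> K) : 'I_n -> K :=
  if w is k :: w' then Apath (mutB d k B) w' (mutA k B a) else a.

Lemma Apath_cat (K : fieldType) B w w' (a : 'I_n -> K) :
  Apath B (w ++ w') a = Apath (Bpath d B w) w' (Apath B w a).
Proof. by elim: w B a => /=. Qed.

Lemma mon_gt0 e (a : 'I_n -> rat) : pos_pt a -> 0 < mon e a.
Proof. by move=> pa; apply: prodr_gt0 => j _; apply: exprn_gt0. Qed.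

Lemma mutA_pos k B (a : 'I_n -> rat) : pos_pt a -> pos_pt (mutA k B a).
Proof.
move=> pa i; rewrite /mutA; case: eqP => // _.
by rewrite divr_gt0 // addr_gt0 // mon_gt0.
Qed.

Lemma Apath_pos B w (a : 'I_n -> rat) : pos_pt a -> pos_pt (Apath B w a).
Proof. by elim: w B a => //= k w IH B a pa; apply/IH/mutA_pos. Qed.

Lemma eq_mon (K : fieldType) e e' (a a' : 'I_n -> K) :
  (forall j, e j = e' j) -> (forall j, e j = 0%N \/ a j = a' j) -> mon e a = mon e' a'.
Proof.
move=> E Ea; apply: eq_bigr => j _; rewrite -E.
by have [->|->] := Ea j.
Qed.

Lemma ediag U B k : valid d U B -> epos B k k = 0%N /\ eneg B k k = 0%N.
Proof. by move=> vB; rewrite /epos /eneg (eps_diag _ vB) oppr0 pospart0. Qed.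

Lemma eps_mutk B k j : eps d (mutB d k B) k j = - eps d B k j.
Proof. by rewrite /eps /mutB eqxx mulNr. Qed.

Lemma mutA_other (K : fieldType) k B (a : 'I_n -> K) i : i != k -> mutA k B a i = a i.
Proof. by rewrite /mutA => /negPf ->. Qed.

Lemma mon_other (K : fieldType) k B (a : 'I_n -> K) e : e k = 0%N -> mon e (mutA k B a) = mon e a.
Proof.
move=> ek; apply: eq_mon => // j; have [->|jk] := eqVneq j k; first by left.
by right; rewrite mutA_other.
Qed.

Lemma mutA_inv U B k (a : 'I_n -> rat) : k \in U -> valid d U B -> pos_pt a ->
  mutA k (mutB d k B) (mutA k B a) = a.
Proof.
move=> kU vB pa; have [e0 e1] := ediag k vB; apply: funext => i.
have [->|ik] := eqVneq i k; last by rewrite !mutA_other.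
rewrite {1}/mutA eqxx.
have -> : mon (epos (mutB d k B) k) (mutA k B a) = mon (eneg B k) a.
  rewrite mon_other; first by apply: eq_mon; [move=> j; rewrite /epos eps_mutk|right].
  by rewrite /epos eps_mutk.
have -> : mon (eneg (mutB d k B) k) (mutA k B a) = mon (epos B k) a.
  by rewrite mon_other /eneg ?eps_mutk ?opprK //;
     apply: eq_mon; [move=> j; rewrite eps_mutk opprK|right].
rewrite /mutA eqxx invf_div addrC mulrCA divff ?mulr1 //.
by rewrite gt_eqF // addr_gt0 // mon_gt0.
Qed.

Lemma Apath_rev U B w (a : 'I_n -> rat) : all (mem U) w -> valid d U B -> pos_pt a ->
  Apath (Bpath d B w) (rev w) (Apath B w a) = a.
Proof.
elim: w B a => //= k w IH B a /andP[kU wU] vB pa; have vB' := valid_mut kU vB.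
rewrite rev_cons -cats1 Apath_cat IH //; last exact: mutA_pos.
by rewrite (Bpath_rev wU vB') /= (mutA_inv kU vB).
Qed.

Lemma pospart_le0 (q : rat) : q \is a Num.int -> q <= 0 -> pospart q = 0%N.
Proof.
move=> qi q0; apply/eqP; rewrite -(eqr_nat rat) pospart_max //.
by rewrite max_r.
Qed.

Definition oppB B i j : rat := - B i j.

Lemma mutB_opp U B k : k \in U -> valid d U B -> mutB d k (oppB B) = oppB (mutB d k B).
Proof.
move=> kU [sB iB]; apply: funext => i; apply: funext => j; rewrite /mutB /oppB.
case: eqP => // _; case: eqP => // _.
have E x : eps d (fun i j => - B i j) x k = - eps d B x k by rewrite /eps mulNr.
rewrite !E.
have Ei := pospartE (iB i k kU).1; have Ej := pospartE (iB j k kU).1.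
have -> : (pospart (eps d B i k))%:R = eps d B i k + (pospart (- eps d B i k))%:R :> rat.
  by move: Ei; lra.
have -> : (pospart (eps d B j k))%:R = eps d B j k + (pospart (- eps d B j k))%:R :> rat.
  by move: Ej; lra.
by rewrite /eps (sB j k); ring.
Qed.

Lemma valid_opp U B : valid d U B -> valid d U (oppB B).
Proof.
move=> [sB iB]; split=> [i j|i k kU]; first by rewrite /oppB (sB i j).
by rewrite /eps /oppB !mulNr !rpredN; apply: iB.
Qed.

Lemma Apath_opp U B w (a : 'I_n -> rat) : all (mem U) w -> valid d U B ->
  Apath (oppB B) w a = Apath B w a.
Proof.
elim: w B a => //= k w IH B a /andP[kU wU] vB.
rewrite (mutB_opp kU vB) (IH _ _ wU (valid_mut kU vB)); congr (Apath _ _ _).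
apply: funext => i; rewrite /mutA; case: eqP => // _; rewrite addrC.
by congr ((_ + _) / _); apply: eq_mon; [|by right| |by right];
  move=> j; rewrite /epos /eneg /eps /oppB mulNr ?opprK.
Qed.

Section Commute.
Variables (U : {set 'I_n}) (B : 'I_n -> 'I_n -> rat) (j k : 'I_n).
Hypotheses (vB : valid d U B) (jk : j != k) (Bjk : B j k = 0).

Let Bkj : B k j = 0. Proof. by rewrite vB.1 Bjk oppr0. Qed.

Lemma mutB_row0 l : mutB d j B l k = B l k.
Proof.
have kj : k != j by rewrite eq_sym.
rewrite /mutB (negPf kj) Bjk /eps Bkj mul0r pospart0 mul0r mulr0 !addr0.
by have [->|] := eqVneq l j; rewrite ?Bjk ?oppr0.
Qed.

Lemma mutB_row0' l : mutB d j B k l = B k l.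
Proof.
have kj : k != j by rewrite eq_sym.
rewrite /mutB (negPf kj) Bkj /eps Bkj mul0r pospart0 mul0r mulr0 !addr0.
by have [->|] := eqVneq l j; rewrite ?Bkj ?oppr0.
Qed.

End Commute.

Lemma mutB_comm U B j k : valid d U B -> j != k -> B j k = 0 ->
  mutB d k (mutB d j B) = mutB d j (mutB d k B).
Proof.
move=> vB jk Bjk; have kj : k != j by rewrite eq_sym.
have Bkj : B k j = 0 by rewrite vB.1 Bjk oppr0.
have e1 : eps d B j k = 0 by rewrite /eps Bjk mul0r.
have e2 : eps d B k j = 0 by rewrite /eps Bkj mul0r.
have X i l : mutB d k (mutB d j B) i l = if i == k then - B k l else if l == k then - B i k
    else mutB d j B i l + (pospart (eps d B i k))%:R * B k l + (pospart (eps d B l k))%:R * B i k.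
  by rewrite {1}/mutB /eps !(mutB_row0 vB jk Bjk) !(mutB_row0' vB jk Bjk).
have Y i l : mutB d j (mutB d k B) i l = if i == j then - B j l else if l == j then - B i j
    else mutB d k B i l + (pospart (eps d B i j))%:R * B j l + (pospart (eps d B l j))%:R * B i j.
  by rewrite {1}/mutB /eps !(mutB_row0 vB kj Bkj) !(mutB_row0' vB kj Bkj).
apply: funext => i; apply: funext => l; rewrite X Y /mutB.
have [ij|ij] := eqVneq i j; have [ik|ik] := eqVneq i k;
  have [lj|lj] := eqVneq l j; have [lk|lk] := eqVneq l k;
  (try (by move: jk; rewrite -?ij -?ik -?lj -?lk ?ij ?ik ?lj ?lk eqxx));
  rewrite ?ij ?ik ?lj ?lk ?e1 ?e2 ?Bjk ?Bkj ?pospart0 ?oppr0 //; ring.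
Qed.

Lemma mutA_comm U B j k (a : 'I_n -> rat) : valid d U B -> j != k -> B j k = 0 ->
  mutA k (mutB d j B) (mutA j B a) = mutA j (mutB d k B) (mutA k B a).
Proof.
move=> vB jk Bjk; have kj : k != j by rewrite eq_sym.
have Bkj : B k j = 0 by rewrite vB.1 Bjk oppr0.
have e1 : eps d B j k = 0 by rewrite /eps Bjk mul0r.
have e2 : eps d B k j = 0 by rewrite /eps Bkj mul0r.
have E1 l : eps d (mutB d j B) k l = eps d B k l by rewrite /eps (mutB_row0' vB jk Bjk).
have E2 l : eps d (mutB d k B) j l = eps d B j l by rewrite /eps (mutB_row0' vB kj Bkj).
have H (x y : 'I_n) B' : (forall l, eps d B' x l = eps d B x l) -> eps d B x y = 0 ->
    mon (epos B' x) (mutA y B a) + mon (eneg B' x) (mutA y B a) =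
    mon (epos B x) a + mon (eneg B x) a.
  move=> E e0; rewrite !mon_other /epos /eneg ?E ?e0 ?oppr0 ?pospart0 //.
  by congr (_ + _); apply: eq_mon; [move=> l; rewrite E|by right|move=> l; rewrite E|by right].
apply: funext => i; rewrite {1}/mutA [RHS]/mutA H // H // (mutA_other _ _ kj) (mutA_other _ _ jk).
by rewrite /mutA; have [->|ik] := eqVneq i k; rewrite ?(negPf kj).
Qed.

End Cluster.

(** * Principal frozen directions and their specialization to 1 *)

Section Principal.
Variables (n : nat) (d : 'I_n -> nat).
Implicit Types (B : 'I_n -> 'I_n -> rat) (i j k l : 'I_n) (w : seq 'I_n) (U : {set 'I_n}).

Definition extd (x : 'I_(n + n)) : nat :=
  match fintype.split x with inl i => d i | inr _ => 1%N end.

(* One frozen direction per index, paired with it by the form. *)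
Definition extB B (x y : 'I_(n + n)) : rat :=
  match fintype.split x, fintype.split y with
  | inl i, inl j => B i j
  | inl i, inr j => (i == j)%:R
  | inr i, inl j => - (i == j)%:R
  | inr _, inr _ => 0
  end.

Definition ext (T : Type) (x y : 'I_n -> T) (z : 'I_(n + n)) : T :=
  match fintype.split z with inl i => x i | inr i => y i end.

Definition extU U : {set 'I_(n + n)} := [set lshift n i | i in U].

Definition resB (C : 'I_(n + n) -> 'I_(n + n) -> rat) i j := C (lshift n i) (lshift n j).
Definition res (T : Type) (x : 'I_(n + n) -> T) i := x (lshift n i).

Lemma split_l i : fintype.split (lshift n i) = inl i. Proof. exact: (unsplitK (inl i)). Qed.
Lemma split_r i : fintype.split (rshift n i) = inr i. Proof. exact: (unsplitK (inr i)). Qed.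

Lemma extd_l i : extd (lshift n i) = d i. Proof. by rewrite /extd split_l. Qed.
Lemma extd_r i : extd (rshift n i) = 1%N. Proof. by rewrite /extd split_r. Qed.

Lemma resK B : resB (extB B) = B.
Proof.
by apply: funext => i; apply: funext => j; rewrite /resB /extB !split_l.
Qed.

Lemma mem_extU U i : (lshift n i \in extU U) = (i \in U).
Proof. by rewrite mem_imset //; apply: lshift_inj. Qed.

Lemma all_extU U w : all (mem U) w -> all (mem (extU U)) (map (lshift n) w).
Proof. by elim: w => //= k w IH /andP[kU /IH ->]; rewrite mem_extU kU. Qed.

Lemma valid_ext U B : valid d U B -> valid extd (extU U) (extB B).
Proof.
move=> [sB iB]; split=> [x y|x y /imsetP[k kU ->]].
  rewrite /extB; case: (fintype.split x) => i; case: (fintype.split y) => j.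
  - exact: sB.
  - by rewrite eq_sym opprK.
  - by rewrite eq_sym.
  - by rewrite oppr0.
rewrite /eps /extB /extd split_l; case: (fintype.split x) => i; first exact: iB.
by rewrite !rpredM ?rpredN ?rpred_nat.
Qed.

Lemma resB_mut C k : resB (mutB extd (lshift n k) C) = mutB d k (resB C).
Proof.
apply: funext => i; apply: funext => j.
by rewrite /resB /mutB /eps !extd_l !(inj_eq (@lshift_inj n n)).
Qed.

Lemma mon_res (K : fieldType) e (a : 'I_(n + n) -> K) :
  (forall f, a (rshift n f) = 1) -> mon e a = mon (res e) (res a).
Proof.
move=> a1; rewrite /mon big_split_ord /= [X in _ * X]big1 ?mulr1 // => f _.
by rewrite a1 expr1n.
Qed.

Lemma res_mutA (K : fieldType) C k (a : 'I_(n + n) -> K) :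
  (forall f, a (rshift n f) = 1) -> res (mutA extd (lshift n k) C a) = mutA d k (resB C) (res a).
Proof.
move=> a1; apply: funext => i; rewrite /res /mutA (inj_eq (@lshift_inj n n)).
case: eqP => // _; rewrite !(mon_res _ a1).
by congr ((_ + _) / _); apply: eq_bigr => j _; rewrite /res /epos /eneg /eps extd_l.
Qed.

Lemma res_Apath (K : fieldType) C w (a : 'I_(n + n) -> K) :
  (forall f, a (rshift n f) = 1) ->
  res (Apath extd C (map (lshift n) w) a) = Apath d (resB C) w (res a).
Proof.
elim: w C a => //= k w IH C a a1; rewrite IH ?resB_mut ?res_mutA // => f.
by rewrite mutA_other ?eq_rlshift.
Qed.

End Principal.

Section Units.
Variable n : nat.
Implicit Types (f g : ('I_n -> rat) -> rat) (e : 'I_n -> nat).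

Lemma Lau_mon e : Lau (@mon n rat e).
Proof. by apply: Lau_prod => j; apply: Lau_exp; apply: Lau_var. Qed.

Lemma Lau_mon_inv e : Lau (fun a => (@mon n rat e a)^-1).
Proof.
apply: Lau_ext (Lau_prod (index_enum 'I_n) xpredT (F := fun j a => (a j)^-1 ^+ e j) _) => [a _|j].
  by rewrite /mon -prodfV; apply: eq_bigr => j _; rewrite exprVn.
by apply: Lau_exp; apply: Lau_inv.
Qed.

Lemma free_mon s e : e s = 0%N -> free_of s (@mon n rat e).
Proof.
move=> es a x _ _; apply: eq_mon => // j; have [->|js] := eqVneq j s; first by left.
by right; rewrite /set_at (negPf js).
Qed.

Definition dele k e l := if l == k then 0%N else e l.

Lemma mon_split (K : fieldType) k e (a : 'I_n -> K) : mon e a = a k ^+ e k * mon (dele k e) a.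
Proof.
rewrite /mon (bigD1 k) //= [in RHS](bigD1 k) //= /dele eqxx expr0 mul1r; congr (_ * _).
by apply: eq_bigr => l /negPf ->.
Qed.

End Units.

Lemma geometric (t : rat) p : (1 + t) ^+ p = 1 + t * \sum_(i < p) (1 + t) ^+ i.
Proof.
have := subrX1 (1 + t) p; rewrite [1 + t - 1]addrAC subrr add0r => <-.
by rewrite [RHS]addrC subrK.
Qed.

(** * The variables [z], [u], [v] created by successive mutations in directions [j], [k], [j] *)

Section Core.
Variables (n : nat) (j k : 'I_n) (p r : nat).
Variables (al be al' be' ga ze : 'I_n -> nat) (z u v : ('I_n -> rat) -> rat).
Hypotheses (jk : j != k) (r0 : (0 < r)%N).
Hypotheses (alj : al j = 0%N) (bej : be j = 0%N) (gaj : ga j = 0%N) (zej : ze j = 0%N).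
Hypothesis zE : forall a, pos_pt a -> z a = (mon al a * a k ^+ p + mon be a) / a j.
Hypothesis uE : forall a, pos_pt a -> u a = (mon ga a * z a ^+ r + mon ze a) / a k.
Hypothesis vE : forall a, pos_pt a -> v a = (mon al' a * u a ^+ p + mon be' a) / z a.
Hypothesis balance : forall a, pos_pt a -> mon al' a * mon ze a ^+ p * mon al a = mon be' a * mon be a.

Lemma core_z : Lau z.
Proof.
apply: Lau_ext (Lau_mul (Lau_add (Lau_mul (Lau_mon al) (Lau_exp p (Lau_var k))) (Lau_mon be))
  (Lau_inv j)) => a pa; exact/esym/zE.
Qed.

Lemma core_u : Lau u.
Proof.
apply: Lau_ext (Lau_mul (Lau_add (Lau_mul (Lau_mon ga) (Lau_exp r core_z)) (Lau_mon ze))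
  (Lau_inv k)) => a pa; exact/esym/uE.
Qed.

Lemma core_z_gt0 a : pos_pt a -> 0 < z a.
Proof.
move=> pa; rewrite zE // divr_gt0 // addr_gt0 ?mulr_gt0 ?mon_gt0 //.
exact: exprn_gt0.
Qed.

(** With the second monomial factored out, [u] is [mon ze / a k] times [1 + rho z]; [S] is the
    geometric sum with [(1 + rho z)^p = 1 + rho z S]. *)
Let rho a := mon ga a * z a ^+ r.-1 / mon ze a.
Let S a := \sum_(i < p) (1 + rho a * z a) ^+ i.

(** The division by [z] in [v] is exact: modulo [z] the power of [u] reduces to a monomial, and by
    [balance] its contribution and [mon be'] combine into a multiple of [z]. *)
Lemma core_vE a : pos_pt a ->
  v a = mon be' a / (mon al a * a k ^+ p) * (a j + mon be a * rho a * S a).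
Proof.
move=> pa; have z0 := core_z_gt0 pa; have ka := pa k; have ja := pa j.
have m0 e := mon_gt0 e pa.
have uu : u a ^+ p = mon ze a ^+ p / a k ^+ p * (1 + rho a * z a * S a).
  have -> : u a = mon ze a / a k * (1 + rho a * z a).
    rewrite uE // /rho -[in LHS](prednK r0) exprS; field.
    by rewrite !gt_eqF.
  by rewrite exprMn expr_div_n geometric.
have alz : mon al a * mon al' a * mon ze a ^+ p = mon be' a * mon be a.
  by rewrite -balance //; ring.
have zz : mon al a * a k ^+ p = z a * a j - mon be a.
  by rewrite zE //; field; rewrite gt_eqF.
rewrite vE // uu.
have kp : a k ^+ p != 0 by rewrite expf_neq0 // gt_eqF.
have al0 : mon al a != 0 by rewrite gt_eqF.
have zn : z a != 0 by rewrite gt_eqF.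
have alp : mon al a * a k ^+ p != 0 by rewrite mulf_neq0.
apply: (mulfI zn); apply: (mulfI alp).
transitivity (mon al a * mon al' a * mon ze a ^+ p * (1 + rho a * z a * S a) +
  mon al a * a k ^+ p * mon be' a); first by field; rewrite kp zn.
rewrite alz.
transitivity (mon be' a * (z a * a j + mon be a * rho a * S a * z a)).
  by rewrite zz; ring.
by field; rewrite kp al0.
Qed.

Lemma Lau_rho : Lau rho.
Proof.
apply: Lau_mul; last exact: Lau_mon_inv.
by apply: Lau_mul; [apply: Lau_mon|apply: Lau_exp; apply: core_z].
Qed.

Lemma Lau_S : Lau S.
Proof.
apply: Lau_sum => i; apply: Lau_exp; apply: Lau_add; first exact: Lau1.
by apply: Lau_mul; [apply: Lau_rho|apply: core_z].
Qed.

Lemma core_v : Lau v.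
Proof.
have L : Lau (fun a => mon be' a * (mon al a)^-1 * (a k)^-1 ^+ p * (a j + mon be a * rho a * S a)).
  apply: Lau_mul; last first.
    apply: Lau_add; first exact: Lau_var.
    apply: Lau_mul; last exact: Lau_S.
    by apply: Lau_mul; [apply: Lau_mon|apply: Lau_rho].
  apply: Lau_mul; last by apply: Lau_exp; apply: Lau_inv.
  by apply: Lau_mul; [apply: Lau_mon|apply: Lau_mon_inv].
by apply: Lau_ext L => a pa; rewrite core_vE // exprVn invfM !mulrA.
Qed.

(** Since [r > 0], [u * a k] is congruent modulo [z] to the invertible monomial [mon ze]. *)
Lemma core_u_coprime phi : Lau (fun a => phi a * z a) -> Lau (fun a => phi a * u a) -> Lau phi.
Proof.
move=> Lz Lu.
have L : Lau (fun a => (mon ze a)^-1 * (a k * (phi a * u a) -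
    mon ga a * z a ^+ r.-1 * (phi a * z a))).
  apply: Lau_mul; first exact: Lau_mon_inv.
  apply: Lau_sub; first by apply: Lau_mul => //; apply: Lau_var.
  by apply: Lau_mul => //; apply: Lau_mul; [apply: Lau_mon|apply: Lau_exp; apply: core_z].
apply: Lau_ext L => a pa; rewrite uE // -[in z a ^+ r](prednK r0) exprS; field.
by rewrite !gt_eqF ?mon_gt0.
Qed.

(** Up to monomials [v] is [a j + mon be * rho * S]. For [r > 1] the factor [rho] is divisible by
    [z], which leaves the unit [a j]. For [r = 1], [S] is congruent to [p], which leaves [a j] plus
    a term free of [a j]; as [z * a j] is free of [a j] too, [Lau_divide] applies. *)
Lemma core_v_coprime phi : Lau (fun a => phi a * z a) -> Lau (fun a => phi a * v a) -> Lau phi.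
Proof.
move=> Lz Lv.
have L1 : Lau (fun a => phi a * (a j + mon be a * rho a * S a)).
  have L : Lau (fun a => (mon be' a)^-1 * mon al a * a k ^+ p * (phi a * v a)).
    apply: Lau_mul => //; apply: Lau_mul; last by apply: Lau_exp; apply: Lau_var.
    by apply: Lau_mul; [apply: Lau_mon_inv|apply: Lau_mon].
  apply: Lau_ext L => a pa; rewrite core_vE //; field.
  by rewrite !gt_eqF ?mon_gt0 // exprn_gt0.
have LM : Lau (fun a => phi a * (mon al a * a k ^+ p + mon be a)).
  apply: Lau_ext (Lau_mul Lz (Lau_var j)) => a pa; rewrite zE //; field.
  by rewrite gt_eqF.
have [r1|r1] := eqVneq r 1%N.
  pose q a := \sum_(i < p) rho a * \sum_(l < i) (1 + rho a * z a) ^+ l.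
  have Lq : Lau q.
    apply: Lau_sum => i; apply: Lau_mul; first exact: Lau_rho.
    apply: Lau_sum => l; apply: Lau_exp; apply: Lau_add; first exact: Lau1.
    by apply: Lau_mul; [apply: Lau_rho|apply: core_z].
  have SE a : S a = p%:R + z a * q a.
    have -> : p%:R = \sum_(i < p) (1 : rat) by rewrite sumr_const card_ord.
    rewrite mulr_sumr -big_split; apply: eq_bigr => i _ /=.
    by rewrite geometric; ring.
  have rhoE a : rho a = mon ga a / mon ze a by rewrite /rho r1 expr0 mulr1.
  apply: (@Lau_divide _ j (fun a => mon al a * a k ^+ p + mon be a)
    (fun a => mon be a * (mon ga a / mon ze a) * p%:R)) => //.
  - apply: Lau_add; last exact: Lau_mon.
    by apply: Lau_mul; [apply: Lau_mon|apply: Lau_exp; apply: Lau_var].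
  - apply: Lau_mul; last exact: Lau_nat.
    apply: Lau_mul; first exact: Lau_mon.
    by apply: Lau_mul; [apply: Lau_mon|apply: Lau_mon_inv].
  - move=> a x pa x0; rewrite !free_mon // {1}/set_at.
    by rewrite eq_sym (negPf jk).
  - by move=> a x pa x0; rewrite !free_mon.
  - by move=> a pa; rewrite gt_eqF // addr_gt0 ?mulr_gt0 ?mon_gt0 // exprn_gt0.
  apply: Lau_ext (Lau_sub L1 (Lau_mul Lz (Lau_mul (Lau_mul (Lau_mon be) Lau_rho) Lq))) => a pa.
  by rewrite SE -rhoE; ring.
have rr : r.-1 = r.-2.+1 by case: r r0 r1 => [|[]].
have L : Lau (fun a => (a j)^-1 * (phi a * (a j + mon be a * rho a * S a) -
    (phi a * z a) * (mon be a * (mon ga a * z a ^+ r.-2 * (mon ze a)^-1) * S a))).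
  apply: Lau_mul; first exact: Lau_inv.
  apply: Lau_sub => //; apply: Lau_mul => //; apply: Lau_mul; last exact: Lau_S.
  apply: Lau_mul; first exact: Lau_mon.
  apply: Lau_mul; last exact: Lau_mon_inv.
  by apply: Lau_mul; [apply: Lau_mon|apply: Lau_exp; apply: core_z].
apply: Lau_ext L => a pa; rewrite /rho rr exprS; field.
by rewrite !gt_eqF ?mon_gt0.
Qed.

Lemma Lau_pow_coprime (g h phi : ('I_n -> rat) -> rat) (c b : nat) : Lau g -> Lau h ->
  (forall psi, Lau (fun a => psi a * g a) -> Lau (fun a => psi a * h a) -> Lau psi) ->
  Lau (fun a => phi a * g a ^+ c) -> Lau (fun a => phi a * h a ^+ b) -> Lau phi.
Proof.
move=> Lg Lh H; elim: c phi => [|c IH] phi Lc Lb.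
  by apply: Lau_ext Lc => a _; rewrite mulr1.
apply: IH => //; apply: (Lau_ext (f := fun a => phi a * g a ^+ c)); first by [].
have Lc' : Lau (fun a => (phi a * g a ^+ c) * g a).
  by apply: Lau_ext Lc => a _; rewrite exprSr mulrA.
have Lb' : Lau (fun a => (phi a * g a ^+ c) * h a ^+ b).
  by apply: Lau_ext (Lau_mul Lb (Lau_exp c Lg)) => a _; ring.
elim: b {Lb} Lb' => [|b IHb] Lb'; first by apply: Lau_ext Lb' => a _; rewrite mulr1.
apply: IHb; apply: H.
  by apply: Lau_ext (Lau_mul Lc' (Lau_exp b Lh)) => a _; ring.
by apply: Lau_ext Lb' => a _; rewrite exprSr; ring.
Qed.

Lemma core_coprime phi e c : Lau (fun a => phi a * z a ^+ e) ->
  Lau (fun a => phi a * (u a * v a) ^+ c) -> Lau phi.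
Proof.
move=> Lz Lc.
have Lw : Lau (fun a => phi a * u a ^+ c).
  apply: (@Lau_pow_coprime z v (fun a => phi a * u a ^+ c) e c core_z core_v core_v_coprime).
    by apply: Lau_ext (Lau_mul Lz (Lau_exp c core_u)) => a _; ring.
  by apply: Lau_ext Lc => a _; rewrite exprMn mulrA.
exact: (@Lau_pow_coprime z u phi e c core_z core_u core_u_coprime).
Qed.

End Core.

Lemma Lau_mutA n (d : 'I_n -> nat) B k i : Lau (fun a : 'I_n -> rat => mutA d k B a i).
Proof.
have [->|ik] := eqVneq i k; last by apply: Lau_ext (Lau_var i) => a _; rewrite mutA_other.
apply: Lau_ext (Lau_mul (Lau_add (Lau_mon _) (Lau_mon _)) (Lau_inv k)) => a _.
by rewrite /mutA eqxx.
Qed.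

Lemma Lau_subst_mutA n (d : 'I_n -> nat) B k phi : Lau phi ->
  exists e, Lau (fun a : 'I_n -> rat => phi (mutA d k B a) * mutA d k B a k ^+ e).
Proof.
move=> Lp; apply: (Lau_subst (D := fun a => mutA d k B a k)) Lp.
- by move=> a; apply: mutA_pos.
- by move=> a pa; rewrite gt_eqF // mutA_pos.
- exact: Lau_mutA.
- by move=> i; apply: Lau_mutA.
move=> i; have [->|ik] := eqVneq i k.
  by apply: Lau_ext (Lau1 n) => a pa; rewrite divff // gt_eqF // mutA_pos.
apply: Lau_ext (Lau_mul (Lau_mutA d B k k) (Lau_inv i)) => a _.
by rewrite (mutA_other _ _ _ ik).
Qed.

(* Commuting mutations: the new variables are coprime because the frozen variable
   attached to [k] occurs in only one of them. *)
Lemma Lau_commuting n (d : 'I_n -> nat) U B j k f phi psi : valid d U B -> j != k -> j \in U -> k \in U ->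
  B j k = 0 -> eps d B k f = 1 -> eps d B j f = 0 -> f != k -> Lau psi -> Lau phi ->
  (forall a, pos_pt a -> psi (mutA d k B a) = phi (mutA d j B a)) ->
  Lau (fun a => psi (mutA d k B a)).
Proof.
move=> vB jk jU kU Bjk kf jf fk Lpsi Lphi E.
have [ejf1 ejf2] : epos d B j f = 0%N /\ eneg d B j f = 0%N.
  by rewrite /epos /eneg jf oppr0 pospart0.
have [e1 L1] := Lau_subst_mutA d B k Lpsi; have [e2 L2] := Lau_subst_mutA d B j Lphi.
have [ekf1 ekf2] : epos d B k f = 1%N /\ eneg d B k f = 0%N.
  have p1 := pospart_intr 1; have n1 := pospart_intr (-1).
  by rewrite /epos /eneg kf p1 n1.
have H rho : Lau (fun a => rho a * mutA d j B a j) -> Lau (fun a => rho a * mutA d k B a k) ->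
    Lau rho.
  move=> Lj Lk; pose m := dele f (epos d B k).
  apply: (@Lau_divide _ f (fun a => mon (epos d B j) a + mon (eneg d B j) a)
    (fun a => mon (eneg d B k) a / mon m a)).
  - by apply: Lau_add; apply: Lau_mon.
  - by apply: Lau_mul; [apply: Lau_mon|apply: Lau_mon_inv].
  - by move=> a x pa x0; rewrite !free_mon.
  - by move=> a x pa x0; rewrite !free_mon // /m /dele eqxx.
  - by move=> a pa; rewrite gt_eqF // addr_gt0 // mon_gt0.
  - apply: Lau_ext (Lau_mul Lj (Lau_var j)) => a pa; rewrite /mutA eqxx; field.
    by rewrite gt_eqF.
  - apply: Lau_ext (Lau_mul Lk (Lau_mul (Lau_var k) (Lau_mon_inv m))) => a pa.
    rewrite /mutA eqxx (mon_split f (epos d B k)) ekf1 -/m; field.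
    by rewrite !gt_eqF ?mon_gt0.
apply: (Lau_pow_coprime (Lau_mutA d B j j) (Lau_mutA d B k k) H _ L1).
by apply: Lau_ext L2 => a pa; rewrite E.
Qed.

Lemma rat_nat_eq (m m' : nat) : m%:R = m'%:R :> rat -> m = m'.
Proof. by move/eqP; rewrite eqr_nat => /eqP. Qed.

(** Being Laurent in the cluster after [j], the function needs only powers of [z] as extra
    denominators; being Laurent in the cluster after [j, k, j], only powers of [u * v]. Coprimality
    removes both. *)
Lemma Lau_rank2 n (d : 'I_n -> nat) U B j k (phi psi : ('I_n -> rat) -> rat) : valid d U B ->
  j != k -> j \in U -> k \in U -> 0 < eps d B j k -> (forall i, (0 < d i)%N) ->
  let B1 := mutB d j B in let B2 := mutB d k B1 in
  let F (a : 'I_n -> rat) := mutA d j B2 (mutA d k B1 (mutA d j B a)) in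
  Lau phi -> Lau psi -> (forall a, pos_pt a -> psi (F a) = phi (mutA d j B a)) ->
  Lau (fun a => phi (mutA d j B a)).
Proof.
move=> vB jk jU kU jk0 d0 B1 B2 F Lphi Lpsi E; have kj : k != j by rewrite eq_sym.
have vB1 : valid d U B1 := valid_mut jU vB; have vB2 : valid d U B2 := valid_mut kU vB1.
have [sB1 iB1] := vB1; have [sB iB] := vB.
have B1j l : l != j -> B1 l j = - B l j by move=> lj; rewrite /B1 /mutB (negPf lj) eqxx.
have e1jk : eps d B1 j k = - eps d B j k by rewrite /B1 eps_mutk.
have kj0 : 0 < eps d B1 k j.
  rewrite /eps B1j // -sB mulr_gt0 ?ltr0n //.
  by move: jk0; rewrite /eps pmulr_lgt0 // ltr0n.
have i1 := (iB1 k j jU).1; have i0 := (iB j k kU).1.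
pose p := epos d B j k; pose r := epos d B1 k j.
have r0 : (0 < r)%N by rewrite -(ltr_nat rat) pospart_max // lt_max kj0.
have n1 : eneg d B1 k j = 0%N by rewrite /eneg pospart_le0 ?rpredN // oppr_le0 ltW.
have n0 : eneg d B j k = 0%N by rewrite /eneg pospart_le0 ?rpredN // oppr_le0 ltW.
have e2jk : eps d B2 j k = eps d B j k.
  by rewrite /eps /B2 /mutB (negPf jk) eqxx mulNr -/(eps d B1 j k) e1jk opprK.
have n2 : eneg d B2 j k = 0%N by rewrite /eneg e2jk.
have p2 : epos d B2 j k = p by rewrite /epos e2jk.
have [jj jj'] := ediag j vB; have [j2 j2'] := ediag j vB2.
have dele0 (K : fieldType) x e (a : 'I_n -> K) : e x = 0%N -> mon (dele x e) a = mon e a.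
  move=> ex; apply: eq_mon => l; last by right.
  by rewrite /dele; case: eqP => // ->.
have dele_eq0 x e l : e l = 0%N -> dele x e l = 0%N.
  by rewrite /dele => ->; case: ifP.
have e2 l : l != k -> eps d B2 j l = - eps d B j l - p%:R * (eneg d B1 k l)%:R.
  move=> lk; rewrite /eps /B2 /mutB (negPf jk) (negPf lk) !mulrDl.
  rewrite -/(eps d B1 j l) {1}/B1 eps_mutk e1jk.
  rewrite [pospart (- eps d B j k)]pospart_le0 ?rpredN // ?oppr_le0 ?ltW //.
  rewrite mul0r mul0r addr0; congr (_ + _).
  have := congr1 (fun m : nat => m%:R : rat) (dpos l kU vB1); rewrite !natrM -/(eneg d B1 k l).
  have pE : p%:R = - eps d B1 j k by rewrite e1jk opprK pospart_max // max_l // ltW.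
  by rewrite pE /eps => H; rewrite !mulNr opprK -[B1 j k * _ * _]mulrA -H; ring.
pose al := dele k (epos d B j); pose be := eneg d B j.
pose al' := dele k (epos d B2 j); pose be' := eneg d B2 j.
pose ga := dele j (epos d B1 k); pose ze := eneg d B1 k.
pose z (a : 'I_n -> rat) : rat := mutA d j B a j.
pose u (a : 'I_n -> rat) : rat := mutA d k B1 (mutA d j B a) k.
pose v (a : 'I_n -> rat) : rat := F a j.
have alj : al j = 0%N by apply: dele_eq0.
have gaj : ga j = 0%N by rewrite /ga /dele eqxx.
have zE a : pos_pt a -> z a = (mon al a * a k ^+ p + mon be a) / a j.
  by move=> pa; rewrite /z /mutA eqxx (mon_split k (epos d B j)) (mulrC (mon al a)).
have uE a : pos_pt a -> u a = (mon ga a * z a ^+ r + mon ze a) / a k.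
  move=> pa; rewrite /u {1}/mutA eqxx (mon_split j (epos d B1 k)) -/ga -/r.
  by rewrite !(@mon_other _ d) // -/(z a) (mutA_other _ _ _ kj) (mulrC (z a ^+ _)).
have vE a : pos_pt a -> v a = (mon al' a * u a ^+ p + mon be' a) / z a.
  move=> pa; rewrite /v /F {1}/mutA eqxx (mon_split k (epos d B2 j)) p2 -/al'.
  have al'k : al' k = 0%N by rewrite /al' /dele eqxx.
  have al'j : al' j = 0%N by apply: dele_eq0.
  rewrite !(@mon_other _ d _ k) // !(@mon_other _ d _ j) // -/(u a) (mulrC (u a ^+ _)).
  by rewrite (mutA_other _ _ _ jk).
(* Compared exponent by exponent, this is the formula [e2] for row [j] of the matrix after the
   mutations at [j] and [k]. *)
have bal a : pos_pt a -> mon al' a * mon ze a ^+ p * mon al a = mon be' a * mon be a.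
  move=> pa; rewrite /mon -prodrXl -!big_split; apply: eq_bigr => l _ /=.
  rewrite -exprM -!exprD; congr (_ ^+ _); have [->|lk] := eqVneq l k.
    by rewrite /al' /al /be' /be /dele eqxx n2 n0 /ze (ediag k vB1).2.
  rewrite /al' /al /be' /be /dele (negPf lk) /ze; apply: rat_nat_eq.
  rewrite !natrD natrM.
  have H1 := pospartE (iB l j jU).2; have H2 := pospartE (vB2.2 l j jU).2.
  move: H1 H2; rewrite e2 // -/(epos d B j l) -/(eneg d B j l).
  rewrite -[pospart (- eps d B j l - _)]/(pospart (- eps d B j l - p%:R * (eneg d B1 k l)%:R)).
  rewrite -e2 // -/(epos d B2 j l) -/(eneg d B2 j l) e2 //; lra.
have cz := core_z zE; have cu := core_u zE uE.
have cv := core_v r0 zE uE vE bal.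
have [e L1] := Lau_subst_mutA d B j Lphi.
have posF a : pos_pt a -> pos_pt (F a) by move=> pa; do 3!apply: mutA_pos.
have Fk a : F a k = u a by rewrite /F (mutA_other _ _ _ kj).
have Fo a i : i != j -> i != k -> F a i = a i.
  by move=> ij ik; rewrite /F (mutA_other _ _ _ ij) (mutA_other _ _ _ ik) (mutA_other _ _ _ ij).
have u0 a : pos_pt a -> u a != 0 by move=> pa; rewrite -Fk gt_eqF // posF.
have v0 a : pos_pt a -> v a != 0 by move=> pa; rewrite gt_eqF // posF.
have [c L2] : exists c, Lau (fun a => psi (F a) * (u a * v a) ^+ c).
  apply: (Lau_subst (D := fun a => u a * v a)) Lpsi => //.
  - by move=> a pa; rewrite mulf_neq0 ?u0 ?v0.
  - exact: Lau_mul.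
  - move=> i; have [->|ij] := eqVneq i j; first exact: cv.
    have [->|ik] := eqVneq i k; first by apply: Lau_ext cu => a _; rewrite Fk.
    by apply: Lau_ext (Lau_var i) => a _; rewrite Fo.
  move=> i; have [->|ij] := eqVneq i j.
    by apply: Lau_ext cu => a pa; rewrite mulfK // v0.
  have [->|ik] := eqVneq i k.
    by apply: Lau_ext cv => a pa; rewrite Fk mulrC mulKf // u0.
  by apply: Lau_ext (Lau_mul (Lau_mul cu cv) (Lau_inv i)) => a _; rewrite Fo.
apply: (core_coprime jk r0 alj _ gaj n1 zE uE vE bal L1) => //.
by apply: Lau_ext L2 => a pa; rewrite E.
Qed.

(* Induction on the length of the path, for all exchange matrices at once: the
   variable at the end of [j :: k :: w] is Laurent in the clusters reached by [j]
   and by [j, k, j] (by [k] if the two mutations commute), and the denominators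
   so obtained are coprime. *)
Theorem Laurent_phenomenon n (d : 'I_n -> nat) U B w i : (forall i, (0 < d i)%N) ->
  valid d U B -> all (mem U) w -> Lau (fun a : 'I_n -> rat => Apath d B w a i).
Proof.
have [N] := ubnP (size w); elim: N => // N IH in n d U B w i *.
case: w => [|j [|k w]] sw d0 vB wU; [exact: Lau_var|exact: Lau_mutA|].
have [jU kU wU'] : [/\ j \in U, k \in U & all (mem U) w] by case/and3P: wU.
have [jk|jk] := eqVneq j k.
  apply: Lau_ext (IH _ d U B w i _ d0 vB wU') => [a pa|]; last by move: sw; rewrite /=; lia.
  by rewrite jk /= (mutB_inv kU vB) (mutA_inv kU vB).
pose dd := extd d; pose UU := extU U; pose C := extB B; pose ww := map (lshift n) w.
have {vB}vC : valid dd UU C := valid_ext vB.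
have {d0}dd0 x : (0 < dd x)%N by rewrite /dd /extd; case: (fintype.split x).
pose J := lshift n j; pose K := lshift n k; pose I := lshift n i.
have JU : J \in UU by rewrite mem_extU.
have KU : K \in UU by rewrite mem_extU.
have wwU : all (mem UU) ww by apply: all_extU.
have JK : J != K by rewrite (inj_eq (@lshift_inj n n)).
have sww : size ww = size w by rewrite size_map.
suff L : Lau (fun a : 'I_(n + n) -> rat => Apath dd C (J :: K :: ww) a I).
  have [||||i0|c Lc] := @Lau_subst _ n (fun a => ext a (fun=> 1)) (fun=> 1) _ _ _ _ _ _ L.
  - by move=> a pa x; rewrite /ext; case: (fintype.split x) => // l; apply: pa.
  - by move=> a _; rewrite oner_neq0.
  - exact: Lau1.
  - by move=> x; rewrite /ext; case: (fintype.split x) => l; [apply: Lau_var|apply: Lau1].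
  - rewrite /ext; case: (fintype.split i0) => l; last by apply: Lau_ext (Lau1 n) => a _; rewrite divr1.
    by apply: Lau_ext (Lau_inv l) => a _; rewrite div1r.
  apply: Lau_ext Lc => a _; rewrite expr1n mulr1.
  have := @res_Apath n d rat C (j :: k :: w) (ext a (fun=> 1)) _; rewrite resK => E.
  have Ea : res (ext a (fun=> 1)) = a by apply: funext => l; rewrite /res /ext split_l.
  by move: E; rewrite Ea => <- // f; rewrite /ext split_r.
have IHC C' w' i' : (size w' < N)%N -> valid dd UU C' -> all (mem UU) w' ->
    Lau (fun a : 'I_(n + n) -> rat => Apath dd C' w' a i').
  by move=> sw' vC' wU0; apply: IH vC' wU0.
have s1 x : (size (x :: ww) < N)%N by rewrite /= sww; exact: sw.
have [BJK|BJK] := eqVneq (C J K) 0.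
  have vJ := valid_mut JU vC; have vK := valid_mut KU vC.
  have L := @Lau_commuting _ dd UU C J K (rshift n k)
    (fun a => Apath dd (mutB dd J C) (K :: ww) a I)
    (fun a => Apath dd (mutB dd K C) (J :: ww) a I) vC JK JU KU BJK.
  have E a : pos_pt a -> Apath dd (mutB dd K C) (J :: ww) (mutA dd K C a) I =
      Apath dd (mutB dd J C) (K :: ww) (mutA dd J C a) I.
    by move=> pa; rewrite /= (mutB_comm vC JK BJK) (mutA_comm _ vC JK BJK).
  apply: Lau_ext (L _ _ _ _ _ E) => [a pa||||| ].
  - exact: E.
  - by rewrite /eps /dd extd_r /C /extB split_l split_r eqxx mulr1.
  - by rewrite /eps /dd extd_r /C /extB split_l split_r (negPf jk) mulr1.
  - by rewrite eq_rlshift.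
  - by apply: IHC; rewrite ?s1 //= ?JU ?KU.
  - by apply: IHC; rewrite ?s1 //= ?JU ?KU.
have pos_case C' : valid dd UU C' -> 0 < eps dd C' J K ->
    Lau (fun a : 'I_(n + n) -> rat => Apath dd C' (J :: K :: ww) a I).
  move=> vC' JK0.
  have v1 := valid_mut JU vC'; have v2 := valid_mut KU v1; have v3 := valid_mut JU v2.
  apply: (@Lau_rank2 _ dd UU C' J K (fun a => Apath dd (mutB dd J C') (K :: ww) a I)
    (fun a => Apath dd (mutB dd J (mutB dd K (mutB dd J C'))) (J :: ww) a I)) => //.
  - by apply: IHC; rewrite ?s1 //= ?JU ?KU.
  - by apply: IHC; rewrite ?s1 //= ?JU ?KU.
  - move=> a pa /=; rewrite (mutB_inv JU v2) (mutA_inv JU v2) //.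
    by do 2!apply: mutA_pos.
have [E0|E0|E0] := ltgtP (eps dd C J K) 0; last first.
- by move/eqP: E0; rewrite /eps mulf_eq0 (negPf BJK) pnatr_eq0 eqn0Ngt dd0.
- exact: pos_case.
(* Reversing the sign of the matrix exchanges the two monomials of every exchange relation and
   leaves the variables unchanged. *)
apply: Lau_ext (pos_case (oppB C) (valid_opp vC) _) => [a _|].
  by rewrite (Apath_opp (U := UU)) //= JU KU.
by rewrite /eps /oppB mulNr oppr_gt0.
Qed.

(** * Bounded Laurent polynomials are constant *)

Section PowersOfTwo.

Lemma pow2_unbounded (b : rat) : exists m : nat, b < 2 ^+ m.
Proof.
exists (Num.truncn `|b|).+1; apply: le_lt_trans (ler_norm b) _.
apply: lt_le_trans (truncnS_gt _) _.
rewrite -natrX ler_nat; apply: ltnW; exact: ltn_expl.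
Qed.

Lemma poly_growth (Q : {poly rat}) C e : (forall m : nat, `|Q.[2 ^+ m]| <= C * (2 ^+ m) ^+ e) ->
  (size Q <= e.+1)%N.
Proof.
move=> H; rewrite leqNgt; apply/negP => sQ.
have [d Ed] : exists d, size Q = d.+2 by case: (size Q) sQ => [|[|d]] // _; exists d.
have ed : (e <= d)%N by move: sQ; rewrite Ed ltnS ltnS.
have Qn : lead_coef Q != 0 by rewrite lead_coef_eq0 -size_poly_eq0 Ed.
pose S := \sum_(i < d.+1) `|Q`_i|.
have [m Hm] := pow2_unbounded ((C + S) / `|lead_coef Q|).
set x : rat := 2 ^+ m; have x1 : 1 <= x by apply: exprn_ege1.
have x0 : 0 < x by apply: lt_le_trans x1.
have C0 : 0 <= C.
  by have := le_trans (normr_ge0 _) (H m); rewrite pmulr_lge0 // !exprn_gt0.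
have := H m; rewrite -/x => {}H.
have : `|lead_coef Q| * x ^+ d.+1 <= C * x ^+ e + S * x ^+ d.
  have -> : `|lead_coef Q| * x ^+ d.+1 = `|Q.[x] - \sum_(i < d.+1) Q`_i * x ^+ i|.
    rewrite horner_coef Ed big_ord_recr /= addrAC subrr add0r lead_coefE Ed /=.
    by rewrite normrM (ger0_norm (exprn_ge0 _ (ltW x0))).
  apply: le_trans (ler_normB _ _) _; apply: lerD => //.
  apply: le_trans (ler_norm_sum _ _ _) _; rewrite /S mulr_suml; apply: ler_sum => i _.
  rewrite normrM (ger0_norm (exprn_ge0 _ (ltW x0))) ler_wpM2l // ler_weXn2l //.
  by rewrite -ltnS.
have : C * x ^+ e + S * x ^+ d <= (C + S) * x ^+ d.
  by rewrite mulrDl lerD2r ler_wpM2l // ler_weXn2l.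
move=> H1 H2; have := le_trans H2 H1; rewrite exprS mulrA ler_pM2r ?exprn_gt0 //.
rewrite -ler_pdivlMl ?normr_gt0 // mulrC => H3.
by have := le_lt_trans H3 Hm; rewrite ltxx.
Qed.

(** Growth at large powers of two bounds the degree; growth at small ones bounds the degree of the
    reversed polynomial, hence the order of vanishing at 0. *)
Lemma poly_two_sided (Q : {poly rat}) C e :
  (forall m : int, `|Q.[2 ^ m]| <= C * (2 ^ m) ^+ e) -> Q = Q`_e *: 'X^e.
Proof.
move=> H; have top : (size Q <= e.+1)%N by apply: (@poly_growth Q C e) => m; exact: H m.
pose r := \poly_(i < e.+1) Q`_(e - i).
have bot : (size r <= 1)%N.
  apply: (@poly_growth _ C) => m; set x : rat := 2 ^+ m.
  have x0 : 0 < x by apply: exprn_gt0.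
  have := H (- m%:Z); rewrite -exprnN -/x => Hm.
  have -> : r.[x] = x ^+ e * Q.[x^-1].
    rewrite /r horner_poly (horner_coef_wide _ top) mulr_sumr.
    rewrite (reindex_inj rev_ord_inj) /=; apply: eq_bigr => i _.
    have ie : (i <= e)%N by rewrite -ltnS.
    rewrite subSS subKn // exprVn mulrCA; congr (_ * _).
    have -> : x ^+ e = x ^+ (e - i) * x ^+ i by rewrite -exprD subnK.
    by rewrite mulfK // expf_neq0 // gt_eqF.
  rewrite normrM (ger0_norm (exprn_ge0 _ (ltW x0))) expr0 mulr1.
  by rewrite -ler_pdivlMl ?exprn_gt0 // -(exprVn x e) [_ * C]mulrC.
apply/polyP => i; rewrite coefZ coefXn; have [->|ie] := eqVneq i e; first by rewrite mulr1.
rewrite mulr0; have [ei|ie'] := leqP e.+1 i; first by rewrite nth_default // (leq_trans top).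
have := nth_default 0 (leq_trans bot _ : (_ <= e - i)%N).
have lt_ie : (i < e)%N by rewrite ltn_neqAle ie -ltnS.
rewrite subn_gt0 lt_ie => /(_ isT); rewrite /r coef_poly ltnS leq_subr subKn //.
Qed.

End PowersOfTwo.

Section Bounded.
Variable n : nat.
Implicit Types (u : 'I_n -> int) (psi : ('I_n -> rat) -> rat).

Definition pow2 u : 'I_n -> rat := fun i => 2 ^ (u i).

Lemma pow2_pos u : pos_pt (pow2 u). Proof. by move=> i; apply: exprz_gt0. Qed.

Lemma Lau_line psi a s C : Lau psi -> pos_pt a ->
  (forall m : int, `|psi (set_at a s (2 ^ m))| <= C) ->
  forall x y, 0 < x -> 0 < y -> psi (set_at a s x) = psi (set_at a s y).
Proof.
move=> L pa H; have [N [e [P [sP LP uP EP]]]] := Lau_expansion s L.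
have E x : 0 < x -> x ^+ e * psi (set_at a s x) = (P a).[x].
  by move=> x0; have := EP _ (pos_set_at s pa x0); rewrite set_at_same uP.
have PE : P a = (P a)`_e *: 'X^e.
  apply: (@poly_two_sided _ C) => m; have x0 : (0 : rat) < 2 ^ m by apply: exprz_gt0.
  rewrite -E // normrM (ger0_norm (exprn_ge0 _ (ltW x0))) mulrC ler_wpM2r //.
  by rewrite exprn_ge0 // ltW.
have K x : 0 < x -> psi (set_at a s x) = (P a)`_e.
  move=> x0; have Ex := E x x0; rewrite PE hornerZ hornerXn mulrC in Ex.
  exact: mulIf (expf_neq0 e (lt0r_neq0 x0)) _ _ Ex.
by move=> x y x0 y0; rewrite !K.
Qed.

Lemma Lau_bounded psi C : Lau psi -> (forall u, `|psi (pow2 u)| <= C) ->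
  forall a, pos_pt a -> psi a = psi (fun=> 1).
Proof.
move=> L H.
have p0 : pow2 (fun=> 0) = fun=> 1 by apply: funext => i; rewrite /pow2 expr0z.
have upd2 u s m : set_at (pow2 u) s (2 ^ m) = pow2 (fun i => if i == s then m else u i).
  by apply: funext => i; rewrite /set_at /pow2; case: eqP.
have S1 (S : seq 'I_n) u : (forall l, l \notin S -> u l = 0) -> psi (pow2 u) = psi (fun=> 1).
  elim: S u => [|s S IH] u uS.
    by rewrite -p0; congr (psi (pow2 _)); apply: funext => l; apply: uS.
  have := @Lau_line psi (pow2 u) s C L (pow2_pos u) _ (2 ^ (u s)) (2 ^ (0 : int)) _ _.
  rewrite !upd2 => E; rewrite -(IH (fun i => if i == s then 0 else u i)).
    rewrite -E ?exprz_gt0 // => [|m]; last by rewrite upd2.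
    by congr (psi (pow2 _)); apply: funext => i; case: eqP => // ->.
  by move=> l lS; case: eqVneq => // ls; apply: uS; rewrite inE negb_or ls.
(* Coordinates are freed from powers of two one at a time: the induction hypothesis bounds the
   function on the powers of two of a line, and [Lau_line] makes it constant there. *)
have S2 (S : seq 'I_n) a : pos_pt a -> (forall l, l \notin S -> exists m : int, a l = 2 ^ m) ->
    psi a = psi (fun=> 1).
  elim: S a => [|s S IH] a pa aS.
    have [u Eu] := choice (fun l => aS l isT).
    rewrite -(S1 (enum 'I_n) u) => [|l]; last by rewrite mem_enum.
    by congr psi; apply: funext => l; rewrite Eu.
  have K m : psi (set_at a s (2 ^ m)) = psi (fun=> 1).
    apply: IH => [|l lS]; first by apply: pos_set_at => //; apply: exprz_gt0.
    rewrite /set_at; case: eqVneq => [_|ls]; first by exists m.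
    by apply: aS; rewrite inE negb_or ls.
  rewrite -(set_at_id a s) -(K 0); apply: (@Lau_line psi a s `|psi (fun=> 1)|) => //.
  by move=> m; rewrite K.
by move=> a pa; apply: (S2 (enum 'I_n)) => // l; rewrite mem_enum.
Qed.

(** Integrality of the coefficients enters here: it makes the constant ratio of two cluster
    variables a natural number. *)
Lemma Lau_at1 psi : Lau psi -> psi (fun=> 1) \is a Num.int.
Proof.
elim=> {psi} [c|i|i|f g _ If _ Ig|f g _ If _ Ig|f g fg _ If].
- exact: rpred_int.
- by rewrite rpred1.
- by rewrite invr1 rpred1.
- exact: rpredD.
- exact: rpredM.
- by rewrite -fg.
Qed.

End Bounded.

Section Growth.
Variables (n : nat) (d : 'I_n -> nat).
Implicit Types (T u : 'I_n -> int) (a : 'I_n -> rat) (e : 'I_n -> nat).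

Definition close_to C a T := forall i, a i <= C * 2 ^ (T i) /\ 2 ^ (T i) <= C * a i.

Lemma pow2_sum e T : 2 ^ (\sum_j (e j)%:Z * T j) = \prod_j (2 ^ (T j)) ^+ e j :> rat.
Proof.
rewrite (big_morph (fun m : int => (2 : rat) ^ m) (id1 := 1) (op1 := *%R)).
- by apply: eq_bigr => j _; rewrite mulrC -exprz_exp.
- by move=> x y; rewrite expfzDr.
- by rewrite expr0z.
Qed.

Lemma close_mon C a T e : 1 <= C -> pos_pt a -> close_to C a T ->
  mon e a <= C ^+ (\sum_j e j) * 2 ^ (\sum_j (e j)%:Z * T j) /\
  2 ^ (\sum_j (e j)%:Z * T j) <= C ^+ (\sum_j e j) * mon e a.
Proof.
move=> C1 pa H; have C0 : 0 <= C by apply: le_trans C1.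
rewrite pow2_sum -prodrXr -!big_split /=; split; apply: ler_prod => j _.
  rewrite exprn_ge0 ?(ltW (pa j)) //= -exprMn lerXn2r ?(H j).1 // nnegrE ?(ltW (pa j)) //.
  by rewrite mulr_ge0 // exprz_ge0.
rewrite exprn_ge0 ?exprz_ge0 //= -exprMn lerXn2r ?(H j).2 // nnegrE ?exprz_ge0 //.
by rewrite mulr_ge0 // ltW.
Qed.

Lemma pow2_max (x y : int) : 2 ^ (Num.max x y) = Num.max (2 ^ x) (2 ^ y) :> rat.
Proof.
by rewrite !maxEle ler_eXz2l //; case: ifP.
Qed.

Lemma quotient_bounds (m1 m2 x X Y t C C1 C2 : rat) : 0 < m1 -> 0 < m2 -> 0 < x -> 0 < X -> 0 < Y ->
  0 < t -> 0 < C -> 1 <= C1 -> 1 <= C2 -> m1 <= C1 * X -> X <= C1 * m1 -> m2 <= C2 * Y ->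
  Y <= C2 * m2 -> x <= C * t -> t <= C * x ->
  (m1 + m2) / x <= 2 * (C1 * C2) * C * (t^-1 * Num.max X Y) /\
  t^-1 * Num.max X Y <= 2 * (C1 * C2) * C * ((m1 + m2) / x).
Proof.
move=> m10 m20 x0 X0 Y0 t0 C0 c1 c2 a1 a2 b1 b2 k1 k2.
have inv y z : 0 < y -> 0 < z -> z <= C * y -> y^-1 <= C / z.
  by move=> y0 z0 H; rewrite -[y^-1]mul1r ler_pdivrMr // mulrAC ler_pdivlMr // mul1r.
have D1 : C1 <= C1 * C2 by rewrite ler_peMr // (le_trans ler01).
have D2 : C2 <= C1 * C2 by rewrite ler_peMl // (le_trans ler01).
have D0 : 0 < C1 * C2 by rewrite mulr_gt0 // (lt_le_trans ltr01).
have MX : X <= Num.max X Y by rewrite le_max lexx.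
have MY : Y <= Num.max X Y by rewrite le_max lexx orbT.
move: (Num.max X Y) (maxEle X Y) MX MY => M ME MX MY.
have M0 : 0 < M by apply: lt_le_trans MX.
move: D0 D1 D2; set D := C1 * C2 => D0 D1 D2.
have e1 : m1 <= D * M by apply: le_trans a1 _; apply: ler_pM => //; apply: ltW => //; apply: lt_le_trans c1.
have e2 : m2 <= D * M by apply: le_trans b1 _; apply: ler_pM => //; apply: ltW => //; apply: lt_le_trans c2.
have f1 : X <= D * m1 by apply: le_trans a2 _; rewrite ler_pM2r.
have f2 : Y <= D * m2 by apply: le_trans b2 _; rewrite ler_pM2r.
have g1 : 0 < D * m1 by rewrite mulr_gt0.
have g2 : 0 < D * m2 by rewrite mulr_gt0.
have f : M <= 2 * D * (m1 + m2) by rewrite ME; case: ifP => _; lra.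
have e : m1 + m2 <= 2 * D * M by lra.
split.
  have -> : 2 * D * C * (t^-1 * M) = 2 * D * M * (C / t) by ring.
  by apply: ler_pM; rewrite ?inv ?invr_ge0 ?(ltW x0) // ltW // addr_gt0.
have -> : 2 * D * C * ((m1 + m2) / x) = C / x * (2 * D * (m1 + m2)) by ring.
by apply: ler_pM; rewrite ?inv ?invr_ge0 ?(ltW t0) // ltW.
Qed.

(** The new constant must be independent of the point: it involves only the total exponents of the
    two monomials, and a factor 2 for replacing their sum by their maximum. *)
Lemma close_mut (U : {set 'I_n}) B (k : 'I_n) (C : rat) : k \in U -> valid d U B -> 1 <= C -> exists2 C', 1 <= C' &
  forall a T, pos_pt a -> close_to C a T -> close_to C' (mutA d k B a) (mutT d k B T).
Proof.
move=> kU vB C1; pose E1 := (\sum_j epos d B k j)%N; pose E2 := (\sum_j eneg d B k j)%N.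
have C0 : 0 < C by apply: lt_le_trans C1.
have D1 : 1 <= C ^+ E1 * C ^+ E2 by rewrite -exprD exprn_ege1.
have CC : C <= 2 * (C ^+ E1 * C ^+ E2) * C.
  move: D1; move: (C ^+ E1 * C ^+ E2) => D D1; rewrite ler_peMl ?(ltW C0) //.
  by move: D1; lra.
exists (2 * (C ^+ E1 * C ^+ E2) * C) => [|a T]; first exact: le_trans C1 CC.
move=> pa H i.
rewrite /mutA /mutT; case: eqP => [_|_]; last first.
  have [H1 H2] := H i; split.
    by apply: le_trans H1 _; rewrite ler_wpM2r // exprz_ge0.
  by apply: le_trans H2 _; rewrite ler_wpM2r // ltW.
have [p1 p2] := close_mon (epos d B k) C1 pa H.
have [q1 q2] := close_mon (eneg d B k) C1 pa H.
have [k1 k2] := H k.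
have m1 := mon_gt0 (epos d B k) pa; have m2 := mon_gt0 (eneg d B k) pa.
rewrite expfzDr // pow2_max -[2 ^ (- T k)]invr_expz.
move: p1 p2 q1 q2; rewrite -/E1 -/E2 -/(Tplus d B k T) -/(Tminus d B k T).
have X0 : (0 : rat) < 2 ^ (Tplus d B k T) by apply: exprz_gt0.
have Y0 : (0 : rat) < 2 ^ (Tminus d B k T) by apply: exprz_gt0.
have t0 : (0 : rat) < 2 ^ (T k) by apply: exprz_gt0.
have c1 : 1 <= C ^+ E1 by apply: exprn_ege1.
have c2 : 1 <= C ^+ E2 by apply: exprn_ege1.
set X := 2 ^ Tplus _ _ _ _ in X0 *; set Y := 2 ^ Tminus _ _ _ _ in Y0 *.
set t := 2 ^ T k in t0 k1 k2 *.
move=> p1 p2 q1 q2; have [s1 s2] := quotient_bounds m1 m2 (pa k) X0 Y0 t0 C0 c1 c2 p1 p2 q1 q2 k1 k2.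
by split.
Qed.

Lemma close_path (U : {set 'I_n}) B w : all (mem U) w -> valid d U B -> exists2 C, 1 <= C &
  forall u, close_to C (Apath d B w (pow2 u)) (Tpath d B w u).
Proof.
elim/last_ind: w => [|w k IH].
  by move=> _ _; exists 1 => // u i; rewrite /pow2 mul1r.
rewrite all_rcons => /andP[kU wU] vB; have [C C1 H] := IH wU vB.
have [C' C1' H'] := close_mut kU (valid_path wU vB) C1.
exists C' => // u; rewrite -cats1 Apath_cat Tpath_cat /=.
by apply: H' => //; apply: Apath_pos; apply: pow2_pos.
Qed.

End Growth.

(* The ratio of the two sides is a Laurent polynomial which is bounded on the
   powers of two, hence constant. *)
Lemma tropical_perm_cluster n (d : 'I_n -> nat) (U : {set 'I_n}) B w (p : 'I_n -> 'I_n) :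
  (forall i, (0 < d i)%N) -> all (mem U) w -> valid d U B ->
  (forall u i, Tpath d B w u i = u (p i)) ->
  forall i, exists c : nat, forall a : 'I_n -> rat, pos_pt a -> Apath d B w a i = c%:R * a (p i).
Proof.
move=> d0 wU vB H i; pose psi (a : 'I_n -> rat) : rat := Apath d B w a i / a (p i).
have L : Lau psi by apply: Lau_mul; [apply: Laurent_phenomenon vB wU|apply: Lau_inv].
have [C C1 HC] := close_path wU vB.
have b u : `|psi (pow2 u)| <= C.
  have q0 := pow2_pos u (p i); have [h _] := HC u i.
  rewrite ger0_norm; last by rewrite ltW // divr_gt0 // Apath_pos //; apply: pow2_pos.
  by rewrite ler_pdivrMr // -[pow2 u _]/(2 ^ u (p i)) -H.
have p1 : 0 < psi (fun=> 1) by rewrite divr_gt0 // Apath_pos // => j.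
have /natrP[c Ec] : psi (fun=> 1) \is a Num.nat by rewrite natrEint ltW // Lau_at1.
exists c => a pa; rewrite -Ec -(Lau_bounded L b pa) divfK //.
by rewrite gt_eqF.
Qed.

(** The constant ratio is a natural number, and so is the one along the reversed path. Their product
    is 1, so both are 1. *)
Theorem cluster_perm n (d : 'I_n -> nat) (U : {set 'I_n}) B w (p : 'S_n) :
  (forall i, (0 < d i)%N) -> all (mem U) w -> valid d U B ->
  (forall u i, Tpath d B w u i = u (p i)) ->
  forall (a : 'I_n -> rat) i, pos_pt a -> Apath d B w a i = a (p i).
Proof.
move=> d0 wU vB H a i pa.
have [c Hc] := tropical_perm_cluster d0 wU vB H i.
have vB' := valid_path wU vB; have wU' : all (mem U) (rev w) by rewrite all_rev.
have H' u j : Tpath d (Bpath d B w) (rev w) u j = u ((p^-1)%g j).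
  have := Tpath_rev u wU' vB'; rewrite (Bpath_rev wU vB) revK => E.
  by rewrite -[in RHS]E H permKV.
have [c' Hc'] := tropical_perm_cluster d0 wU' vB' H' (p i).
have pw : pos_pt (Apath d B w a) by apply: Apath_pos.
have := Hc' _ pw; rewrite (Apath_rev wU vB) // permK Hc //.
have q0 := pa (p i).
rewrite mulrA -natrM => E.
have : (c' * c)%:R = 1 :> rat.
  by apply: (mulIf (lt0r_neq0 q0)); rewrite -E mul1r.
move/eqP; rewrite pnatr_eq1 muln_eq1 => /andP[_ /eqP->].
by rewrite mul1r.
Qed.

Section ClusterChamber.
Variables (n : nat) (d : 'I_n -> nat) (U : {set 'I_n}).
Hypothesis d_gt0 : forall i, (0 < d i)%N.
Implicit Types (B : 'I_n -> 'I_n -> rat) (w : seq 'I_n) (p : 'S_n) (u T : 'I_n -> int).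

Lemma mutT_scale B k (m : nat) T :
  mutT d k B (fun i => m%:Z * T i) = fun i => m%:Z * mutT d k B T i.
Proof.
have S (e : 'I_n -> nat) : \sum_j (e j)%:Z * (m%:Z * T j) = m%:Z * \sum_j (e j)%:Z * T j.
  by rewrite mulr_sumr; apply: eq_bigr => j _; rewrite mulrCA.
apply: funext => i; rewrite /mutT; case: eqP => // _.
by rewrite /Tplus /Tminus !S mulrDr maxr_pMr // mulrN.
Qed.

Lemma Tpath_scale B w (m : nat) T :
  Tpath d B w (fun i => m%:Z * T i) = fun i => m%:Z * Tpath d B w T i.
Proof. by elim: w B T => //= k w IH B T; rewrite mutT_scale IH. Qed.

Lemma expz_bounded (z : int) (C : rat) : (forall m : nat, 2 ^ (m%:Z * z) <= C) -> z <= 0.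
Proof.
move=> H; rewrite leNgt; apply/negP => z0.
have [m Hm] := pow2_unbounded C; have := le_lt_trans (H m) Hm.
rewrite -[2 ^+ m]/(2 ^ m%:Z) ltNge ler_eXz2l // => /negP; apply.
by rewrite ler_peMr // -gtz0_ge1.
Qed.

(** Cluster variables at [pow2 u] are powers of two with tropical exponents, up to a bounded factor.
    Multiplying [u] by [m] would make any discrepancy grow exponentially in [m]. *)
Lemma cluster_perm_tropical B w (p : 'I_n -> 'I_n) : all (mem U) w -> valid d U B ->
  (forall (a : 'I_n -> rat) i, pos_pt a -> Apath d B w a i = a (p i)) ->
  forall u i, Tpath d B w u i = u (p i).
Proof.
move=> wU vB H u i; have [C C1 HC] := close_path wU vB.
have b (m : nat) : let v l := m%:Z * u l in
    2 ^ (m%:Z * (u (p i) - Tpath d B w u i)) <= C /\ 2 ^ (m%:Z * (Tpath d B w u i - u (p i))) <= C.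
  move=> v; have := HC v i; rewrite H; last exact: pow2_pos.
  rewrite /v Tpath_scale /pow2 !mulrBr !expfzDr // -!invr_expz => -[h1 h2].
  by rewrite !ler_pdivrMr ?exprz_gt0.
have := expz_bounded (fun m => (b m).1); have := expz_bounded (fun m => (b m).2).
by rewrite !subr_le0 => h1 h2; apply/eqP; rewrite eq_le h1 h2.
Qed.

Lemma Apath_frozen (K : fieldType) B w (a : 'I_n -> K) f : all (mem U) w -> f \notin U ->
  Apath d B w a f = a f.
Proof.
elim: w B a => //= k w IH B a /andP[kU wU] fU; rewrite IH // mutA_other //.
by apply: contraNneq fU => ->.
Qed.

Theorem same_chamber_cluster (R : realFieldType) B q : all (mem U) q -> valid d U B ->
  same_chamber d U R B q <->
  exists p : 'S_n, (forall (a : 'I_n -> rat) i, pos_pt a -> Apath d B q a i = a (p i)) /\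
    (forall i j, eps d (Bpath d B q) i j = eps d B (p i) (p j)).
Proof.
move=> qU vB; split=> [S|[p [H _]]].
  have [p [_ dp Bp _ Tp]] := same_chamber_perm d_gt0 qU vB S.
  by exists p; split=> [a i|i j]; [apply: cluster_perm vB Tp a i|rewrite /eps Bp dp].
have fix_off f : f \notin U -> p f = f.
  (* Only the variable [f] has value 2 at this point, and being frozen it keeps that value, which
     detects [p f]. *)
  move=> fU; pose a l : rat := if l == f then 2 else 1.
  have pa : pos_pt a by move=> l; rewrite /a; case: eqP.
  have := H a f pa; rewrite (Apath_frozen _ _ qU fU) /a eqxx.
  by case: eqP.
have pU i : i \in U -> p i \in U.
  move=> iU; apply: contraT => piU; have := fix_off _ piU => /perm_inj E.
  by rewrite E iU in piU.
exact: (@tropical_perm_chamber n d U R d_gt0 B q p qU vB pU (cluster_perm_tropical qU vB H)).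
Qed.

End ClusterChamber.

(** * Chambers in a chart *)

Section Seeds.
Variables (R : realType) (n : nat) (G : fixed_data n).
Local Notation U := (Iuf G).
Local Notation d := (dmul G).
Local Notation dir := (direction G).
Implicit Types (e : 'I_n -> 'rV[int]_n) (k : dir) (w t : seq dir) (x y z : 'rV[int]_n)
  (m : 'rV[R]_n).

Definition gramB e i j : rat := gram_form (gram G) (e i) (e j).

Lemma gram_formDl x y z : gram_form (gram G) (x + y) z = gram_form (gram G) x z + gram_form (gram G) y z.
Proof. by rewrite /gram_form map_mxD !mulmxDl mxE. Qed.

Lemma gram_formDr x y z : gram_form (gram G) z (x + y) = gram_form (gram G) z x + gram_form (gram G) z y.
Proof. by rewrite /gram_form map_mxD linearD /= mulmxDr mxE. Qed.

Lemma gram_formC x y : gram_form (gram G) x y = - gram_form (gram G) y x.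
Proof.
rewrite /gram_form; set a := map_mx _ x; set b := map_mx _ y.
have -> : (a *m gram G *m b^T) 0 0 = ((a *m gram G *m b^T)^T) 0 0 by rewrite [RHS]mxE.
by rewrite !trmx_mul trmxK gram_skew mulmxA mulmxN mulNmx [LHS]mxE.
Qed.

Lemma gram_formNl x y : gram_form (gram G) (- x) y = - gram_form (gram G) x y.
Proof. by rewrite /gram_form map_mxN !mulNmx [LHS]mxE. Qed.

Lemma gram_formNr x y : gram_form (gram G) x (- y) = - gram_form (gram G) x y.
Proof. by rewrite gram_formC gram_formNl -gram_formC. Qed.

Lemma gram_formMl x y (r : nat) : gram_form (gram G) (x *+ r) y = gram_form (gram G) x y * r%:R.
Proof.
elim: r => [|r IH]; last by rewrite mulrS gram_formDl IH mulrS; ring.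
by rewrite mulr0n mulr0 /gram_form map_mx0 !mul0mx mxE.
Qed.

Lemma gram_formMr x y (r : nat) : gram_form (gram G) x (y *+ r) = gram_form (gram G) x y * r%:R.
Proof. by rewrite gram_formC gram_formMl [gram_form _ y x]gram_formC; ring. Qed.

Lemma gramB_skew e i j : gramB e i j = - gramB e j i.
Proof. exact: gram_formC. Qed.

Lemma exchange_eps e i j : exchange_matrix G e i j = eps d (gramB e) i j.
Proof. by rewrite mxE. Qed.

Lemma gramB_mutate e k : gramB (mutate k e) = mutB d (val k) (gramB e).
Proof.
have sk : gramB e (val k) (val k) = 0 by have := gramB_skew e (val k) (val k); lra.
apply: funext => i; apply: funext => j; rewrite /gramB /mutate /mutB !exchange_eps.
case: eqP => _; have [jk|_] := eqVneq j (val k).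
- by rewrite jk gram_formNl gram_formNr opprK -/(gramB e _ _) sk oppr0.
- by rewrite gram_formNl gram_formDr gram_formMr -!/(gramB e _ _) sk mul0r addr0.
- by rewrite gram_formNr gram_formDl gram_formMl -!/(gramB e _ _) sk mul0r addr0.
rewrite gram_formDl !gram_formDr !gram_formMl !gram_formMr -!/(gramB e _ _) sk.
by ring.
Qed.

Lemma seed_at_cat s w w' : seed_at s (w ++ w') = seed_at (seed_at s w) w'.
Proof. exact: foldl_cat. Qed.

Lemma gramB_seed_at s w : gramB (seed_at s w) = Bpath d (gramB s) (map val w).
Proof.
elim/last_ind: w => // w k IH.
by rewrite map_rcons -cats1 -[rcons (map _ _) _]cats1 seed_at_cat Bpath_cat -IH /= gramB_mutate.
Qed.

Lemma all_dir w : all (mem U) (map val w).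
Proof. by elim: w => //= k w ->; rewrite (valP k). Qed.

Lemma valid_seed s : is_seed G s -> valid d U (gramB s).
Proof.
case=> [_ [uf _] [circ _]]; split=> [i j|i k kU]; first exact: gramB_skew.
have ufk : s k \in Nuf G by apply: (uf (exist _ k kU)).
have ufM (r : nat) : s k *+ r \in Nuf G.
  have [z0 zB] := Nuf_zmod G; elim: r => [|r IH]; first by rewrite mulr0n.
  rewrite mulrS -[s k *+ r]opprK; apply: (zB) => //.
  by rewrite -[- _]sub0r; apply: (zB).
rewrite /eps /gramB; split.
  by rewrite -gram_formMr; apply: form_N_NufNcirc.
by rewrite -gram_formMr; apply: form_Nuf_Ncirc.
Qed.

Lemma valid_seed_at s w : is_seed G s -> valid d U (gramB (seed_at s w)).
Proof. by move=> ss; rewrite gramB_seed_at; apply: valid_path (all_dir w) (valid_seed ss). Qed.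

Definition seed_val e m i : R := pairing (e i) m.

Lemma pairingDl x y m : pairing (x + y) m = pairing x m + pairing y m.
Proof.
by rewrite /pairing -big_split; apply: eq_bigr => j _; rewrite mxE rmorphD /= mulrDl.
Qed.

Lemma pairingNl x m : pairing (- x) m = - pairing x m.
Proof. by rewrite /pairing -sumrN; apply: eq_bigr => j _; rewrite mxE rmorphN /= mulNr. Qed.

Lemma pairingMl x m (r : nat) : pairing (x *+ r) m = r%:R * pairing x m.
Proof.
elim: r => [|r IH]; last by rewrite mulrS pairingDl IH [in RHS]mulrS; ring.
by rewrite mulr0n mul0r /pairing big1 // => j _; rewrite mxE mul0r.
Qed.

Lemma pairing_trop x y m (c : R) : 
  pairing x (m + c *: map_mx ratr (covector G y)) = pairing x m - c * ratr (gram_form (gram G) x y).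
Proof.
rewrite gram_formC rmorphN /= mulrN opprK /pairing.
have -> : gram_form (gram G) y x = \sum_j (x 0 j)%:~R * covector G y 0 j.
  by rewrite /gram_form mxE; apply: eq_bigr => j _; rewrite !mxE mulrC.
rewrite rmorph_sum mulr_sumr -big_split; apply: eq_bigr => j _ /=.
by rewrite !mxE rmorphM /= ratr_int; ring.
Qed.

Lemma seed_val_mutate e k m :
  seed_val (mutate k e) (tropical_mutation e k m) = tau d (val k) (gramB e) (seed_val e m).
Proof.
have sk : gram_form (gram G) (e (val k)) (e (val k)) = 0.
  by have := gram_formC (e (val k)) (e (val k)); lra.
apply: funext => i; rewrite /seed_val /tau /mutate /tropical_mutation pairing_trop.
case: eqP => [_|_]; first by rewrite pairingNl gram_formNl sk oppr0 rmorph0 mulr0 subr0.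
rewrite pairingDl gram_formDl !gram_formMl sk mul0r addr0 !pairingMl exchange_eps.
congr (_ + _ - _).
have -> : Num.max ((d (val k))%:R * pairing (e (val k)) m) 0 =
    (d (val k))%:R * Num.max (pairing (e (val k)) m) 0 :> R.
  by rewrite maxr_pMr ?ler0n // mulr0.
by rewrite /eps rmorphM /= ratr_nat /gramB; ring.
Qed.

Definition zspan e := forall x, exists c : 'I_n -> int, x = \sum_j c j *: e j.

Lemma zspan_mutate e k : zspan e -> zspan (mutate k e).
Proof.
move=> se x; pose P y := exists c : 'I_n -> int, y = \sum_j c j *: mutate k e j.
have PD y z : P y -> P z -> P (y + z).
  move=> [c ->] [c' ->]; exists (fun j => c j + c' j).
  by rewrite -big_split; apply: eq_bigr => j _; rewrite scalerDl.
have PZ (r : int) y : P y -> P (r *: y).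
  move=> [c ->]; exists (fun j => r * c j).
  by rewrite scaler_sumr; apply: eq_bigr => j _; rewrite scalerA.
have P0 : P 0 by exists (fun=> 0); rewrite big1 // => j _; rewrite scale0r.
have Pe j : P (mutate k e j).
  exists (fun l => (l == j)%:Z); rewrite (bigD1 j) //= eqxx scale1r big1 ?addr0 // => l /negPf ->.
  by rewrite scale0r.
have Pk : P (e (val k)).
  by have := PZ (-1) _ (Pe (val k)); rewrite /mutate eqxx scaleN1r opprK.
have Pi j : P (e j).
  have := Pe j; rewrite /mutate; case: eqP => [-> _ //|_ H].
  rewrite -[e j](addrK (e (val k) *+ pospart (exchange_matrix G e j (val k)))).
  apply: (PD) => //; rewrite -scaleN1r -scaler_nat; apply: (PZ); apply: (PZ).
  exact: Pk.
have [c ->] := se x; apply: (big_ind P) => // j _; exact: (PZ).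
Qed.

Lemma zspan_seed_at s w : is_seed G s -> zspan (seed_at s w).
Proof.
case=> [[_ sp] _ _]; elim/last_ind: w => [x|w k IH].
  by have [//|c [-> _]] := sp x; exists c.
by rewrite -cats1 seed_at_cat; apply: zspan_mutate.
Qed.

Definition seed_mx e : 'M[R]_n := \matrix_(i, j) (e j 0 i)%:~R.

Lemma seed_valE e m i : seed_val e m i = (m *m seed_mx e) 0 i.
Proof. by rewrite /seed_val /pairing mxE; apply: eq_bigr => j _; rewrite mxE mulrC. Qed.

Lemma seed_mx_unit e : zspan e -> seed_mx e \in unitmx.
Proof.
move=> se; have [c Hc] := choice (fun i => se (delta_mx 0 i)).
rewrite -unitmx_tr; apply: (proj2 (@mulmx1_unit _ _ (\matrix_(i, j) (c i j)%:~R) _ _)).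
apply/matrixP => i j; rewrite [RHS]mxE.
have -> : (i == j)%:R = ((delta_mx 0 i : 'rV[int]_n) 0 j)%:~R :> R.
  by rewrite mxE eqxx /= eq_sym; case: eqP.
rewrite (Hc i) summxE rmorph_sum mxE /=.
by apply: eq_bigr => l _; rewrite !mxE rmorphM.
Qed.

Definition trop_run s m w : ('I_n -> 'rV[int]_n) * 'rV[R]_n :=
  foldl (fun em k => (mutate k em.1, tropical_mutation em.1 k em.2)) (s, m) w.

Lemma trop_run_seed s m w : (trop_run s m w).1 = seed_at s w.
Proof.
by elim/last_ind: w => // w k IH; rewrite /trop_run foldl_rcons /= -/(trop_run s m w) IH -cats1 seed_at_cat.
Qed.

Lemma tropical_point_ex s m : exists x : tropical_point R G s, chart x [::] = m.
Proof.
have H w k : (trop_run s m (rcons w k)).2 =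
    tropical_mutation (seed_at s w) k (trop_run s m w).2.
  by rewrite {1}/trop_run foldl_rcons /= -/(trop_run s m w) trop_run_seed.
by exists (TropicalPoint H).
Qed.

Lemma seed_val_chart s (x : tropical_point R G s) w :
  seed_val (seed_at s w) (chart x w) = tpath d (gramB s) (map val w) (seed_val s (chart x [::])).
Proof.
elim/last_ind: w => // w k IH; rewrite chart_rcons map_rcons.
rewrite -[rcons (map _ _) _]cats1 tpath_cat -IH -gramB_seed_at /= -seed_val_mutate.
by rewrite -cats1 seed_at_cat.
Qed.

(** The chart of [w] is reached from the chart of [t] by going back along [t] to the initial seed
    and then along [w]. Conversely, a vector in chart [t] comes from a tropical point, as the
    coordinates in the initial chart can be prescribed. *)
Lemma chamber_in_chartE s t w : is_seed G s -> forall m,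
  chamber_in_chart s t w m <->
  nonneg U (tpath d (gramB (seed_at s t)) (rev (map val t) ++ map val w) (seed_val (seed_at s t) m)).
Proof.
move=> ss m; have vs := valid_seed ss; have tU := all_dir t.
have E (x : tropical_point R G s) :
    tpath d (gramB (seed_at s t)) (rev (map val t) ++ map val w) (seed_val (seed_at s t) (chart x t)) =
    seed_val (seed_at s w) (chart x w).
  rewrite gramB_seed_at tpath_cat (Bpath_rev tU vs) seed_val_chart (tpath_rev _ tU vs).
  by rewrite -seed_val_chart.
split.
  case=> x cx <- i iU; rewrite E; have := cx i iU; rewrite /zpow_trop oppr_le0.
  exact.
move=> H; pose v := tpath d (gramB (seed_at s t)) (rev (map val t)) (seed_val (seed_at s t) m).
have su := seed_mx_unit (zspan_seed_at [::] ss).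
have [x cx] := tropical_point_ex s ((\row_i v i) *m invmx (seed_mx s)).
have vx : seed_val s (chart x [::]) = v.
  by apply: funext => i; rewrite cx seed_valE mulmxKV // mxE.
have xm : chart x t = m.
  have : seed_val (seed_at s t) (chart x t) = seed_val (seed_at s t) m.
    rewrite seed_val_chart vx /v gramB_seed_at.
    exact: (tpath_revK _ tU vs).
  move=> /(congr1 (fun f => \row_i f i)) H2.
  apply: (can_inj (mulmxK (seed_mx_unit (zspan_seed_at t ss)))).
  apply/rowP => i; have := congr1 (fun r : 'rV[R]_n => r 0 i) H2.
  by rewrite !mxE !seed_valE !mxE.
exists x => // i iU; rewrite /zpow_trop oppr_le0.
by have := H i iU; rewrite -xm E.
Qed.

End Seeds.

Local Open Scope classical_set_scope.

(** * The fan of chambers *)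

Lemma row_free_inj (F : fieldType) p n (A : 'M[F]_(p, n)) :
  (forall v : 'rV_p, v *m A = 0 -> v = 0) -> row_free A.
Proof.
move=> H; rewrite -kermx_eq0; apply/eqP/row_matrixP => i.
by rewrite row0; apply: H; rewrite -row_mul mulmx_ker row0.
Qed.

Section Fan.
Variables (R : realType) (n : nat) (d : 'I_n -> nat) (U : {set 'I_n}).
Hypothesis d_gt0 : forall i, (0 < d i)%N.
Variable B : 'I_n -> 'I_n -> rat.
Hypothesis vB : valid d U B.
Variable M : 'M[R]_n.
Hypothesis uM : M \in unitmx.
Implicit Types (q r : seq 'I_n) (S J : {set 'I_n}) (m y v : 'rV[R]_n) (i j k : 'I_n).
Local Notation path q := (all (mem U) q).

(* The coordinates of [m] in the seed at [q]. *)
Definition coords q m : 'I_n -> R := tpath d B q (fun i => (m *m M) 0 i).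

Definition cone_face q S : set 'rV[R]_n :=
  [set m | nonneg U (coords q m) /\ forall i, i \in S -> coords q m i = 0].

Lemma coords_cat q r m : coords (q ++ r) m = tpath d (Bpath d B q) r (coords q m).
Proof. exact: tpath_cat. Qed.

Lemma coords_rel q r m : path q ->
  coords r m = tpath d (Bpath d B q) (rev q ++ r) (coords q m).
Proof. by move=> qU; rewrite tpath_cat (Bpath_rev qU vB) (tpath_rev _ qU vB). Qed.

Lemma rel_chart q r : path q -> path r -> exists C : 'I_n -> 'I_n -> int,
  (forall m, nonneg U (coords q m) ->
     forall i, coords r m i = \sum_j coords q m j * (C j i)%:~R) /\
  (forall i, i \in U -> (forall j, j \notin U -> C j i = 0) /\
     ((forall j, 0 <= C j i) \/ (forall j, C j i <= 0))).
Proof.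
move=> qU rU; have vB' := valid_path qU vB.
have pU : path (rev q ++ r) by rewrite all_cat all_rev qU.
have [C HC] := chart_matrix_ex R d_gt0 pU vB'; exists C; split.
  by move=> m m0 i; rewrite (coords_rel r m qU); case: HC => -> //.
by move=> i iU; apply: (chart_matrix_sign d_gt0 pU vB' HC iU).
Qed.

Definition chamber_param q (Lam : 'M[R]_n) :=
  [/\ Lam \in unitmx, forall m, nonneg U (coords q m) -> m = (\row_i coords q m i) *m Lam
    & forall y, nonneg U (fun i => y 0 i) -> coords q (y *m Lam) = fun i => y 0 i].

(** The transition map back from [q] is linear on its chamber, so the chamber is a linear image of
    the standard cone. *)
Lemma chamber_param_ex q : path q -> exists Lam, chamber_param q Lam.
Proof.
move=> qU; have vB' := valid_path qU vB; have rU : path (rev q) by rewrite all_rev.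
have [C [HC _ _]] := chart_matrix_ex R d_gt0 rU vB'.
pose A : 'M[R]_n := \matrix_(j, i) (C j i)%:~R.
have AE y i : (y *m A) 0 i = \sum_j y 0 j * (C j i)%:~R.
  by rewrite mxE; apply: eq_bigr => j _; rewrite mxE.
have P2 y : nonneg U (fun i => y 0 i) -> coords q (y *m (A *m invmx M)) = fun i => y 0 i.
  move=> y0; rewrite /coords mulmxA mulmxKV //.
  have -> : (fun i => (y *m A) 0 i) = tpath d (Bpath d B q) (rev q) (fun i => y 0 i).
    by apply: funext => i; rewrite AE HC.
  exact: (tpath_revK _ qU vB).
exists (A *m invmx M); split=> // [|m m0].
  rewrite -row_free_unit; apply: row_free_inj => v v0.
  (* The parametrization is known to invert [coords q] only on vectors non-negative on [U], so a
     kernel vector is split into positive and negative parts. *)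
  pose yp : 'rV[R]_n := \row_i Num.max (v 0 i) 0.
  pose yn : 'rV[R]_n := \row_i Num.max (- v 0 i) 0.
  have vE : v = yp - yn.
    apply/rowP => i; rewrite !mxE !maxEle oppr_le0.
    by case: leP => h1; case: leP => h2; lra.
  have E : yp *m (A *m invmx M) = yn *m (A *m invmx M).
    by apply/eqP; rewrite -subr_eq0 -mulmxBl -vE v0.
  have p0 : nonneg U (fun i => yp 0 i) by move=> i _; rewrite mxE le_max lexx orbT.
  have n0 : nonneg U (fun i => yn 0 i) by move=> i _; rewrite mxE le_max lexx orbT.
  have := P2 _ p0; rewrite E (P2 _ n0) => F.
  have {}F : yn = yp by apply/rowP => i; exact: (congr1 (@^~ i) F).
  by rewrite vE F subrr.
apply: (can_inj (mulmxK uM)); rewrite mulmxA mulmxKV //.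
apply/rowP => i; rewrite AE.
have := congr1 (@^~ i) (tpath_rev (fun i => (m *m M) 0 i) qU vB).
rewrite -/(coords q m) HC //= => <-.
by apply: eq_bigr => j _; rewrite mxE.
Qed.

Lemma cone_face_param q Lam S m : chamber_param q Lam ->
  cone_face q S m <-> exists y, [/\ nonneg U (fun i => y 0 i), forall i, i \in S -> y 0 i = 0
    & m = y *m Lam].
Proof.
case=> uL L1 L2; split=> [[m0 mS]|[y [y0 yS ->]]].
  exists (\row_i coords q m i); split=> [i iU|i iS|]; last exact: L1.
    by rewrite mxE; apply: m0.
  by rewrite mxE mS.
by split=> [i iU|i iS]; rewrite L2 //; [apply: y0|apply: yS].
Qed.

Lemma delta_row_nonneg j : nonneg U (fun i => (delta_mx 0 j : 'rV[R]_n) 0 i).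
Proof. by move=> i _; rewrite mxE ler0n. Qed.

Lemma delta_row_off (s : R) j : j \notin U -> nonneg U (fun i => (s *: delta_mx 0 j : 'rV[R]_n) 0 i).
Proof.
move=> jU i iU; rewrite !mxE eqxx /=; case: eqP => [ij|_]; last by rewrite mulr0.
by rewrite -ij iU in jU.
Qed.

(** In chamber coordinates the supporting form has non-negative coefficients outside [S], and zero
    ones on frozen coordinates because these range over a whole line. So it vanishes exactly where
    the coordinates it involves do. *)
Lemma face_of_cone_face q S D : path q -> S \subset U -> face_of D (cone_face q S) ->
  exists S', [/\ S \subset S', S' \subset U & D = cone_face q S'].
Proof.
move=> qU SU [u [u0 ->]]; have [Lam HL] := chamber_param_ex qU.
pose c i := (Lam *m u) i 0.
have fE y : (y *m Lam *m u) 0 0 = \sum_i y 0 i * c i by rewrite -mulmxA mxE.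
have fd (s : R) j : ((s *: delta_mx 0 j : 'rV[R]_n) *m Lam *m u) 0 0 = s * c j.
  rewrite (fE (s *: delta_mx 0 j)) (bigD1 j) //= !mxE !eqxx mulr1 big1 ?addr0 // => i /negPf ij.
  by rewrite !mxE ij andbF mulr0 mul0r.
have KE s j : j \notin S -> nonneg U (fun i => (s *: delta_mx 0 j : 'rV[R]_n) 0 i) -> 0 <= s * c j.
  move=> jS nn; rewrite -fd; apply: u0; apply/(cone_face_param _ _ HL).
  exists (s *: delta_mx 0 j); split=> // i iS; rewrite !mxE eqxx /=.
  by case: eqP => [ij|_]; rewrite ?mulr0 //; rewrite -ij iS in jS.
have c0 i : i \notin S -> 0 <= c i.
  by move=> iS; rewrite -[c i]mul1r; apply: KE => //; rewrite scale1r; apply: delta_row_nonneg.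
have cU i : i \notin U -> c i = 0.
  move=> iU; have iS : i \notin S by apply: contra iU; apply: (fintype.subsetP SU).
  apply/eqP; rewrite eq_le c0 // andbT -oppr_ge0 -mulN1r; apply: KE => //.
  exact: delta_row_off.
exists (S :|: [set i in U | c i != 0]); split.
- exact: finset.subsetUl.
- by rewrite finset.subUset SU; apply/fintype.subsetP => i; rewrite inE => /andP[].
apply/seteqP; split=> m; last first.
  move=> [m0 mS]; have mK : cone_face q S m.
    by split=> // i iS; apply: mS; rewrite inE iS.
  split=> //; have [_ L1 _] := HL; rewrite [m]L1 // fE big1 // => i _.
  rewrite mxE; have [->|ci] := eqVneq (c i) 0; first by rewrite mulr0.
  rewrite mS ?mul0r // !inE ci andbT; have [//|iU] := boolP (i \in U); first by rewrite orbT.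
  by rewrite cU ?eqxx in ci.
move=> [mK]; have [m0 mS] := mK; have [_ L1 _] := HL; rewrite [m in m *m u]L1 // fE => /eqP.
have t0 i : 0 <= (\row_i coords q m i) 0 i * c i.
  rewrite mxE; have [iS|iS] := boolP (i \in S); first by rewrite mS // mul0r.
  have [iU|iU] := boolP (i \in U); first by rewrite mulr_ge0 ?c0 //; apply: m0.
  by rewrite cU // mulr0.
rewrite psumr_eq0 // => /allP z; split=> // i; rewrite !inE => /orP[/mS //|/andP[_ ci]].
have := z i (mem_index_enum _); rewrite mxE mulf_eq0 (negPf ci) orbF => /eqP //.
Qed.

Lemma cone_face_face q S S' : path q -> S \subset S' -> S' \subset U ->
  face_of (cone_face q S') (cone_face q S).
Proof.
move=> qU SS SU; have [Lam HL] := chamber_param_ex qU; have [uL L1 L2] := HL.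
exists (invmx Lam *m \col_i (i \in S')%:R).
have fE m : cone_face q S m ->
    (m *m (invmx Lam *m \col_i (i \in S')%:R)) 0 0 = \sum_(i in S') coords q m i.
  move=> [m0 _]; rewrite [m in LHS]L1 // mulmxA mulmxK // mxE [RHS]big_mkcond.
  by apply: eq_bigr => i _; rewrite !mxE; case: ifP => _; rewrite ?mulr1 ?mulr0.
have t0 m : nonneg U (coords q m) -> forall i, i \in S' -> 0 <= coords q m i.
  by move=> m0 i iS; apply: m0; apply: (fintype.subsetP SU).
split=> [m mK|]; first by rewrite fE // sumr_ge0 // => i; apply: t0; case: mK.
apply/seteqP; split=> m.
  move=> [m0 mS]; have mK : cone_face q S m by split=> // i /(fintype.subsetP SS); apply: mS.
  by split=> //; rewrite fE // big1.
move=> [mK]; have [m0 mS] := mK; rewrite fE // => /eqP; rewrite psumr_eq0; last exact: t0.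
move=> /allP z; split=> // i iS; have := z i (mem_index_enum _); rewrite iS => /eqP //.
Qed.

Lemma signed_sum_eq0 (c : 'I_n -> int) (x : 'I_n -> R) : nonneg U x ->
  (forall j, j \notin U -> c j = 0) -> (forall j, 0 <= c j) \/ (forall j, c j <= 0) ->
  \sum_j x j * (c j)%:~R = 0 -> forall j, c j != 0 -> x j = 0.
Proof.
move=> x0 cU sc; wlog c0 : c cU {sc} / forall j, 0 <= c j => [H|] s0 j cj.
  case: sc => c0; first exact: (H c).
  apply: (H (fun j => - c j)) => [i /cU ->|i||]; rewrite ?oppr0 ?oppr_ge0 ?oppr_eq0 //.
  under eq_bigr do rewrite rmorphN /= mulrN.
  by rewrite sumrN s0 oppr0.
have t0 i : 0 <= x i * (c i)%:~R.
  have [iU|/cU ->] := boolP (i \in U); last by rewrite mulr0.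
  by rewrite mulr_ge0 ?ler0z // x0.
move/eqP: s0; rewrite psumr_eq0 // => /allP z.
have := z j (mem_index_enum _); rewrite mulf_eq0 intr_eq0 (negPf cj) orbF => /eqP //.
Qed.

(** On the first chamber each unfrozen coordinate of the second is a combination with coefficients
    of one sign. A non-positive combination that must be non-negative has only zero terms, so the
    second cone merely imposes vanishing conditions. *)
Lemma cone_face_inter q S q' S' : path q -> path q' -> S \subset U -> S' \subset U ->
  exists J, [/\ S \subset J, J \subset U & cone_face q S `&` cone_face q' S' = cone_face q J].
Proof.
move=> qU qU' SU SU'; have [C [HC sC]] := rel_chart qU qU'.
pose J := S :|: [set j in U | [exists i in U, C j i < 0] || [exists i in S', C j i != 0]].
exists J; split.
- exact: finset.subsetUl.
- by rewrite finset.subUset SU; apply/fintype.subsetP => j; rewrite inE => /andP[].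
apply/seteqP; split=> m.
  move=> [[m0 mS] [m0' mS']]; split=> // j; rewrite !inE => /orP[/mS //|/andP[jU]].
  case/orP=> /existsP[i /andP[iU Cji]].
    have [cU sc] := sC i iU.
    have c0 l : C l i <= 0.
      by case: sc => // /(_ j); rewrite leNgt Cji.
    apply: (@signed_sum_eq0 (fun j => C j i) _ m0 cU sc); last by rewrite lt_eqF.
    apply/eqP; rewrite eq_le -{2}HC // (m0' i iU) andbT.
    exact: (col_le0 m0 cU c0).
  have [cU sc] := sC i (fintype.subsetP SU' _ iU).
  by apply: (@signed_sum_eq0 (fun j => C j i) _ m0 cU sc) => //; rewrite -HC // mS'.
move=> [m0 mJ]; split; first by split=> // i iS; apply: mJ; rewrite inE iS.
split=> [i iU|i iS].
  rewrite HC // sumr_ge0 // => j _; have [cU _] := sC i iU.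
  have [jU|/cU ->] := boolP (j \in U); last by rewrite mulr0.
  have [Cji|Cji] := leP 0 (C j i); first by rewrite mulr_ge0 ?ler0z // m0.
  rewrite mJ ?mul0r // !inE jU /=; apply/orP; right; apply/orP; left.
  by apply/existsP; exists i; rewrite iU.
rewrite HC // big1 // => j _; have iU := fintype.subsetP SU' _ iS; have [cU _] := sC i iU.
have [jU|/cU ->] := boolP (j \in U); last by rewrite mulr0.
have [->|Cji] := eqVneq (C j i) 0; first by rewrite mulr0.
rewrite mJ ?mul0r // !inE jU /=; apply/orP; right; apply/orP; right.
by apply/existsP; exists i; rewrite iS.
Qed.

End Fan.

Section ConeDim.
Variables (R : realType) (n : nat).
Implicit Types (C : set 'rV[R]_n).

Lemma cone_dim_unique C p q : cone_dim C p -> cone_dim C q -> p = q.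
Proof.
have le p' q' : cone_dim C p' -> cone_dim C q' -> (p' <= q')%N.
  move=> [b [fb Cb _]] [b' [fb' _ sb']].
  rewrite -(eqP fb) -(eqP fb'); apply: mxrankS; apply/row_subP => i.
  exact: sb'.
by move=> H H'; apply/eqP; rewrite eqn_leq !le.
Qed.

Definition spread (A : {set 'I_n}) (a : 'rV[R]_#|A|) : 'rV[R]_n :=
  a *m rowsub (@enum_val _ (mem A)) 1%:M.

Lemma spread_in (A : {set 'I_n}) (a : 'rV[R]_#|A|) (k : 'I_#|A|) : spread a 0 (enum_val k) = a 0 k.
Proof.
rewrite mxE (bigD1 k) //= !mxE eqxx mulr1 big1 ?addr0 // => l lk.
by rewrite !mxE (inj_eq enum_val_inj) (negPf lk) mulr0.
Qed.

Lemma spread_out (A : {set 'I_n}) (a : 'rV[R]_#|A|) i : i \notin A -> spread a 0 i = 0.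
Proof.
move=> iA; rewrite mxE big1 // => l _; rewrite !mxE.
by case: eqP => [E|_]; rewrite ?mulr0 //; rewrite -E enum_valP in iA.
Qed.

Lemma spreadE (A : {set 'I_n}) (y : 'rV[R]_n) : (forall i, i \notin A -> y 0 i = 0) ->
  y = spread (\row_k y 0 (enum_val k : 'I_n) : 'rV_#|A|).
Proof.
move=> yA; apply/rowP => i; have [iA|iA] := boolP (i \in A); last by rewrite spread_out ?yA.
by rewrite -(enum_rankK_in iA iA) spread_in mxE.
Qed.

Lemma spread_mul (A : {set 'I_n}) (a : 'rV[R]_#|A|) (Lam : 'M[R]_n) :
  a *m rowsub (@enum_val _ (mem A)) Lam = spread a *m Lam.
Proof. by rewrite rowsubE mulmxA. Qed.

End ConeDim.

Section Fan.
Variables (R : realType) (n : nat) (d : 'I_n -> nat) (U : {set 'I_n}).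
Hypothesis d_gt0 : forall i, (0 < d i)%N.
Variable B : 'I_n -> 'I_n -> rat.
Hypothesis vB : valid d U B.
Variable M : 'M[R]_n.
Hypothesis uM : M \in unitmx.
Implicit Types (q r : seq 'I_n) (S J : {set 'I_n}) (m y v : 'rV[R]_n) (i j k : 'I_n).
Local Notation path q := (all (mem U) q).
Local Notation coords := (coords d B M).
Local Notation K := (cone_face d U B M).
Local Notation cone q := (K q finset.set0).

Lemma cone_face_polyhedral q S : path q -> polyhedral_cone (K q S).
Proof.
move=> qU; have [Lam HL] := chamber_param_ex d_gt0 vB uM qU.
pose g1 : 'M[R]_n := \matrix_(i, j) (if i \in S then 0 else Lam i j).
(* Frozen coordinates are unconstrained: the negated generators produce the lineality space. *)
pose g2 : 'M[R]_n := \matrix_(i, j) (if (i \in U) || (i \in S) then 0 else - Lam i j).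
have gE (a b : 'rV[R]_n) : row_mx a b *m col_mx g1 g2 =
    (\row_i (if i \in S then 0 else a 0 i - (if i \in U then 0 else b 0 i))) *m Lam.
  rewrite mul_row_col; apply/rowP => j; rewrite !mxE -big_split; apply: eq_bigr => i _ /=.
  by rewrite !mxE; case: (i \in S); case: (i \in U); rewrite ?orbT ?orbF //=; ring.
exists (n + n)%N, (col_mx g1 g2); apply/seteqP; split=> m.
  move/(cone_face_param _ _ HL) => [y [y0 yS ->]].
  exists (row_mx (\row_i Num.max (y 0 i) 0) (\row_i Num.max (- y 0 i) 0)); split.
    move=> j; rewrite mxE; case: fintype.split => i; rewrite mxE le_max lexx orbT //.
  rewrite gE; congr (_ *m _); apply/rowP => i; rewrite !mxE.
  case: ifP => [/yS //|_]; case: ifP => [iU|_]; first by rewrite subr0 max_l // y0.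
  by rewrite !maxEle oppr_le0; case: leP => h1; case: leP => h2; lra.
move=> [a [a0 ->]]; rewrite -(hsubmxK a) gE; apply/(cone_face_param _ _ HL).
set y := \row_i _; exists y; split=> // i; rewrite mxE; last by move=> ->.
by move=> iU; case: ifP => // _; rewrite iU subr0 mxE a0.
Qed.

Lemma cone_face_simplicial q S : path q -> S \subset U -> simplicial_cone (K q S).
Proof.
move=> qU SU; have [Lam HL] := chamber_param_ex d_gt0 vB uM qU; have [uL _ _] := HL.
pose A := U :\: S.
have AU i : i \in A -> i \notin ~: U by rewrite !inE negbK => /andP[].
exists #|A|, #|~: U|, (rowsub (@enum_val _ (mem A)) Lam), (rowsub (@enum_val _ (mem (~: U))) Lam).
split.
  apply: row_free_inj => v; rewrite -(hsubmxK v) mul_row_col !spread_mul -mulmxDl.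
  move/(congr1 (mulmxr (invmx Lam))); rewrite /= mulmxK // mul0mx => E.
  have Ei i : spread (lsubmx v) 0 i + spread (rsubmx v) 0 i = 0.
    by have := congr1 (fun y : 'rV[R]_n => y 0 i) E; rewrite !mxE.
  have -> : lsubmx v = 0.
    apply/rowP => k; have := Ei (enum_val k); rewrite spread_in [X in _ + X]spread_out.
      by rewrite addr0 => ->; rewrite mxE.
    by apply: AU; apply: enum_valP.
  have -> : rsubmx v = 0.
    apply/rowP => k; have := Ei (enum_val k); rewrite spread_in [X in X + _]spread_out.
      by rewrite add0r => ->; rewrite mxE.
    by apply/negP => /AU; rewrite enum_valP.
  by rewrite row_mx0.
apply/seteqP; split=> m.
  move/(cone_face_param _ _ HL) => [y [y0 yS ->]].
  exists (\row_k y 0 (enum_val k)), (\row_k y 0 (enum_val k)); split.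
    by move=> j; rewrite mxE y0 //; have := enum_valP j; rewrite inE => /andP[].
  rewrite !spread_mul -mulmxDl; congr (_ *m _); apply/rowP => i; rewrite [RHS]mxE.
  have [iU|iU] := boolP (i \in U).
    rewrite [X in _ + X]spread_out ?inE ?iU // addr0.
    have [iS|iS] := boolP (i \in S); first by rewrite spread_out ?inE ?iS // yS.
    have iA : i \in A by rewrite inE iS.
    by rewrite -(enum_rankK_in iA iA) spread_in mxE.
  have iA : i \in ~: U by rewrite inE.
  rewrite spread_out ?inE ?(negPf iU) ?andbF // add0r.
  by rewrite -(enum_rankK_in iA iA) spread_in mxE.
move=> [a [b [a0 ->]]]; rewrite !spread_mul -mulmxDl; apply/(cone_face_param _ _ HL).
exists (spread a + spread b); split=> // i iX; rewrite mxE.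
  rewrite [X in _ + X]spread_out ?inE ?iX // addr0.
  have [iA|iA] := boolP (i \in A); last by rewrite spread_out.
  by rewrite -(enum_rankK_in iA iA) spread_in.
by rewrite !spread_out ?addr0 // !inE ?iX ?(fintype.subsetP SU).
Qed.

Lemma cone_face_dim q S : path q -> S \subset U -> cone_dim (K q S) #|~: S|.
Proof.
move=> qU SU; have [Lam HL] := chamber_param_ex d_gt0 vB uM qU; have [uL _ _] := HL.
exists (rowsub (@enum_val _ (mem (~: S))) Lam); split.
- apply: row_free_inj => v; rewrite spread_mul => /(congr1 (mulmxr (invmx Lam))).
  rewrite /= mulmxK // mul0mx => E; apply/rowP => k.
  by rewrite -spread_in E !mxE.
- move=> k; apply/(cone_face_param _ _ HL); exists (delta_mx 0 (enum_val k)); split.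
  + exact: delta_row_nonneg.
  + move=> i iS; rewrite mxE eqxx /=; case: eqP => // E; have := enum_valP k.
    by rewrite -E inE iS.
  + by rewrite row_rowsub rowE.
move=> m /(cone_face_param _ _ HL) [y [y0 yS ->]].
rewrite (@spreadE _ _ (~: S) y) => [|i]; last by rewrite inE negbK => /yS.
by rewrite -spread_mul submxMl.
Qed.

Definition cluster_fan : set (set 'rV[R]_n) :=
  [set D | exists q S, [/\ path q, S \subset U & D = K q S]].

Theorem cluster_fan_simplicial : simplicial_fan cluster_fan.
Proof.
split; last by move=> _ [q [S [qU SU ->]]]; apply: cone_face_simplicial.
split.
- by move=> _ [q [S [qU SU ->]]]; apply: cone_face_polyhedral.
- move=> _ D [q [S [qU SU ->]]] /(face_of_cone_face d_gt0 vB uM qU SU) [S' [_ S'U ->]].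
  by exists q, S'.
move=> _ _ [q [S [qU SU ->]]] [q' [S' [qU' SU' ->]]]; split.
  have [J [SJ JU ->]] := cone_face_inter d_gt0 vB M qU qU' SU SU'.
  exact: (cone_face_face d_gt0 vB uM qU SJ JU).
rewrite setIC; have [J [SJ JU ->]] := cone_face_inter d_gt0 vB M qU' qU SU' SU.
exact: (cone_face_face d_gt0 vB uM qU' SJ JU).
Qed.

Lemma interior_point q S : path q -> S \subset U -> exists m,
  [/\ K q S m, forall i, i \in U -> i \notin S -> 0 < coords q m i & forall i, i \in S -> coords q m i = 0].
Proof.
move=> qU SU; have [Lam HL] := chamber_param_ex d_gt0 vB uM qU; have [uL _ L2] := HL.
pose y : 'rV[R]_n := \row_i (i \notin S)%:R.
have y0 : nonneg U (fun i => y 0 i) by move=> i _; rewrite mxE ler0n.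
exists (y *m Lam); split.
- by apply/(cone_face_param _ _ HL); exists y; split=> // i iS; rewrite mxE iS.
- by move=> i iU iS; rewrite L2 // mxE iS.
- by move=> i iS; rewrite L2 // mxE iS.
Qed.

Lemma cone_face_sub q S S' : S \subset S' -> K q S' `<=` K q S.
Proof. by move=> SS m [m0 mS]; split=> // i /(fintype.subsetP SS); apply: mS. Qed.

(** An interior point of [cone q] has no vanishing unfrozen coordinate in the seed at [q'], so it
    lies on no proper face of [cone q']. *)
Lemma cone_maximal q q' S' : path q -> path q' -> S' \subset U -> cone q `<=` K q' S' ->
  K q' S' = cone q.
Proof.
move=> qU qU' SU' H; have s0U : finset.set0 \subset U by apply: finset.sub0set.
have [m [mK mp _]] := interior_point qU s0U.
have mpos : positive U (coords q m) by move=> i iU; apply: mp; rewrite ?inE.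
have vq := valid_path qU vB.
have pU : path (rev q ++ q') by rewrite all_cat all_rev qU.
have nz i : i \in U -> coords q' m i != 0.
  by move=> iU; rewrite (coords_rel vB M q' m qU); apply: (tpath_neq0_U d_gt0 pU vq mpos iU).
have [m'0 m'S] := H _ mK.
have S0 : S' = finset.set0.
  apply/setP => i; rewrite inE; apply/negP => iS.
  by have := nz i (fintype.subsetP SU' _ iS); rewrite m'S ?eqxx.
subst S'; apply/seteqP; split=> //.
have [J [_ JU EJ]] := cone_face_inter d_gt0 vB M qU' qU s0U s0U.
have J0 : J = finset.set0.
  apply/setP => i; rewrite inE; apply/negP => iJ.
  have [_ mJ] : K q' J m by rewrite -EJ; split=> //; exact: H.
  by have := nz i (fintype.subsetP JU _ iJ); rewrite mJ ?eqxx.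
move=> p pK; have : K q' J p by rewrite J0.
by rewrite -EJ => -[].
Qed.

Theorem cluster_fan_maximal : maximal_cones cluster_fan = [set cone q | q in [set q | path q]].
Proof.
have s0U : finset.set0 \subset U by apply: finset.sub0set.
apply/seteqP; split=> C.
  move=> [[q [S [qU SU ->]]] maxC]; exists q => //; apply: maxC.
    by exists q, finset.set0.
  exact/cone_face_sub/finset.sub0set.
move=> [q qU <-]; split; first by exists q, finset.set0.
by move=> _ [q' [S' [qU' SU' ->]]]; apply: cone_maximal.
Qed.

Section Walls.

Lemma wall_eq q k : path q -> k \in U -> K q [set k]%SET = K (rcons q k) [set k]%SET.
Proof.
move=> qU kU; have vq := valid_path qU vB.
have E m : coords (rcons q k) m = tau d k (Bpath d B q) (coords q m).
  by rewrite -cats1 coords_cat.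
have F m : coords q m k = 0 -> coords (rcons q k) m = coords q m.
  move=> mk; rewrite E (tau_le0 kU vq) ?mk //; apply: funext => i.
  by case: eqP => [->|_]; rewrite ?mulr0 ?addr0 ?mk ?oppr0.
have kE m : coords (rcons q k) m k = - coords q m k by rewrite E /tau eqxx.
apply/seteqP; split=> m [m0 mk].
  have z : coords q m k = 0 by apply: mk; rewrite inE.
  by rewrite /cone_face /= F.
have z : coords q m k = 0.
  by have := mk k; rewrite kE inE eqxx => /(_ isT) /eqP; rewrite oppr_eq0 => /eqP.
by rewrite F // in m0 mk.
Qed.

Lemma crossed_neq q k : path q -> k \in U -> cone q <> cone (rcons q k).
Proof.
move=> qU kU E; have s0U : finset.set0 \subset U by apply: finset.sub0set.
have [m [mK mp _]] := interior_point qU s0U.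
rewrite E in mK; have [m0 _] := mK; have := m0 k kU.
rewrite -cats1 coords_cat /= /tau eqxx oppr_ge0 leNgt mp ?inE //.
Qed.

(** Some coordinate [i] at [q] has a negative coefficient at [k'], else [cone q'] would lie in
    [cone q]; by sign coherence it is non-positive on [cone q']. At an interior point of the common
    wall all unfrozen coordinates at [q] except [k] are positive, hence [i = k]. *)
Lemma wall_sign q q' k k' m : path q -> path q' -> k \in U -> k' \in U ->
  K q' [set k']%SET = K q [set k]%SET -> ~ (cone q' `<=` cone q) ->
  positive U (coords q' m) -> coords q m k < 0.
Proof.
move=> qU qU' kU kU' EK nsub mp.
have [C [HC sC]] := rel_chart d_gt0 vB M qU' qU.
have onwall p j : K q' [set k']%SET p -> nonneg U (coords q' p) /\ coords q p k = 0.
  move=> pK; split; first by case: pK.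
  by move: pK; rewrite EK => -[_]; apply; rewrite inE.
have kk' : [set k']%SET \subset U by rewrite finset.sub1set.
have [p [pK pp p0]] := interior_point qU' kk'.
have pK' : K q [set k]%SET p by rewrite -EK.
have [p1 _] := pK; have [p2 p3] := pK'.
have kk : [set k]%SET \subset U by rewrite finset.sub1set.
have [z [zK zp _]] := interior_point qU kk.
have [z1 z0] : K q' [set k']%SET z by rewrite EK.
have z0' : coords q' z k' = 0 by apply: z0; rewrite inE.
have [i [iU Ci]] : exists i, i \in U /\ C k' i < 0.
  apply: contrapT => N; apply: nsub => x [x0 _]; split; last by move=> i; rewrite inE.
  move=> i iU; have [cU sc] := sC i iU.
  rewrite HC //; apply: (col_ge0 (U := U)) => //; case: sc => // c0.
  have Ck : C k' i = 0.
    by apply/eqP; rewrite eq_le c0 leNgt; apply/negP => Ck; apply: N; exists i.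
  have cz : \sum_j coords q' p j * (C j i)%:~R = 0.
    by apply/eqP; rewrite eq_le -{2}HC // (p2 i iU) andbT; exact: (col_le0 p1 cU c0).
  move=> j; have [->//|Cj] := eqVneq (C j i) 0.
  have jU : j \in U by apply: contraT => /cU E; rewrite E eqxx in Cj.
  have jk : j != k' by apply: contraNneq Cj => ->; rewrite Ck.
  have := pp j jU; rewrite inE jk (signed_sum_eq0 p1 cU (or_intror c0) cz Cj) ltxx.
  by move=> /(_ isT).
have [cU sc] := sC i iU.
have c0 j : C j i <= 0 by case: sc => // /(_ k'); rewrite leNgt Ci.
have ik : i = k.
  apply/eqP; apply: contraT => ik; have := zp i iU; rewrite inE ik => /(_ isT).
  by rewrite HC // ltNge (col_le0 z1 cU c0).
have m0 := positive_nonneg mp.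
rewrite -ik HC // lt_neqAle (col_le0 m0 cU c0) andbT; apply/eqP => /(signed_sum_eq0 m0 cU (or_intror c0)).
move/(_ k'); rewrite lt_eqF // => /(_ isT) E; have := mp k' kU'.
by rewrite E ltxx.
Qed.

(** Otherwise the interior of [cone q'] would be on the negative side of the wall both for [q] and
    for the mutated seed, whose coordinates at [k] are opposite. *)
Lemma wall_crossing q q' k k' : path q -> path q' -> k \in U -> k' \in U ->
  K q' [set k']%SET = K q [set k]%SET -> cone q <> cone q' -> cone q' = cone (rcons q k).
Proof.
move=> qU qU' kU kU' EK ne; have s0U : finset.set0 \subset U by apply: finset.sub0set.
have rU : path (rcons q k) by rewrite all_rcons qU andbT.
have [m [_ mp _]] := interior_point qU' s0U.
have mpos : positive U (coords q' m) by move=> i iU; apply: mp; rewrite ?inE.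
have n1 : ~ (cone q' `<=` cone q).
  by move=> H; apply: ne; apply: (cone_maximal qU' qU s0U H).
have lt := wall_sign qU qU' kU kU' EK n1 mpos.
have [H|n2] := pselect (cone q' `<=` cone (rcons q k)).
  by rewrite (cone_maximal qU' rU s0U H).
rewrite (wall_eq qU kU) in EK.
have := wall_sign rU qU' kU kU' EK n2 mpos.
rewrite -cats1 coords_cat /= /tau eqxx oppr_lt0 => lt'.
by have := lt_trans lt lt'; rewrite ltxx.
Qed.

Lemma codim1_wall q E : path q -> codim1_face_of E (cone q) ->
  exists2 k, k \in U & E = K q [set k]%SET.
Proof.
move=> qU [fE [p [dE dC]]]; have s0U : finset.set0 \subset U by apply: finset.sub0set.
have [S [_ SU ES]] := face_of_cone_face d_gt0 vB uM qU s0U fE.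
rewrite ES in dE; have p1 := cone_dim_unique dE (cone_face_dim qU SU).
have p2 := cone_dim_unique dC (cone_face_dim qU s0U).
have /cards1P[k Sk] : #|S| == 1%N.
  have := cardsC S; have := cardsC (finset.set0 : {set 'I_n}); rewrite cards0 add0n => c1 c2.
  by rewrite -(eqn_add2r #|~: S|) c2 -c1 -p2 p1.
exists k; first by apply: (fintype.subsetP SU); rewrite Sk inE.
by rewrite ES Sk.
Qed.

Lemma wall_codim1 q k : path q -> k \in U -> codim1_face_of (K q [set k]%SET) (cone q).
Proof.
move=> qU kU; have kk : [set k]%SET \subset U by rewrite finset.sub1set.
have s0U : finset.set0 \subset U by apply: finset.sub0set.
split; first exact: (cone_face_face d_gt0 vB uM qU (finset.sub0set _) kk).
exists #|~: [set k]%SET|; split; first exact: cone_face_dim.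
suff -> : (#|~: [set k]%SET|).+1 = #|~: (finset.set0 : {set 'I_n})| by apply: cone_face_dim.
have := cardsC (finset.set0 : {set 'I_n}); have := cardsC [set k]%SET.
by rewrite cards0 cards1 => <-; rewrite add0n.
Qed.

Theorem cluster_fan_adjacent q q' : path q -> path q' ->
  adjacent (dual_graph cluster_fan) (cone q) (cone q') <->
  exists2 k, k \in U & cone q' = cone (rcons q k).
Proof.
move=> qU qU'; split=> /=.
  move=> [ne [E [E1 E2]]]; have [k kU Ek] := codim1_wall qU E1.
  have [k' kU' Ek'] := codim1_wall qU' E2.
  by exists k => //; apply: (wall_crossing qU qU' kU kU') => //; rewrite -Ek -Ek'.
move=> [k kU ->]; have rU : path (rcons q k) by rewrite all_rcons qU andbT.
split; first exact: crossed_neq.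
exists (K q [set k]%SET); split; first exact: wall_codim1.
by rewrite wall_eq //; apply: wall_codim1.
Qed.

End Walls.
End Fan.

(** * The exchange graph *)

Section RationalFunctions.
Variable n : nat.
Local Notation mp := {mpoly rat[n]}.
Implicit Types (p q : mp) (a : 'I_n -> rat) (f g : ratfun n) (phi psi : ('I_n -> rat) -> rat).

(** Substitution of polynomials for the variables, so that positive constants can be replaced by the
    variables themselves one at a time. *)
Definition eval_at p (h : 'I_n -> mp) : mp :=
  \sum_(m <- msupp p) (p@_m)%:MP * \prod_i h i ^+ m i.

Lemma eval_at_line p (h : 'I_n -> mp) s :
  (forall c : rat, 0 < c -> eval_at p (fun i => if i == s then c%:MP else h i) = 0) ->
  eval_at p h = 0.
Proof.
move=> H.
pose Q : {poly mp} := \sum_(m <- msupp p) ((p@_m)%:MP)%:P *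
  \prod_i (if i == s then 'X else (h i)%:P) ^+ m i.
have QE (y : mp) : Q.[y] = eval_at p (fun i => if i == s then y else h i).
  rewrite horner_sum; apply: eq_bigr => m _; rewrite hornerM hornerC horner_prod; congr (_ * _).
  by apply: eq_bigr => i _; rewrite horner_exp; case: eqP => _; rewrite ?hornerX ?hornerC.
have Q0 : Q = 0.
  apply/eqP; apply: contraT => Qn.
  pose r := [seq ((m.+1)%:R : rat)%:MP : mp | m <- iota 0 (size Q)].
  have := @max_poly_roots _ Q r Qn; rewrite size_map size_iota ltnn => -> //.
    by apply/allP => x /mapP[m _ ->]; rewrite rootE QE H // ltr0Sn.
  rewrite map_inj_uniq ?iota_uniq // => x y /eqP; rewrite mpolyC_eq.
  by rewrite eqr_nat eqSS => /eqP.
have := QE (h s); rewrite Q0 horner0 => ->; apply: eq_bigr => m _; congr (_ * _).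
by apply: eq_bigr => i _; case: eqP => [->|].
Qed.

Lemma mpoly_pos_eq0 p : (forall a, pos_pt a -> p.@[a] = 0) -> p = 0.
Proof.
move=> p0.
have H (S : seq 'I_n) (h : 'I_n -> mp) : (forall i, i \notin S -> exists2 c : rat, 0 < c & h i = c%:MP) ->
    eval_at p h = 0.
  elim: S h => [|s S IH] h hS.
    have hc i : exists c : rat, 0 < c /\ h i = c%:MP by have [//|c] := hS i; exists c.
    have [a Ha] := choice hc.
    have -> : eval_at p h = (p.@[a])%:MP.
      rewrite mevalE rmorph_sum; apply: eq_bigr => m _ /=.
      rewrite rmorphM rmorph_prod; congr (_ * _); apply: eq_bigr => i _ /=.
      by rewrite (Ha i).2 rmorphXn.
    by rewrite p0 ?mpolyC0 // => i; case: (Ha i).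
  apply: (eval_at_line (s := s)) => c c0; apply: IH => i iS.
  by case: eqVneq => [_|is_]; [exists c|apply: hS; rewrite inE negb_or is_].
have <- : eval_at p (fun i => 'X_i) = p.
  rewrite {2}[p]mpolyE; apply: eq_bigr => m _; rewrite -mul_mpolyC; congr (_ * _).
  by rewrite [RHS]mpolyXE_id.
by apply: (H (enum 'I_n)) => i; rewrite mem_enum.
Qed.

(** Fractions with numerator and denominator positive on the positive orthant are stable under
    subtraction-free operations and determined by their values there. Identities in the function
    field are thereby checked on positive rational points. *)
Definition takes f phi := exists p q : mp, f = tofrac p / tofrac q /\
  forall a, pos_pt a -> [/\ 0 < p.@[a], 0 < q.@[a] & phi a = p.@[a] / q.@[a]].

Lemma tofrac_pos_neq0 p : (forall a, pos_pt a -> 0 < p.@[a]) -> tofrac p != 0 :> ratfun n.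
Proof.
move=> H; rewrite tofrac_eq0; apply/eqP => p0.
by have := H (fun=> 1) (fun=> ltr01); rewrite p0 meval0 ltxx.
Qed.

Lemma takes_ext f phi psi : (forall a, phi a = psi a) -> takes f phi -> takes f psi.
Proof. by move=> /funext ->. Qed.

Lemma takes_var i : takes (tofrac 'X_i) (fun a => a i).
Proof.
exists 'X_i, 1; split=> [|a pa]; first by rewrite rmorph1 divr1.
by rewrite mevalXU meval1 divr1 ltr01.
Qed.

Lemma takes1 : takes 1 (fun=> 1).
Proof.
exists 1, 1; split=> [|a pa]; first by rewrite rmorph1 divr1.
by rewrite meval1 divr1 ltr01.
Qed.

Lemma takes_add f g phi psi : takes f phi -> takes g psi -> takes (f + g) (fun a => phi a + psi a).
Proof.
move=> [p [q [-> H]]] [p' [q' [-> H']]].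
have q0 : tofrac q != 0 :> ratfun n by apply: tofrac_pos_neq0 => a /H[].
have q0' : tofrac q' != 0 :> ratfun n by apply: tofrac_pos_neq0 => a /H'[].
exists (p * q' + p' * q), (q * q'); split=> [|a pa].
  by rewrite rmorphD !rmorphM /= addf_div // mulrC.
have [h1 h2 ->] := H a pa; have [h1' h2' ->] := H' a pa.
by rewrite mevalD !mevalM addf_div ?gt_eqF // addr_gt0 ?mulr_gt0.
Qed.

Lemma takes_mul f g phi psi : takes f phi -> takes g psi -> takes (f * g) (fun a => phi a * psi a).
Proof.
move=> [p [q [-> H]]] [p' [q' [-> H']]].
exists (p * p'), (q * q'); split=> [|a pa]; first by rewrite !rmorphM /= mulf_div.
have [h1 h2 ->] := H a pa; have [h1' h2' ->] := H' a pa.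
by rewrite !mevalM mulf_div !mulr_gt0.
Qed.

Lemma takes_inv f phi : takes f phi -> takes f^-1 (fun a => (phi a)^-1).
Proof.
move=> [p [q [-> H]]]; exists q, p; split=> [|a pa]; first by rewrite invf_div.
by have [h1 h2 ->] := H a pa; rewrite invf_div.
Qed.

Lemma takes_mon e (A : 'I_n -> ratfun n) (F : ('I_n -> rat) -> 'I_n -> rat) :
  (forall i, takes (A i) (fun a => F a i)) -> takes (mon e A) (fun a => mon e (F a)).
Proof.
move=> H; rewrite /mon; elim: (index_enum _) => [|i r IH].
  by rewrite big_nil; apply: takes_ext takes1 => a; rewrite big_nil.
rewrite big_cons.
apply: (@takes_ext _ (fun a => F a i ^+ e i * \prod_(j <- r) F a j ^+ e j)) => [a|].
  by rewrite big_cons.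
apply: takes_mul IH; elim: (e i) => [|m IHm]; first exact: takes1.
rewrite exprS; apply: (@takes_ext _ (fun a => F a i * F a i ^+ m)) => [a|]; first by rewrite exprS.
exact: takes_mul.
Qed.

Lemma takes_eq f g phi psi : takes f phi -> takes g psi ->
  f = g <-> forall a, pos_pt a -> phi a = psi a.
Proof.
move=> [p [q [-> H]]] [p' [q' [-> H']]].
have q0 : tofrac q != 0 :> ratfun n by apply: tofrac_pos_neq0 => a /H[].
have q0' : tofrac q' != 0 :> ratfun n by apply: tofrac_pos_neq0 => a /H'[].
split=> [/eqP|E].
  rewrite eqr_div // -!rmorphM /= tofrac_eq => /eqP E a pa.
  have [h1 h2 ->] := H a pa; have [h1' h2' ->] := H' a pa.
  have := congr1 (meval a) E; rewrite !mevalM => E'.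
  by apply/eqP; rewrite eqr_div ?lt0r_neq0 //; apply/eqP.
apply/eqP; rewrite eqr_div // -!rmorphM /= tofrac_eq -subr_eq0; apply/eqP/mpoly_pos_eq0 => a pa.
have := E a pa; have [h1 h2 ->] := H a pa; have [h1' h2' ->] := H' a pa.
move/eqP; rewrite eqr_div ?lt0r_neq0 // => /eqP E'.
by rewrite mevalB !mevalM E' subrr.
Qed.

Lemma takes_Apath (d : 'I_n -> nat) B w (A : 'I_n -> ratfun n) F :
  (forall i, takes (A i) (fun a => F a i)) ->
  forall i, takes (Apath d B w A i) (fun a => Apath d B w (F a) i).
Proof.
elim: w B A F => //= k w IH B A F H; apply: IH => i; rewrite /mutA.
case: eqP => // _; apply: takes_mul; last exact: takes_inv.
by apply: takes_add; apply: takes_mon.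
Qed.

End RationalFunctions.

Lemma cluster_alongE n (G : fixed_data n) (e : 'I_n -> 'rV[int]_n)
    (w : seq (direction G)) (A : 'I_n -> ratfun n) :
  cluster_along e A w = Apath (dmul G) (gramB G e) (map val w) A.
Proof.
elim: w e A => //= k w IH e A; rewrite IH gramB_mutate; congr Apath.
apply: funext => i; rewrite /mutate_cluster /mutA /mon /epos /eneg.
by case: eqP => // _; congr ((_ + _) / _); apply: eq_bigr => j _; rewrite exchange_eps.
Qed.

Section Glue.
Variables (R : realType) (n : nat) (G : fixed_data n) (s : 'I_n -> 'rV[int]_n).
Hypothesis ss : is_seed G s.
Variable t : seq (direction G).
Implicit Types (w : seq (direction G)) (k : direction G).
Local Notation U := (Iuf G).
Local Notation d := (dmul G).
Local Notation B0 := (gramB G s).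
Local Notation vec w := (map val w : seq 'I_n).

Let d_gt0 i : (0 < d i)%N := dmul_gt0 G i.
Let v0 : valid d U B0 := valid_seed ss.
Let vt : valid d U (gramB G (seed_at s t)) := valid_seed_at t ss.
Let M : 'M[R]_n := seed_mx R (seed_at s t).
Let uM : M \in unitmx := seed_mx_unit R (zspan_seed_at t ss).
Let q w := rev (vec t) ++ vec w.
Let qU w : all (mem U) (q w). Proof. by rewrite all_cat all_rev !all_dir. Qed.
Local Notation cone p := (cone_face d U (gramB G (seed_at s t)) M p finset.set0).
Local Notation F := (cluster_fan d U (gramB G (seed_at s t)) M).

Lemma chamber_cone w : @chamber_in_chart R n G s t w = cone (q w).
Proof.
have E m : seed_val (seed_at s t) m = (fun i => (m *m M) 0 i).
  by apply: funext => i; exact: seed_valE.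
apply/seteqP; split=> m.
  by move=> /(chamber_in_chartE t w ss); rewrite E => H; split=> // i; rewrite inE.
by move=> [H _]; apply/(chamber_in_chartE t w ss); rewrite E.
Qed.

Lemma path_lift (p : seq 'I_n) : all (mem U) p -> exists w, vec w = p.
Proof.
elim: p => [|k p IH]; first by exists [::].
by move=> /andP[kU /IH[w <-]]; exists (exist _ k kU :: w).
Qed.

Lemma cone_chamber p : all (mem U) p -> exists w, cone p = @chamber_in_chart R n G s t w.
Proof.
(* Sequences start at the initial seed, so [t] is prepended; seen from the chart [t] it cancels and
   [p] remains. *)
move=> pU; have [w Ew] := path_lift pU; exists (t ++ w); rewrite chamber_cone.
have E m : coords d (gramB G (seed_at s t)) M (q (t ++ w)) m = coords d (gramB G (seed_at s t)) M p m.
  have tU : all (mem U) (vec t) by apply: all_dir.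
  have rU : all (mem U) (rev (vec t)) by rewrite all_rev.
  rewrite /coords /q map_cat Ew catA tpath_cat tpath_cat Bpath_cat.
  have := tpath_rev (fun i => (m *m M) 0 i) rU vt; rewrite revK => ->.
  by have := Bpath_rev rU vt; rewrite revK => ->.
by apply/seteqP; split=> m [m0 mS]; split=> // [|i]; rewrite ?inE // ?E // -E.
Qed.

Lemma renumber_comp (p p' : 'S_n) (S : labelled_seed n) :
  renumber p (renumber p' S) = renumber (p * p')%g S.
Proof.
rewrite /renumber /=; congr pair; first by apply: funext => i; rewrite permM.
by apply/matrixP => i j; rewrite !mxE !permM.
Qed.

Lemma renumber1 (S : labelled_seed n) : renumber 1%g S = S.
Proof.
case: S => A E; rewrite /renumber /=; congr pair; first by apply: funext => i; rewrite perm1.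
by apply/matrixP => i j; rewrite !mxE !perm1.
Qed.

Lemma vertex_eqP w w' : vertex_at s w = vertex_at s w' <->
  exists p : 'S_n, labelled_seed_at s w' = renumber p (labelled_seed_at s w).
Proof.
split=> [E|[p E]].
  have : vertex_at s w' (labelled_seed_at s w') by exists 1%g => //; rewrite renumber1.
  by rewrite -E => -[p _ <-]; exists p.
rewrite /vertex_at E; apply/seteqP; split=> S [p' _ <-].
  by exists (p' * p^-1)%g => //; rewrite renumber_comp mulgKV.
by exists (p' * p)%g => //; rewrite renumber_comp.
Qed.

Lemma same_labelled_seed w w' (p : 'S_n) :
  labelled_seed_at s w' = renumber p (labelled_seed_at s w) <->
  (forall (a : 'I_n -> rat) i, pos_pt a -> Apath d B0 (vec w') a i = Apath d B0 (vec w) a (p i)) /\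
  (forall i j, eps d (gramB G (seed_at s w')) i j = eps d (gramB G (seed_at s w)) (p i) (p j)).
Proof.
have T (u : seq (direction G)) i := takes_Apath d B0 (vec u) (F := id) (@takes_var n) i.
rewrite /labelled_seed_at /renumber /= !cluster_alongE; split.
  move=> E; have E1 := congr1 fst E; have E2 := congr1 snd E; split=> [a i pa|i j].
    exact: (proj1 (takes_eq (T w' i) (T w (p i))) (congr1 (@^~ i) E1) a pa).
  by have := congr1 (fun A : 'M_n => A i j) E2; rewrite /= !mxE.
move=> [E1 E2]; congr pair.
  apply: funext => i; apply/(takes_eq (T w' i) (T w (p i))) => a pa; exact: E1.
by apply/matrixP => i j; have := E2 i j; rewrite -!exchange_eps !mxE.
Qed.

(** The seed at [w] becomes the new origin, and [same_chamber_cluster] is applied to the path back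
    along [w] and then along [w']. *)
Lemma vertex_chamber w w' : vertex_at s w = vertex_at s w' <->
  @chamber_in_chart R n G s t w = @chamber_in_chart R n G s t w'.
Proof.
have wU := all_dir w; have vw := valid_seed_at w ss.
have rU : all (mem U) (rev (vec w) ++ vec w') by rewrite all_cat all_rev !all_dir.
have EB : gramB G (seed_at s w) = Bpath d B0 (vec w) by exact: gramB_seed_at.
have EB' : Bpath d (gramB G (seed_at s w)) (rev (vec w) ++ vec w') = gramB G (seed_at s w').
  by rewrite EB Bpath_cat (Bpath_rev wU v0) gramB_seed_at.
have EA (a : 'I_n -> rat) : pos_pt a ->
    Apath d (gramB G (seed_at s w)) (rev (vec w) ++ vec w') (Apath d B0 (vec w) a) =
    Apath d B0 (vec w') a.
  by move=> pa; rewrite EB Apath_cat (Apath_rev wU v0) // (Bpath_rev wU v0).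
have sc : same_chamber d U R (gramB G (seed_at s w)) (rev (vec w) ++ vec w') <->
    @chamber_in_chart R n G s t w = @chamber_in_chart R n G s t w'.
  have Ec m : coords d (gramB G (seed_at s t)) M (q w') m =
      tpath d (gramB G (seed_at s w)) (rev (vec w) ++ vec w') (coords d (gramB G (seed_at s t)) M (q w) m).
    have Eq u : Bpath d (gramB G (seed_at s t)) (q u) = gramB G (seed_at s u).
      by rewrite /q gramB_seed_at Bpath_cat (Bpath_rev (all_dir t) v0) gramB_seed_at.
    have rt : Bpath d (gramB G (seed_at s t)) (rev (vec t)) = B0.
      by rewrite gramB_seed_at (Bpath_rev (all_dir t) v0).
    have X u x : tpath d (gramB G (seed_at s t)) (rev (vec t) ++ u) x =
        tpath d B0 u (tpath d (gramB G (seed_at s t)) (rev (vec t)) x) :> ('I_n -> R).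
      by rewrite tpath_cat rt.
    by rewrite /coords /q !X tpath_cat EB (tpath_rev _ wU v0) (Bpath_rev wU v0).
  rewrite !chamber_cone; split=> [S|E x].
    apply/seteqP; split=> m [m0 mS]; split=> [|i]; rewrite ?inE //.
      by rewrite Ec; apply: (proj1 (S _) m0).
    by apply: (proj2 (S _)); rewrite -Ec.
  pose y := tpath d (Bpath d (gramB G (seed_at s t)) (q w)) (rev (q w)) x.
  pose m : 'rV[R]_n := (\row_i y i) *m invmx M.
  have cm : coords d (gramB G (seed_at s t)) M (q w) m = x.
    rewrite /coords /m; have -> : (fun i => ((\row_i y i) *m invmx M *m M) 0 i) = y.
      by apply: funext => i; rewrite mulmxKV // mxE.
    exact: (tpath_revK _ (qU w) vt).
  rewrite -cm -Ec; have := congr1 (fun C : set 'rV[R]_n => C m) E; rewrite /cone_face /= => Em.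
  split=> H.
    by have [] : nonneg U (coords d (gramB G (seed_at s t)) M (q w') m) /\
      (forall i, i \in finset.set0 -> coords d (gramB G (seed_at s t)) M (q w') m i = 0)
      by rewrite -Em; split=> // i; rewrite inE.
  by have [] : nonneg U (coords d (gramB G (seed_at s t)) M (q w) m) /\
      (forall i, i \in finset.set0 -> coords d (gramB G (seed_at s t)) M (q w) m i = 0)
      by rewrite Em; split=> // i; rewrite inE.
rewrite -sc (same_chamber_cluster d_gt0 R rU vw) vertex_eqP.
split=> -[p].
  move=> /same_labelled_seed [E1 E2]; exists p; split=> [a i pa|i j]; last by rewrite EB' E2.
  have rwU : all (mem U) (rev (vec w)) by rewrite all_rev.
  (* Every positive point is the value of the cluster at [w] at some positive initial point, found
     by mutating back. *)
  pose b := Apath d (gramB G (seed_at s w)) (rev (vec w)) a.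
  have pb : pos_pt b by apply: Apath_pos.
  have Eb : Apath d B0 (vec w) b = a.
    have EBr : Bpath d (gramB G (seed_at s w)) (rev (vec w)) = B0.
      by rewrite EB (Bpath_rev wU v0).
    by have := Apath_rev rwU vw pa; rewrite revK EBr.
  by rewrite -{1}Eb EA // E1 // Eb.
move=> [E1 E2]; exists p; apply/same_labelled_seed; split=> [a i pa|i j]; last by rewrite -EB' E2.
by rewrite -EA // E1 //; apply: Apath_pos.
Qed.

(** A vertex is sent to the chamber of a chosen mutation sequence, independent of the choice by
    [vertex_chamber]; the empty set is a default outside the vertices. *)
Definition chamber_of_vertex (X : set (labelled_seed n)) : set 'rV[R]_n :=
  if pselect (exists w, vertex_at s w = X) is left H then chamber_in_chart s t (projT1 (cid H))
  else set0.

Lemma chamber_of_vertexE w : chamber_of_vertex (vertex_at s w) = chamber_in_chart s t w.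
Proof.
rewrite /chamber_of_vertex; case: pselect => [H|[]]; last by exists w.
by apply/vertex_chamber; case: cid.
Qed.

Lemma maximal_chambers : maximal_cones F =
  [set @chamber_in_chart R n G s t w | w in [set: seq (direction G)]].
Proof.
rewrite (cluster_fan_maximal d_gt0 vt uM); apply/seteqP; split=> C.
  by move=> [p /cone_chamber[w Ew] <-]; exists w.
by move=> [w _ <-]; exists (q w); [exact: qU|rewrite chamber_cone].
Qed.

Lemma exchange_dual_iso : graph_iso (exchange_graph G s) (dual_graph F) chamber_of_vertex.
Proof.
have qr w k : q (rcons w k) = rcons (q w) (val k) by rewrite /q map_rcons rcons_cat.
split.
  split.
  - move=> _ [w _ <-]; rewrite chamber_of_vertexE /= maximal_chambers; by exists w.
  - move=> x y; rewrite !inE => -[w _ <-] [w' _ <-]; rewrite !chamber_of_vertexE.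
    by move/vertex_chamber.
  - move=> C; rewrite /= maximal_chambers => -[w _ <-].
    by exists (vertex_at s w); [exists w|exact: chamber_of_vertexE].
move=> _ _ [w _ <-] [w' _ <-]; split.
  move=> [w1 [k [-> ->]]]; rewrite !chamber_of_vertexE !chamber_cone qr.
  apply/(cluster_fan_adjacent d_gt0 vt uM (qU w1)); first by rewrite -qr.
  by exists (val k) => //; exact: valP.
rewrite !chamber_of_vertexE !chamber_cone => /(cluster_fan_adjacent d_gt0 vt uM (qU w) (qU w')).
move=> [k kU E]; exists w, (exist _ k kU); split=> //.
by apply/vertex_chamber; rewrite !chamber_cone qr.
Qed.

End Glue.

Theorem theorem0p8 (R : realType) (n : nat) (G : fixed_data n)
    (s : 'I_n -> 'rV[int]_n) (s_seed : is_seed G s)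
    (v_neq0 : forall i, i \in Iuf G -> covector G (s i) != 0) :
  forall t : seq (direction G),
  exists F : set (set 'rV[R]_n),
    [/\ simplicial_fan F,
        maximal_cones F =
          [set @chamber_in_chart R n G s t w | w in [set: seq (direction G)]]
      & exists f : set (labelled_seed n) -> set 'rV[R]_n,
          graph_iso (exchange_graph G s) (dual_graph F) f /\
          (forall w : seq (direction G),
             f (vertex_at s w) = chamber_in_chart s t w)].
Proof.
move=> t; have vt := valid_seed_at t s_seed.
have uM := seed_mx_unit R (zspan_seed_at t s_seed).
exists (cluster_fan (dmul G) (Iuf G) (gramB G (seed_at s t)) (seed_mx R (seed_at s t))); split.
- exact: (cluster_fan_simplicial (dmul_gt0 G) vt uM).
- exact: maximal_chambers.
exists (@chamber_of_vertex R n G s t); split; first exact: exchange_dual_iso.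
by move=> w; exact: chamber_of_vertexE.
Qed.
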